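(* Let $n\ge 2$ be an integer, let $p=n$, and let $1<Q_1\le Q_2$ be given. Let $A:=\{x\in\mathbf{R}^n : 1/e<|x|<1\}$. Then there are functions $u_1$ and $u_2$ on $A$ such that $u_j$ is a $Q_j$-quasisuperminimizer in $A$ for $j=1,2$, but $\min\{u_1,u_2\}$ is not a $Q_2$-quasisuperminimizer in $A$.
   Context: Let $\Omega\subset\mathbf{R}^n$ be a nonempty open set, $1<p<\infty$ and $Q\ge 1$. A (real-valued) function $u\in W^{1,p}_{\rm loc}(\Omega)$ is a $Q$-quasisuperminimizer in $\Omega$ if $$\int_{\{\varphi\neq 0\}}|\nabla u|^p\,dx\le Q\int_{\{\varphi\neq 0\}}|\nabla(u+\varphi)|^p\,dx$$ for all nonnegative $\varphi\in W^{1,p}_0(\Omega)$. Here the definition is used with $p=n$. *)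

(* Defs.v *)
From HB Require Import structures.
From mathcomp Require Import all_boot all_order all_algebra.
From mathcomp Require Import all_classical all_reals all_analysis.
Set Implicit Arguments.
Unset Strict Implicit.
Unset Printing Implicit Defensive.
Import Order.TTheory GRing.Theory Num.Theory.
Import numFieldNormedType.Exports.
Local Open Scope classical_set_scope.
Local Open Scope ring_scope.

(* The library has no measure on 'rV[R]_n.  We equip 'rV[R]_n with the product
   of the Borel sigma-algebras of its coordinates (as the library does for
   n.-tuple), and define n-dimensional Lebesgue measure by iterating the
   library's product measure. *)
Section rV_measurable.
Context (R : realType) (n : nat).

Let coord (i : 'I_n) (x : 'rV[R]_n) : R := x ord0 i.

Let rV_set0 : g_sigma_preimage coord set0.
Proof. exact: sigma_algebra0. Qed.

Let rV_setC A : g_sigma_preimage coord A -> g_sigma_preimage coord (~` A).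
Proof. exact: sigma_algebraC. Qed.

Let rV_bigcup (F : (set _)^nat) : (forall i, g_sigma_preimage coord (F i)) ->
  g_sigma_preimage coord (\bigcup_i (F i)).
Proof. exact: sigma_algebra_bigcup. Qed.

HB.instance Definition _ := @isMeasurable.Build default_measure_display
  'rV[R]_n (g_sigma_preimage coord) rV_set0 rV_setC rV_bigcup.

Lemma measurable_rV_coord (i : 'I_n) :
  measurable_fun [set: 'rV[R]_n] (fun x : 'rV[R]_n => x ord0 i).
Proof.
move=> _ Y mY; rewrite setTI; apply: sub_sigma_algebra => /=.
rewrite -bigcup_seq/=; exists i => /=; first by rewrite mem_index_enum.
by exists Y => //; rewrite setTI.
Qed.

Lemma measurable_fun_rVP d (T : measurableType d) (f : T -> 'rV[R]_n) :
  (forall i, measurable_fun [set: T] (fun x => f x ord0 i)) ->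
  measurable_fun [set: T] f.
Proof.
move=> mf; suff H : g_sigma_preimage (fun i => coord i \o f) `<=` measurable.
  move=> _ A mA; apply: H; rewrite g_sigma_preimage_comp; exists A => //.
apply: smallest_sub; first exact: sigma_algebra_measurable.
rewrite -bigcup_seq; apply: bigcup_sub => i _ A [B mB <-].
exact: mf.
Qed.

End rV_measurable.

Section lebesgue_rV.
Context (R : realType).

Definition rV_cons n (x : measurableTypeR R * 'rV[R]_n) : 'rV[R]_n.+1 :=
  row_mx (const_mx x.1 : 'rV[R]_1) x.2.

Lemma rV_cons0 n (x : measurableTypeR R * 'rV[R]_n) :
  rV_cons x ord0 ord0 = x.1.
Proof. by rewrite mxE; case: splitP => // j _; rewrite mxE. Qed.

Lemma rV_consS n (x : measurableTypeR R * 'rV[R]_n) i :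
  rV_cons x ord0 (lift ord0 i) = x.2 ord0 i.
Proof.
rewrite mxE; case: splitP => [j|k]; first by rewrite [j]ord1.
by move=> /= [] /val_inj ->.
Qed.

Lemma measurable_rV_cons n : measurable_fun [set: _] (@rV_cons n).
Proof.
apply: measurable_fun_rVP => i; have [j ->|->] := unliftP ord0 i.
  under eq_fun do rewrite rV_consS.
  exact: (measurableT_comp (@measurable_rV_coord R n j) measurable_snd).
by under eq_fun do rewrite rV_cons0; exact: measurable_fst.
Qed.

Section step.
Context n (mu : {sigma_finite_measure set 'rV[R]_n -> \bar R}).
Local Open Scope ereal_scope.

Definition lebesgue_cons : set 'rV[R]_n.+1 -> \bar R :=
  pushforward (lebesgue_measure \x mu) (@rV_cons n).

Let rV_uncons (x : 'rV[R]_n.+1) : measurableTypeR R * 'rV[R]_n :=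
  (x ord0 ord0, \row_j x ord0 (lift ord0 j)).

Let rV_consK : cancel (@rV_cons n) rV_uncons.
Proof.
move=> x; rewrite /rV_uncons rV_cons0 [RHS]surjective_pairing; congr pair.
by apply/rowP => j; rewrite mxE rV_consS.
Qed.

Let measurable_rV_uncons : measurable_fun [set: _] rV_uncons.
Proof.
apply: measurable_fun_pair; first exact: measurable_rV_coord.
apply: measurable_fun_rVP => i; under eq_fun do rewrite mxE.
exact: measurable_rV_coord.
Qed.


Let nu := measure_function_pushforward__canonical__measure_function_Measure
  (lebesgue_measure \x mu) (@measurable_rV_cons n).

HB.instance Definition _ := isMeasure.Build _ _ _ lebesgue_cons
  (measure0 nu) (measure_ge0 nu) (@measure_semi_sigma_additive _ _ _ nu).

Let lebesgue_cons_sigma_finite : sigma_finite setT lebesgue_cons.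
Proof.
have /sigma_finiteP[F [TF ndF Foo]] := sigma_finiteT (@lebesgue_measure R).
have /sigma_finiteP[G [TG ndG Goo]] := sigma_finiteT mu.
exists (fun k => rV_uncons @^-1` (F k `*` G k)) => [|k].
  apply/esym; rewrite -subTset => x _.
  have [i _ Fi] : (\bigcup_i F i) (rV_uncons x).1 by rewrite -TF.
  have [j _ Gj] : (\bigcup_i G i) (rV_uncons x).2 by rewrite -TG.
  exists (maxn i j) => //; split.
  - by move: Fi; exact/subsetPset/ndF/leq_maxl.
  - by move: Gj; exact/subsetPset/ndG/leq_maxr.
have [mF Fk] := Foo k; have [mG Gk] := Goo k; split.
  rewrite -[X in measurable X]setTI; apply: measurable_rV_uncons => //.
  exact: measurableX.
rewrite /lebesgue_cons /pushforward -comp_preimage.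
rewrite (_ : _ \o _ = id) ?preimage_id; last exact/funext/rV_consK.
by rewrite product_measure1E// lte_mul_pinfty// ge0_fin_numE.
Qed.

HB.instance Definition _ := Measure_isSigmaFinite.Build _ _ _ lebesgue_cons
  lebesgue_cons_sigma_finite.

End step.

Fixpoint lebesgue_rV n : {sigma_finite_measure set 'rV[R]_n -> \bar R} :=
  if n is n'.+1 then lebesgue_cons (lebesgue_rV n') else \d_(0 : 'rV[R]_0).

End lebesgue_rV.

Lemma lebesgue_rV_prod (R : realType) n (B : 'I_n -> set R) :
  (forall i, measurable (B i)) ->
  lebesgue_rV R n [set x | forall i, B i (x ord0 i)] =
  (\prod_(i < n) lebesgue_measure (B i))%E.
Proof.
elim: n B => [|n IHn] B mB.
  rewrite big_ord0 /= diracE mem_set//= => -[]//.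
rewrite big_ord_recl -IHn => [|i]; last exact: mB.
have mtail : measurable [set y : 'rV[R]_n | forall i, B (lift ord0 i) (y ord0 i)].
  rewrite (_ : mkset _ = \bigcap_(i in [set: 'I_n])
      (fun y : 'rV[R]_n => y ord0 i) @^-1` B (lift ord0 i)).
    apply: fin_bigcap_measurable => // i _; rewrite -[X in measurable X]setTI.
    exact: measurable_rV_coord.
  by apply/seteqP; split => [y By i _|y By i]; exact: By.
rewrite -product_measure1E//; last exact: mB.
rewrite /= /lebesgue_cons /pushforward.
congr (product_measure1 _ _ _); apply/seteqP; split => -[t y] /=.
- move=> Bx; split => [|i]; first by have := Bx ord0; rewrite rV_cons0.
  by have := Bx (lift ord0 i); rewrite rV_consS.
- by move=> [Bt By] i; case: (unliftP ord0 i) => [j ->|->];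
    rewrite ?rV_consS ?rV_cons0.
Qed.

Section sobolev.
Context (R : realType) (n : nat).
Implicit Types (Omega K : set 'rV[R]_n) (u phi psi : 'rV[R]_n -> R) (p Q : R).

Local Notation mu := (lebesgue_rV R n).

(* Euclidean norm; the library's norm on 'rV[R]_n is the sup norm, which
   induces the same topology. *)
Definition enorm (x : 'rV[R]_n) : R := Num.sqrt (\sum_i x ord0 i ^+ 2).

Definition partial (i : 'I_n) u : 'rV[R]_n -> R :=
  fun x => 'D_(delta_mx ord0 i) u x.

Definition smooth u := forall s : seq 'I_n,
  let v := foldr partial u s in
  continuous v /\ forall i x, derivable v x (delta_mx ord0 i).

(* C_c^oo(Omega); its elements are extended by 0 to all of 'rV[R]_n. *)
Definition test_function Omega psi :=
  [/\ smooth psi, compact (closure [set x | psi x != 0])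
    & closure [set x | psi x != 0] `<=` Omega].

(* All notions below depend only on the values of the functions in Omega. *)
Definition Lp Omega p u := u \_ Omega \in Lfun mu p%:E.

Definition Lp_loc Omega p u :=
  forall K, compact K -> K `<=` Omega -> Lp K p u.

Definition is_weak_gradient Omega u (g : 'rV[R]_n -> 'rV[R]_n) :=
  [/\ Lp_loc Omega 1 u, forall i, Lp_loc Omega 1 (fun x => g x ord0 i)
    & forall psi, test_function Omega psi -> forall i,
      \int[mu]_(x in Omega) (u x * partial i psi x) =
      - \int[mu]_(x in Omega) (g x ord0 i * psi x)].

Definition weakly_differentiable Omega u := exists g, is_weak_gradient Omega u g.

(* A representative of the weak gradient, which is unique almost everywhere
   in Omega; meaningful only if u is weakly differentiable in Omega. *)
Definition gradient Omega u : 'rV[R]_n -> 'rV[R]_n :=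
  xget (cst 0) [set g | is_weak_gradient Omega u g].

Definition W1p Omega p u := [/\ Lp Omega p u, weakly_differentiable Omega u
  & forall i, Lp Omega p (fun x => gradient Omega u x ord0 i)].

Definition W1p_loc Omega p u := [/\ Lp_loc Omega p u,
  weakly_differentiable Omega u
  & forall i, Lp_loc Omega p (fun x => gradient Omega u x ord0 i)].

Definition W1p_norm Omega p u : \bar R :=
  ('N[mu]_p%:E[EFin \o (u \_ Omega)] +
   'N[mu]_p%:E[EFin \o ((enorm \o gradient Omega u) \_ Omega)])%E.

(* The closure of C_c^oo(Omega) in W^{1,p}(Omega). *)
Definition W1p0 Omega p u := W1p Omega p u /\
  forall eps : R, 0 < eps -> exists2 psi, test_function Omega psi &
    (W1p_norm Omega p (u \- psi)%R < eps%:E)%E.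

Definition quasisuperminimizer Omega p Q u := W1p_loc Omega p u /\
  forall phi, W1p0 Omega p phi ->
  {ae mu, forall x, Omega x -> 0 <= phi x} ->
  (\int[mu]_(x in Omega `&` [set x | phi x != 0%R])
     (enorm (gradient Omega u x) `^ p)%:E <=
   Q%:E * \int[mu]_(x in Omega `&` [set x | phi x != 0%R])
     (enorm (gradient Omega (u \+ phi)%R x) `^ p)%:E)%E.

Definition annulus : set 'rV[R]_n :=
  [set x | (expR 1)^-1 < enorm x < 1].

End sobolev.

Arguments annulus : clear implicits.

(* Main.v *)
Require Import Defs.
From HB Require Import structures.
From mathcomp Require Import all_boot all_order all_algebra.
From mathcomp Require Import all_classical all_reals all_analysis.
From mathcomp Require Import measurable_realfun ring lra.
Set Implicit Arguments.
Unset Strict Implicit.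
Unset Printing Implicit Defensive.
Import Order.TTheory GRing.Theory Num.Theory.
Import numFieldNormedType.Exports.
Local Open Scope classical_set_scope.
Local Open Scope ring_scope.

(* In the variable t = - ln |x| ([lgr x]), with values in (0, 1), the n-energy
   of a radial function f(t) is, up to a constant, the integral of |f'(t)|^n dt.
   Since the field x / |x|^n is divergence free, any function H(t, z) with
   H(t, 0) = 0 gives, for phi in W^{1,n}_0, an integral of (d/dt) H(t, phi) that
   vanishes; hence f o t is a Q-quasisuperminimizer as soon as
   H_t(t, z) + H_z(t, z) s <= Q |f'(t) + s|^n - |f'(t)|^n for z >= 0.
   With H = Q n z this holds when f' takes values in [al, be], where al < 1 < be are
   the points at which the tangent of Q w^n at w = 1 meets w^n; with H built from
   (t + d) ((f + z) / (t + d))^n it holds for f = C (t + d)^g + const when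
   g^n <= Q (n g - n + 1).

   Let f2 have slope al up to a point and slope nearly be afterwards, normalised by
   f2(0) = 0 and f2(1) = 1, so that it is nearly extremal: its energy almost equals
   Q2 times the energy of the identity. Let f1 be of the power type, below f2 on
   (0, b) with b in the range of slope al, and above f2 afterwards. By strict
   convexity, replacing f2 by f1 on (0, b) raises the energy by a fixed amount,
   whatever the smoothing parameter of f2, so the energy of min (f1, f2) exceeds Q2
   times that of the identity, a competitor above the minimum. *)

(** * Boxes and integration by parts in 'rV[R]_n *)

(** Two features of the definition shape the argument. Energies are taken over the set where [phi]
    is nonzero, while the calibration integral lives on the whole annulus; the two agree because the
    gradient of a function in W^{1,n}_0 vanishes almost everywhere on its zero set. And the identity
    profile differs from the minimum right up to the boundary spheres, so it is only a limit of
    admissible competitors, obtained by smooth truncation. The energy balance is exact. Write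
    [f1'^n] against its tangent at [al] and [f2'^n] against the tangent line of [Q2 w^n] at 1: the
    linear terms integrate to zero, because [f1] and [f2] agree at 0 and b, and [f2] and the
    identity agree at 0 and 1. What remains is a gain from [f1] on (0, b) and a loss measuring how
    far [f2'] is from taking only the values [al] and [be]. The assumption Q1 > 1 provides an
    exponent g > 1, and g > 1 makes the slope of [f1] near 0 smaller than [al] once the shift d is
    small. The shift itself keeps [f1] smooth up to t = 0 and the quotients (f + z) / (t + d) under
    control. *)

Section rVbasic.
Context (R : realType) (n : nat).
Implicit Types (U : set 'rV[R]_n) (a b : 'rV[R]_n).

Definition obox a b : set 'rV[R]_n := [set x | forall i, `]a ord0 i, b ord0 i[%classic (x ord0 i)].

Definition cbox a b : set 'rV[R]_n := [set x | forall i, `[a ord0 i, b ord0 i]%classic (x ord0 i)].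

Lemma measurable_obox a b : measurable (obox a b).
Proof.
rewrite (_ : obox a b = \bigcap_(i in [set: 'I_n])
    (fun y : 'rV[R]_n => y ord0 i) @^-1` `]a ord0 i, b ord0 i[%classic).
  apply: fin_bigcap_measurable => // i _; rewrite -[X in measurable X]setTI.
  exact: measurable_rV_coord.
by apply/seteqP; split => [y By i _|y By i]; exact: By.
Qed.

Lemma obox_sub_cbox a b : obox a b `<=` cbox a b.
Proof. by move=> x xab i; apply: subset_itv_oo_cc; exact: xab. Qed.

Lemma compact_cbox a b : compact (cbox a b).
Proof.
by apply: (@rV_compact R n (fun i => `[a ord0 i, b ord0 i]%classic)) => i; exact: segment_compact.
Qed.

(** Corners of the boxes with rational centre and half-side 1/(m+1); the index type is countable, so
    unions over these boxes are countable. *)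
Definition rat_lo (q : 'rV[rat]_n * nat) : 'rV[R]_n := \row_i (ratr (q.1 ord0 i) - q.2.+1%:R^-1).

Definition rat_hi (q : 'rV[rat]_n * nat) : 'rV[R]_n := \row_i (ratr (q.1 ord0 i) + q.2.+1%:R^-1).

Lemma open_rat_box U x : open U -> U x ->
  exists q, obox (rat_lo q) (rat_hi q) x /\ cbox (rat_lo q) (rat_hi q) `<=` U.
Proof.
move=> oU Ux; have : nbhs x U by exact: open_nbhs_nbhs.
rewrite -nbhs_ballE => -[e e0 eU].
have [k ke] : exists k : nat, k.+1%:R^-1 < e / 2.
  have [k] := ltr_add_invr (divr_gt0 e0 (ltr0n _ 2)); rewrite add0r => H.
  by exists k.
have /choice[q hq] : forall i, exists q : rat, `|ratr q - x ord0 i| < k.+1%:R^-1.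
  move=> i; have k0 : (0 < k.+1%:R^-1 :> R) by rewrite invr_gt0.
  have xx : x ord0 i - k.+1%:R^-1 < x ord0 i + k.+1%:R^-1 by rewrite ltrD2l gtrN.
  have [q] := rat_in_itvoo xx.
  by rewrite in_itv/= => qP; exists q; rewrite ltr_distl.
exists (\row_i q i, k); split => [i|y By].
  by rewrite /= !mxE in_itv/= -ltr_distlC.
apply: eU; split => // i0 i; rewrite [i0]ord1 /ball/=.
have := By i; rewrite /= !mxE in_itv/= -ler_distlC => h1; have h2 := hq i.
rewrite (_ : x _ _ - _ = (ratr (q i) - y ord0 i) - (ratr (q i) - x ord0 i)); last by ring.
rewrite (le_lt_trans (ler_normB _ _))// [ltRHS](splitr e).
by rewrite ltrD// ?(le_lt_trans h1)// (lt_trans _ ke).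
Qed.

(** The sigma-algebra is generated by the coordinates, not by the open sets; an open set is
    recovered as the union of the countably many open rational boxes contained in it. *)
Lemma open_measurable_rV U : open U -> measurable U.
Proof.
move=> oU; pose B q := obox (rat_lo q) (rat_hi q).
have -> : U = \bigcup_q (if `[< B q `<=` U >] then B q else set0).
  apply/seteqP; split => [x Ux|x [q _]]; last by case: ifPn => // /asboolP; exact.
  have [q [Bx qU]] := open_rat_box oU Ux; exists q => //.
  by rewrite ifT//; apply/asboolP => y /obox_sub_cbox /qU.
by apply: countable_bigcupT_measurable => // q; case: ifP => // _; exact: measurable_obox.
Qed.

Lemma continuous_measurable_rV U (f : 'rV[R]_n -> R) : open U ->
  (forall x, U x -> {for x, continuous f}) -> measurable_fun U f.
Proof.
move=> oU cf; apply: (measurability _ (RGenOpens.measurableE R)).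
move=> /= _ [_ [a [b ->]] <-]; apply: open_measurable_rV.
rewrite openE => x [Ux /= fx]; near=> y; split; first by near: y; exact: open_nbhs_nbhs.
by near: y; apply: (cf x Ux); apply: open_nbhs_nbhs; split => //; exact: interval_open.
Unshelve. all: by end_near. Qed.

End rVbasic.

Section boxes.
Context (R : realType).

Definition box n (M : R) : set 'rV[R]_n := [set x | forall i, `[- M, M]%classic (x ord0 i)].

Lemma measurable_box n M : measurable (@box n M).
Proof.
rewrite (_ : @box n M = \bigcap_(i in [set: 'I_n])
    (fun y : 'rV[R]_n => y ord0 i) @^-1` `[- M, M]%classic).
  apply: fin_bigcap_measurable => // i _; rewrite -[X in measurable X]setTI.
  exact: measurable_rV_coord.
by apply/seteqP; split => [y By i _|y By i]; exact: By.
Qed.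

Lemma lebesgue_rV_box n M : (lebesgue_rV R n (@box n M) < +oo)%E.
Proof.
rewrite (@lebesgue_rV_prod R n (fun=> `[- M, M]%classic))//.
set v := lebesgue_measure _.
have /andP[v0 vy] : (0 <= v < +oo)%E.
  rewrite /v measure_ge0/= lebesgue_measure_itv/=.
  by case: ifP => _; rewrite ?ltry// -EFinB ltry.
suff /andP[] : (0 <= \prod_(i < n) v < +oo)%E by [].
elim/big_ind : _ => [|x y /andP[x0 xy] /andP[y0 yy]|i _].
- by rewrite lee01 ltry.
- by rewrite mule_ge0// lte_mul_pinfty// ge0_fin_numE.
- by rewrite v0 vy.
Qed.

Lemma bounded_box_integrable n (f : 'rV[R]_n -> R) (K M : R) :
  measurable_fun [set: 'rV[R]_n] f -> (forall x, `|f x| <= K) ->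
  (forall x, ~ box M x -> f x = 0) ->
  (lebesgue_rV R n).-integrable [set: 'rV[R]_n] (EFin \o f).
Proof.
move=> mf fK f0.
rewrite (_ : _ \o _ = (EFin \o f) \_ (box M)); last first.
  apply/funext => x; rewrite patchE; case: ifPn => //= /negP.
  by rewrite inE => /f0 ->.
apply/integrable_restrict; rewrite ?setTI//; first exact: measurable_box.
apply: measurable_bounded_integrable; first exact: measurable_box.
- exact: lebesgue_rV_box.
- exact: measurable_funTS.
- by exists K; split; rewrite ?num_real// => N KN x _ /=; exact: le_trans (fK x) (ltW KN).
Qed.

End boxes.

(** * Vanishing integrals of partial derivatives *)

Section ibp.
Context (R : realType).

Lemma integral_derive_compact (G g : R -> R) (M : R) :
  (forall s : R, is_derive s 1 G (g s)) -> continuous g ->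
  (forall s, M < `|s| -> G s = 0) -> (forall s, M < `|s| -> g s = 0) ->
  (\int[lebesgue_measure]_s (g s)%:E = 0)%E.
Proof.
(* [N] strictly exceeds [M], so that [G] vanishes at both endpoints of [I]. *)
move=> dG cg G0 g0; pose N : R := `|M| + 1; pose I : set R := `[- N, N]%classic.
have MN : M < N by rewrite ltr_pwDr// ler_norm.
have N0 : 0 < N by rewrite ltr_wpDl.
have cG : continuous G.
  by move=> s; apply/differentiable_continuous/derivable1_diffP; have [] := dG s.
transitivity (\int[lebesgue_measure]_(s in I) (g s)%:E)%E.
  rewrite [RHS]integral_mkcond; apply: eq_integral => s _.
  rewrite patchE; case: ifPn => // /negP; rewrite inE /I /= in_itv/= => /negP sN.
  by rewrite g0// (lt_trans MN)// ltNge ler_norml.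
rewrite (@continuous_FTC2 _ g G)//.
- by rewrite !G0 ?subee// ?normrN gtr0_norm.
- by rewrite gtrN.
- exact: continuous_subspaceT.
- split => [s _||].
  + by have [] := dG s.
  + apply: cvg_at_right_filter; exact: cG.
  + apply: cvg_at_left_filter; exact: cG.
- by move=> s _; rewrite derive1E; have [_ ->] := dG s.
Qed.

Lemma coord_shift n (x : 'rV[R]_n) (s : R) i j :
  (x + s *: delta_mx ord0 i) ord0 j = x ord0 j + s * (j == i)%:R.
Proof. by rewrite !mxE. Qed.

Lemma rV_consD n (t s : R) (y : 'rV[R]_n) :
  rV_cons (t + s, y) = rV_cons (t, y) + s *: delta_mx ord0 ord0.
Proof.
apply/rowP => i; rewrite coord_shift; case: (unliftP ord0 i) => [j ->|->].
  by rewrite !rV_consS /= mulr0 addr0.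
by rewrite !rV_cons0 /= mulr1.
Qed.

Lemma rV_consDS n (t s : R) (y : 'rV[R]_n) j :
  rV_cons (t, y + s *: delta_mx ord0 j) =
  rV_cons (t, y) + s *: delta_mx ord0 (lift ord0 j).
Proof.
apply/rowP => i; rewrite coord_shift; case: (unliftP ord0 i) => [k ->|->].
  by rewrite !rV_consS coord_shift (inj_eq lift_inj).
by rewrite !rV_cons0 /= mulr0 addr0.
Qed.

(** Induction on the dimension by Fubini, splitting off the first coordinate. If [i] is another
    coordinate, the inner integral over the tail vanishes by induction; if [i] is the first one, the
    order is exchanged and the inner integral vanishes by the fundamental theorem of calculus.
    Derivatives are assumed along lines only, so the hypotheses pass to slices. *)
Lemma integral_partial0 n (w d : 'rV[R]_n -> R) (i : 'I_n) (K M : R) :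
  (forall x (s : R), is_derive s 1 (fun r : R => w (x + r *: delta_mx ord0 i))
     (d (x + s *: delta_mx ord0 i))) ->
  (forall x, continuous (fun s : R => d (x + s *: delta_mx ord0 i))) ->
  measurable_fun [set: 'rV[R]_n] d -> (forall x, `|d x| <= K) ->
  (forall x, ~ box M x -> w x = 0) -> (forall x, ~ box M x -> d x = 0) ->
  (\int[lebesgue_rV R n]_x (d x)%:E = 0)%E.
Proof.
elim: n w d i => [w d []//|n IHn w d i dw cd md dK w0 d0].
have ibox t (y : 'rV[R]_n) : box M (rV_cons (t, y)) <-> `[- M, M]%classic t /\ box M y.
  split => [H|[tM yM] k].
    split; first by have := H ord0; rewrite rV_cons0.
    by move=> k; have := H (lift ord0 k); rewrite rV_consS.
  by case: (unliftP ord0 k) => [j ->|->]; rewrite ?rV_consS ?rV_cons0//; exact: yM.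
have mcons := @measurable_rV_cons R n.
have id := bounded_box_integrable md dK d0.
have idc : (lebesgue_measure \x lebesgue_rV R n)%E.-integrable setT ((EFin \o d) \o (@rV_cons R n)).
  apply/integrableP; split.
    apply: measurableT_comp => //; exact: measurableT_comp.
  move/integrableP : id => [_]; rewrite /= /lebesgue_cons.
  rewrite ge0_integral_pushforward//.
  by apply: measurableT_comp => //; apply: measurableT_comp => //.
rewrite /= /lebesgue_cons integral_pushforward//; last exact/measurable_EFinP.
rewrite preimage_setT.
case: (unliftP ord0 i) => [j ij|i0].
  rewrite -integral12_prod_meas1//.
  apply: integral0_eq => t _.
  apply: (IHn (fun y => w (rV_cons (t, y))) (fun y => d (rV_cons (t, y))) j).
  - move=> x s; under eq_fun do rewrite rV_consDS -ij; rewrite rV_consDS -ij; exact: dw.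
  - move=> x; under eq_fun do rewrite rV_consDS -ij; exact: cd.
  - apply: (measurableT_comp md); apply: (measurableT_comp mcons).
    exact: pair1_measurable.
  - by move=> x.
  - by move=> x xM; apply: w0 => /ibox[].
  - by move=> x xM; apply: d0 => /ibox[].
rewrite -integral21_prod_meas1//.
apply: integral0_eq => y _.
have E r : rV_cons (r, y) = rV_cons (0, y) + r *: delta_mx ord0 i.
  by rewrite i0 -rV_consD add0r.
apply: (@integral_derive_compact (fun t => w (rV_cons (t, y))) (fun t => d (rV_cons (t, y))) M).
- move=> s.
  have -> : (fun t : R => w (rV_cons (t, y))) =
      (fun t : R => w (rV_cons ((0 : R), y) + t *: delta_mx ord0 i)).
    by apply/funext => t; rewrite (E t).
  by rewrite (E s); exact: dw.
- have -> : (fun t : R => d (rV_cons (t, y))) =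
      (fun t : R => d (rV_cons ((0 : R), y) + t *: delta_mx ord0 i)).
    by apply/funext => t; rewrite (E t).
  exact: cd.
- move=> s Ms; apply: w0 => /ibox[+ _]; rewrite /= in_itv/= -ler_norml leNgt Ms//.
- move=> s Ms; apply: d0 => /ibox[+ _]; rewrite /= in_itv/= -ler_norml leNgt Ms//.
Qed.

End ibp.

Lemma continuous_near_eq (T U : topologicalType) (f g : T -> U) x :
  (\forall y \near x, f y = g y) -> {for x, continuous g} -> {for x, continuous f}.
Proof.
move=> fg cg; rewrite /prop_for /continuous_at (nbhs_singleton fg).
by apply: cvg_trans cg; apply: near_eq_cvg; apply: filterS fg.
Qed.

Lemma cont_add (T : topologicalType) (R : realType) (f g : T -> R) x : {for x, continuous f} ->
  {for x, continuous g} -> {for x, continuous (fun y => f y + g y)}.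
Proof. by move=> cf cg; exact: (cvgD cf cg). Qed.

Lemma cont_mul (T : topologicalType) (R : realType) (f g : T -> R) x : {for x, continuous f} ->
  {for x, continuous g} -> {for x, continuous (fun y => f y * g y)}.
Proof. by move=> cf cg; exact: (cvgM cf cg). Qed.

Lemma cont_opp (T : topologicalType) (R : realType) (f : T -> R) x : {for x, continuous f} ->
  {for x, continuous (fun y => - f y)}.
Proof. by move=> cf; exact: (cvgN cf). Qed.

Lemma cont_comp (S T U : topologicalType) (K : T -> U) (f : S -> T) x : {for x, continuous f} ->
  {for f x, continuous K} -> {for x, continuous (fun y => K (f y))}.
Proof. by move=> cf cK; exact: (continuous_comp cf cK). Qed.

Section derive_line.
Context (R : realType).

Lemma is_derive_line (V : normedModType R) (f : V -> R) (x v : V) (s d : R) :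
  is_derive s 1 (fun r : R => f (x + r *: v)) d <-> is_derive (x + s *: v) v f d.
Proof.
have E : (fun h : R => h^-1 *: (((fun r : R => f (x + r *: v)) \o shift s) (h *: 1) -
            f (x + s *: v))) =
          (fun h : R => h^-1 *: ((f \o shift (x + s *: v)) (h *: v) - f (x + s *: v))).
  apply/funext => h /=; congr (_ *: (f _ - _)).
  by rewrite [h *: 1]mulr1 scalerDl addrCA.
split => -[dr <-]; split.
- by move: dr; rewrite /derivable E.
- by rewrite /derive E.
- by rewrite /derivable E.
- by rewrite /derive E.
Qed.

(** Only the derivative of [f] along [v] is involved: restricted to the line, this is the
    one-variable chain rule. *)
Lemma is_derive_comp (V : normedModType R) (K : R -> R) (f : V -> R) (x v : V) (k d : R) :
  is_derive (f x) 1 K k -> is_derive x v f d -> is_derive x v (K \o f) (k * d).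
Proof.
move=> dK df; have {}df : is_derive (0 : R) 1 (fun r : R => f (x + r *: v)) d.
  by apply/is_derive_line; rewrite scale0r addr0.
rewrite -[x]addr0 -(scale0r v); apply/is_derive_line.
apply: (@is_derive1_comp R K (fun r : R => f (x + r *: v))) => //.
by rewrite scale0r addr0.
Qed.

End derive_line.

Section domain.
Context (R : realType) (n : nat).
Implicit Types (Omega C : set 'rV[R]_n).
Local Notation mu := (lebesgue_rV R n).
Local Notation e_ i := (delta_mx ord0 i : 'rV[R]_n).

Lemma le_coord_norm (x : 'rV[R]_n) i : `|x ord0 i| <= `|x|.
Proof. by rewrite [leRHS]/Num.Def.normr /= mx_normrE; apply/bigmax_geP; right; exists (ord0, i). Qed.

Lemma compact_sub_box C : compact C -> exists M : R, C `<=` box M.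
Proof.
move=> /compact_bounded[M [_ /(_ (M + 1))]]; rewrite ltrDl ltr01 => /(_ isT) CM.
exists (M + 1) => x /CM /= xM i; rewrite /= in_itv/= -ler_norml.
by apply: le_trans xM; exact: le_coord_norm.
Qed.

(** Since [w] vanishes off the compact set [C], so does [d] on the rest of [Omega]; extended by 0 it
    is continuous on the whole space, with bounded support, and is still the derivative of [w]
    everywhere. *)
Lemma ibp_open Omega C (w d : 'rV[R]_n -> R) i : open Omega -> compact C -> C `<=` Omega ->
  (forall x, ~ C x -> w x = 0) -> (forall x, Omega x -> is_derive x (e_ i) w (d x)) ->
  (forall x, Omega x -> {for x, continuous d}) ->
  [/\ (forall x, Omega x -> ~ C x -> d x = 0), mu.-integrable Omega (EFin \o d) &
      (\int[mu]_(x in Omega) (d x)%:E = 0)%E].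
Proof.
move=> oO cC CO w0 dw cd.
have oC : open (~` C) by apply: closed_openC; apply: compact_closed => //; exact: norm_hausdorff.
have w0n x : ~ C x -> is_derive x (e_ i) w 0.
  move=> Cx; apply: (@near_eq_is_derive R _ R (cst 0) w x (e_ i) 0).
  by apply: filterS (open_nbhs_nbhs (conj oC Cx)) => y Cy; rewrite (w0 y).
have d0 x : Omega x -> ~ C x -> d x = 0.
  by move=> Ox /w0n [_ <-]; have [_ <-] := dw x Ox.
pose D := d \_ Omega.
have DE x : ~ C x -> D x = 0.
  by rewrite /D patchE => Cx; case: ifPn => //; rewrite inE => /d0; exact.
have cD x : {for x, continuous D}.
  have [Ox|nOx] := pselect (Omega x).
    apply: continuous_near_eq (cd x Ox).
    by apply: filterS (open_nbhs_nbhs (conj oO Ox)) => y Oy; rewrite /D patchE mem_set.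
  have Cx : ~ C x by move=> /CO.
  apply: (@continuous_near_eq _ _ _ (cst (0 : R))); last exact: cst_continuous.
  by apply: filterS (open_nbhs_nbhs (conj oC Cx)) => y Cy; rewrite (DE y Cy).
have dD x : is_derive x (e_ i) w (D x).
  have [Ox|nOx] := pselect (Omega x); first by rewrite /D patchE mem_set//; exact: dw.
  have Cx : ~ C x by move=> /CO.
  by rewrite (DE x Cx); exact: w0n.
have mD : measurable_fun [set: 'rV[R]_n] D.
  by apply: continuous_measurable_rV => //; exact: openT.
have [K DK] : exists K, forall x, `|D x| <= K.
  have : compact (D @` C).
    apply: continuous_compact => //; exact: continuous_subspaceT.
  move=> /compact_bounded[K [_ /(_ (`|K| + 1))]].
  rewrite (le_lt_trans (ler_norm K)) ?ltrDl// => /(_ isT) KP.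
  exists (`|K| + 1) => x; have [Cx|Cx] := pselect (C x).
    by apply: KP; exists x.
  by rewrite (DE x Cx) normr0 addr_ge0.
have [M CM] := compact_sub_box cC.
have w0' x : ~ box M x -> w x = 0 by move=> xM; apply: w0 => /CM.
have d0' x : ~ box M x -> D x = 0 by move=> xM; apply: DE => /CM.
have iD := bounded_box_integrable mD DK d0'.
have mO := open_measurable_rV oO.
have EE : EFin \o D = (EFin \o d) \_ Omega.
  by apply/funext => x; rewrite /D /= !patchE; case: ifP.
split => //.
  by move: iD; rewrite EE => /integrable_restrict; rewrite setTI; apply.
rewrite integral_mkcond -EE; apply: (@integral_partial0 R n w D i K M) => //.
  by move=> x s; apply/is_derive_line.
move=> x s; apply: (@continuous_comp _ _ _ (fun r : R => x + r *: e_ i) D) => //.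
apply: cvgD; first exact: cvg_cst.
by apply: cvgZr_tmp; exact: cvg_id.
Qed.

End domain.

(** * Smooth functions and test functions *)

Section derive_rules.
Context (R : realType) (V : normedModType R).
Implicit Types (f g : V -> R) (x v : V) (a b c : R).

Lemma isD_add f g x v a b : is_derive x v f a -> is_derive x v g b ->
  is_derive x v (fun y => f y + g y) (a + b).
Proof. by move=> df dg; exact: is_deriveD. Qed.

Lemma isD_mul f g x v a b : is_derive x v f a -> is_derive x v g b ->
  is_derive x v (fun y => f y * g y) (a * g x + f x * b).
Proof. by move=> df dg; apply: is_derive_eq; rewrite addrC [_ *: a]mulrC. Qed.

Lemma isD_cst c x v : is_derive x v (fun=> c) 0.
Proof. exact: is_derive_cst. Qed.

Lemma isD_scale c f x v a : is_derive x v f a -> is_derive x v (fun y => c * f y) (c * a).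
Proof. by move=> df; have := isD_mul (isD_cst c x v) df; rewrite mul0r add0r. Qed.

Lemma isD_opp f x v a : is_derive x v f a -> is_derive x v (fun y => - f y) (- a).
Proof. by move=> df; exact: is_deriveN. Qed.

Lemma isD_sub f g x v a b : is_derive x v f a -> is_derive x v g b ->
  is_derive x v (fun y => f y - g y) (a - b).
Proof. by move=> df dg; exact: is_deriveB. Qed.

Lemma isD_exp f x v a n : is_derive x v f a ->
  is_derive x v (fun y => f y ^+ n) (n%:R * f x ^+ n.-1 * a).
Proof.
have -> : (fun y => f y ^+ n) = f ^+ n by apply/funext => y; rewrite exprfctE.
by move=> df; exact: is_deriveX.
Qed.

End derive_rules.

Lemma isD_inv (R : realType) (x : R) : x != 0 -> is_derive x 1 (@GRing.inv R) (- x^-1 ^+ 2).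
Proof.
move=> x0; have := @is_deriveV R id x 1 1 x0 (is_derive_id _ _).
by rewrite [_ *: 1]mulr1 exprVn.
Qed.

Section smooth1.
Context (R : realType).

Definition smooth1 (V : set R) (K : R -> R) :=
  forall k x, V x -> derivable (derive1n k K) x 1.

(** A family closed under differentiation consists of smooth functions: every iterated derivative is
    again a member. *)
Lemma smooth1_family (I : Type) (F : I -> R -> R) (V : set R) : open V ->
  (forall i, exists j, forall x, V x -> is_derive x 1 (F i) (F j x)) ->
  forall i, smooth1 V (F i).
Proof.
move=> oV dF.
suff H k i : exists j, forall x, V x -> derive1n k (F i) x = F j x.
  move=> i k x Vx; have [j Fj] := H k i; have [l Fl] := dF j.
  apply: (@near_eq_derivable R _ R (F j)); last by have [] := Fl x Vx.
  by apply: filterS (open_nbhs_nbhs (conj oV Vx)) => y Vy; rewrite Fj.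
elim: k i => [|k IHk] i; first by exists i.
have [j Fj] := IHk i; have [l Fl] := dF j; exists l => x Vx.
rewrite derive1nS derive1E -(@near_eq_derive R _ R (F j)); first by have [] := Fl x Vx.
by apply: filterS (open_nbhs_nbhs (conj oV Vx)) => y Vy; rewrite Fj.
Qed.

Lemma smooth1_derive V K : smooth1 V K -> smooth1 V (derive1 K).
Proof. by move=> sK k x Vx; rewrite -derive1Sn; exact: sK. Qed.

Lemma smooth1_expR : smooth1 setT (@expR R).
Proof.
apply: (@smooth1_family unit (fun=> expR)); [exact: openT| |exact: tt].
by move=> _; exists tt => x _; exact: is_derive_expR.
Qed.

Lemma smooth1_ln : smooth1 [set x | 0 < x] (@ln R).
Proof.
(* The derivatives of [ln] are multiples of negative powers; [None] stands for [ln] itself. *)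
pose F (i : option (R * nat)) : R -> R :=
  if i is Some (c, k) then fun x => c * x^-1 ^+ k else @ln R.
apply: (@smooth1_family _ F _ _ _ None); first exact: open_gt.
move=> [[c k]|] /=.
  exists (Some (- (c * k%:R), k.+1)) => x /= x0.
  apply: is_derive_eq; first exact: isD_scale (isD_exp k (isD_inv (lt0r_neq0 x0))).
  case: k => [|k]; first by rewrite mulr0n !mul0r mulr0 oppr0 mul0r.
  by rewrite succnK -[k.+2]addn2 exprD; ring.
exists (Some (1, 1%N)) => x /= x0; rewrite mul1r expr1; exact: is_derive1_ln.
Qed.

(** The classical function exp(-1/s), extended by 0, times a polynomial in 1/s; carrying the
    polynomial as a parameter makes the family closed under differentiation. *)
Definition flat (P : {poly R}) (s : R) : R :=
  if 0 < s then P.[s^-1] * expR (- s^-1) else 0.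

(** Take the k-th power of [y / k <= expR (y / k)]. *)
Lemma pow_expRN_le k (y : R) : 0 < y -> y ^+ k * expR (- y) <= k%:R ^+ k.
Proof.
move=> y0; rewrite expRN ler_pdivrMr ?expR_gt0//.
case: k => [|k]; first by rewrite !expr0 mul1r -expR0 ler_expR ltW.
have -> : expR y = expR (y / k.+1%:R) ^+ k.+1 by rewrite -expRM_natl mulrC divfK// pnatr_eq0.
rewrite -exprMn lerXn2r ?nnegrE ?mulr_ge0 ?expR_ge0 ?(ltW y0)//.
rewrite -ler_pdivrMl ?ltr0n// mulrC; apply: le_trans (expR_ge1Dx _).
by rewrite lerDr.
Qed.

Lemma flat_bound P : exists2 C : R, 0 <= C & forall s, `|flat P s| <= C.
Proof.
exists (\sum_(i < size P) `|P`_i| * i%:R ^+ i) => [|s].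
  by apply: sumr_ge0 => i _; rewrite mulr_ge0// exprn_ge0.
rewrite /flat; case: ifPn => [s0|_]; last first.
  by rewrite normr0; apply: sumr_ge0 => i _; rewrite mulr_ge0// exprn_ge0.
rewrite horner_coef mulr_suml; apply: le_trans (ler_norm_sum _ _ _) _.
apply: ler_sum => i _; rewrite -mulrA normrM ler_wpM2l//.
rewrite ger0_norm ?mulr_ge0 ?exprn_ge0 ?expR_ge0 ?invr_ge0 ?(ltW s0)//.
by rewrite pow_expRN_le// invr_gt0.
Qed.

Lemma flat_mulXn P k s : s != 0 -> flat ('X^k * P) s = s^-1 ^+ k * flat P s.
Proof.
move=> s0; rewrite /flat; case: ifP => _; last by rewrite mulr0.
by rewrite hornerM hornerXn mulrA.
Qed.

(** Away from 0 this is the usual computation. At 0, [flat P h] equals [h ^+ 2] times the bounded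
    function [flat ('X^2 * P)], so the difference quotient is O(h). *)
Lemma is_derive_flat P (s : R) : is_derive s 1 (flat P) (flat ('X^2 * (P - P^`())) s).
Proof.
have [s0|s0|->] := ltgtP s 0.
- have -> : flat ('X^2 * (P - P^`())) s = 0 by rewrite /flat ltNge (ltW s0).
  apply: (@near_eq_is_derive R R R (cst 0)).
  by near=> y; rewrite /flat ltNge ifN// negbK ltW//; near: y; exact: lt_nbhsl.
- rewrite /flat s0.
  apply: (@near_eq_is_derive R R R (fun s => P.[s^-1] * expR (- s^-1))).
    by near=> y; rewrite ifT//; near: y; exact: lt_nbhsr.
  apply: is_derive_eq.
    apply: isD_mul.
      exact: (is_derive_comp (is_derive_poly _ _) (isD_inv (lt0r_neq0 s0))).
    exact: (is_derive_comp (is_derive_expR _) (isD_opp (isD_inv (lt0r_neq0 s0)))).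
  by rewrite !hornerE /=; ring.
have [C C0 PC] := flat_bound ('X^2 * P).
have fE h : flat P h = h ^+ 2 * flat ('X^2 * P) h.
  have [->|h0] := eqVneq h 0; first by rewrite /flat ltxx expr0n mul0r.
  by rewrite flat_mulXn// mulrA -exprMn mulfV// expr1n mul1r.
have {1}-> : flat ('X^2 * (P - P^`())) 0 = 0 by rewrite /flat ltxx.
have L : h^-1 *: ((flat P \o shift 0) (h *: 1) - flat P 0) @[h --> 0^'] --> 0.
  have C1 : 0 < C + 1 by rewrite ltr_wpDl.
  apply/cvgr0Pnorm_le => e e0; have e1 : 0 < e / (C + 1) := divr_gt0 e0 C1.
  near=> h.
  have h0 : h != 0 by near: h; exact: nbhs_dnbhs_neq.
  have -> : h^-1 *: ((flat P \o shift 0) (h *: 1) - flat P 0) = h * flat ('X^2 * P) h.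
    rewrite /= addr0 [h *: 1]mulr1 {2}/flat ltxx subr0 [LHS]/GRing.scale/= fE.
    by rewrite expr2 mulrA mulrA mulVf// mul1r.
  rewrite normrM; apply: le_trans (ler_wpM2l (normr_ge0 _) (PC h)) _.
  have he : `|h| <= e / (C + 1).
    by near: h; exact: dnbhs0_le.
  apply: le_trans (ler_wpM2r C0 he) _.
  by rewrite -mulrA ler_piMr ?(ltW e0)// mulrC ler_pdivrMr// mul1r lerDl.
split; first by apply/cvg_ex; exists 0.
by apply/cvg_lim.
Unshelve. all: by end_near. Qed.

End smooth1.

Lemma smooth1_flat (R : realType) (P : {poly R}) : smooth1 setT (flat P).
Proof.
apply: (@smooth1_family R _ (@flat R)); first exact: openT.
by move=> {}P; exists ('X^2 * (P - P^`())) => x _; exact: is_derive_flat.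
Qed.

Lemma is_derive_continuous1 (R : realType) (f : R -> R) (x d : R) :
  is_derive x 1 f d -> {for x, continuous f}.
Proof. by move=> [df _]; apply/differentiable_continuous/derivable1_diffP. Qed.

Section smooth_on.
Context (R : realType) (n : nat).
Implicit Types (U : set 'rV[R]_n) (u v : 'rV[R]_n -> R).
Local Notation e_ i := (delta_mx ord0 i : 'rV[R]_n).

(** A syntactic class of smooth functions: since it is closed under partial derivatives on an open
    set, existence and continuity of all iterated partial derivatives follow by induction. *)
Inductive smooth_on U : ('rV[R]_n -> R) -> Prop :=
| smooth_cst c : smooth_on U (fun=> c)
| smooth_coord i : smooth_on U (fun x => x ord0 i)
| smooth_add u v : smooth_on U u -> smooth_on U v -> smooth_on U (fun x => u x + v x)
| smooth_mul u v : smooth_on U u -> smooth_on U v -> smooth_on U (fun x => u x * v x)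
| smooth_comp V K u : open V -> smooth1 V K -> (forall x, U x -> V (u x)) ->
    smooth_on U u -> smooth_on U (fun x => K (u x))
| smooth_eq u v : smooth_on U u -> (forall x, U x -> u x = v x) -> smooth_on U v.

Lemma smooth_sum U (I : Type) (r : seq I) (F : I -> 'rV[R]_n -> R) :
  (forall i, smooth_on U (F i)) -> smooth_on U (fun x => \sum_(i <- r) F i x).
Proof.
move=> sF; elim: r => [|i r IHr].
  by apply: (smooth_eq (smooth_cst U 0)) => x _; rewrite big_nil.
by apply: (smooth_eq (smooth_add (sF i) IHr)) => x _; rewrite big_cons.
Qed.

Lemma smooth_prod U (I : Type) (r : seq I) (F : I -> 'rV[R]_n -> R) :
  (forall i, smooth_on U (F i)) -> smooth_on U (fun x => \prod_(i <- r) F i x).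
Proof.
move=> sF; elim: r => [|i r IHr].
  by apply: (smooth_eq (smooth_cst U 1)) => x _; rewrite big_nil.
by apply: (smooth_eq (smooth_mul (sF i) IHr)) => x _; rewrite big_cons.
Qed.

Lemma smooth_continuous U u : open U -> smooth_on U u ->
  forall x, U x -> {for x, continuous u}.
Proof.
move=> oU; elim=> {u}.
- by move=> c x _; exact: cst_continuous.
- by move=> i x _; exact: coord_continuous.
- by move=> u v _ cu _ cv x Ux; exact: (cvgD (cu x Ux) (cv x Ux)).
- by move=> u v _ cu _ cv x Ux; exact: (cvgM (cu x Ux) (cv x Ux)).
- move=> V K u oV sK uV _ cu x Ux; apply: continuous_comp; first exact: cu.
  by apply: is_derive_continuous1; apply: derivableP; apply: (sK 0%N); exact: uV.
- move=> u v _ cu uv x Ux; apply: continuous_near_eq (cu x Ux).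
  by apply: filterS (open_nbhs_nbhs (conj oU Ux)) => y Uy; rewrite uv.
Qed.

Lemma is_derive_coord (x : 'rV[R]_n) i j :
  is_derive x (e_ i) (fun y : 'rV[R]_n => y ord0 j) (j == i)%:R.
Proof.
rewrite -[x]addr0 -(scale0r (e_ i)); apply/is_derive_line.
have -> : (fun r : R => (x + r *: e_ i) ord0 j) = (fun r => x ord0 j + r * (j == i)%:R).
  by apply/funext => r; rewrite coord_shift.
apply: is_derive_eq.
by rewrite scaler0 add0r add0r mul1r [_%:A]mulr1.
Qed.

Lemma smooth_is_derive U u i : open U -> smooth_on U u ->
  exists2 d, smooth_on U d & forall x, U x -> is_derive x (e_ i) u (d x).
Proof.
move=> oU; elim=> {u}.
- by move=> c; exists (fun=> 0); [exact: smooth_cst|move=> x _; exact: isD_cst].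
- move=> j; exists (fun=> (j == i)%:R); first exact: smooth_cst.
  by move=> x _; exact: is_derive_coord.
- move=> u v su [du sdu ud] sv [dv sdv vd].
  exists (fun x => du x + dv x); first exact: smooth_add.
  by move=> x Ux; apply: isD_add; [exact: ud|exact: vd].
- move=> u v su [du sdu ud] sv [dv sdv vd].
  exists (fun x => du x * v x + u x * dv x).
    by apply: smooth_add; exact: smooth_mul.
  by move=> x Ux; apply: isD_mul; [exact: ud|exact: vd].
- move=> V K u oV sK uV su [du sdu ud].
  exists (fun x => derive1 K (u x) * du x).
    apply: smooth_mul => //; apply: (smooth_comp oV _ uV su); exact: smooth1_derive.
  move=> x Ux; apply: is_derive_comp; last exact: ud.
  rewrite derive1E; apply: derivableP; apply: (sK 0%N); exact: uV.
- move=> u v su [d sd ud] uv; exists d => // x Ux.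
  apply: near_eq_is_derive (ud x Ux).
  by apply: filterS (open_nbhs_nbhs (conj oU Ux)) => y Uy; rewrite uv.
Qed.

Lemma smooth_foldr_partial U u s : open U -> smooth_on U u ->
  smooth_on U (foldr (@partial R n) u s).
Proof.
move=> oU su; elim: s => [//|i s IHs] /=.
have [d sd ud] := smooth_is_derive i oU IHs.
apply: (smooth_eq sd) => x Ux; rewrite /partial; by have [_ <-] := ud x Ux.
Qed.

Lemma smooth_derivable U u i x : open U -> smooth_on U u -> U x -> derivable u x (e_ i).
Proof. by move=> oU su Ux; have [d _ /(_ x Ux)[]] := smooth_is_derive i oU su. Qed.

(** [U] and the complement of [C] form an open cover of the space: [u] is smooth on the first and
    identically 0 on the second. *)
Lemma smooth_test_function U C u : open U -> compact C -> C `<=` U ->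
  smooth_on U u -> (forall x, ~ C x -> u x = 0) -> test_function U u.
Proof.
move=> oU cC CU su u0.
have clC : closed C by apply: compact_closed => //; exact: norm_hausdorff.
have oC : open (~` C) by exact: closed_openC.
have su0 : smooth_on (~` C) u.
  by apply: (smooth_eq (smooth_cst _ 0)) => x /u0 ->.
have supp : closure [set x | u x != 0] `<=` C.
  rewrite [X in _ `<=` X]((closure_id C).1 clC); apply: closureS => x /= ux.
  by apply: contrapT => /u0 /eqP; apply/negP.
split => [s| |]; last exact: subset_trans CU.
  split => [x|i x]; (have [Cx|Cx] := pselect (C x); [have Ux := CU _ Cx|]).
  - exact: (smooth_continuous oU (smooth_foldr_partial s oU su)).
  - exact: (smooth_continuous oC (smooth_foldr_partial s oC su0)).
  - exact: (@smooth_derivable U _ i x oU (smooth_foldr_partial s oU su) Ux).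
  - exact: (@smooth_derivable (~` C) _ i x oC (smooth_foldr_partial s oC su0) Cx).
by apply: subclosed_compact cC supp; exact: closed_closure.
Qed.

Lemma test_function_smooth Omega u : test_function Omega u ->
  [/\ continuous u, (forall i, continuous (partial i u)) &
      forall i x, is_derive x (e_ i) u (partial i u x)].
Proof.
move=> [su _ _]; split.
- by have [] := su [::].
- by move=> i; have [] := su [:: i].
- by move=> i x; apply: derivableP; have [] := su [::].
Qed.

End smooth_on.

Lemma Rdominated_cvg d (T : measurableType d) (R : realType) (mu : {measure set T -> \bar R})
    (D : set T) (F : nat -> T -> R) (f g : T -> R) :
  measurable D -> (forall k, measurable_fun D (F k)) -> measurable_fun D f ->
  {ae mu, forall x, D x -> (fun k => F k x) @ \oo --> f x} ->
  mu.-integrable D (EFin \o g) ->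
  (forall k x, D x -> `|F k x| <= g x) ->
  mu.-integrable D (EFin \o f) /\
  (fun k => \int[mu]_(x in D) F k x) @ \oo --> \int[mu]_(x in D) f x.
Proof.
move=> mD mF mf Ff ig Fg.
have [| | | |fi _ Fi] := @dominated_convergence _ _ _ mu D mD (fun k => EFin \o F k)
  (EFin \o f) (EFin \o g) _ _ _ ig.
- by move=> k; exact/measurable_EFinP.
- exact/measurable_EFinP.
- by apply: filterS Ff => x Ffx Dx; apply/fine_cvgP; split; [exact: nearW|exact: Ffx].
- by apply: aeW => x k Dx; rewrite lee_fin; exact: Fg.
split => //; rewrite /Rintegral; apply: fine_cvg.
by rewrite fineK//; exact: integrable_fin_num.
Qed.

(** * The fundamental lemma of the calculus of variations *)

Section obox_generate.
Context (R : realType) (n : nat).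

Definition oboxes : set (set 'rV[R]_n) := [set A | exists a b, A = obox a b].

Definition rV_max (a b : 'rV[R]_n) : 'rV[R]_n := \row_i Num.max (a ord0 i) (b ord0 i).

Definition rV_min (a b : 'rV[R]_n) : 'rV[R]_n := \row_i Num.min (a ord0 i) (b ord0 i).

Lemma obox_setI a b a' b' : obox a b `&` obox a' b' = obox (rV_max a a') (rV_min b b').
Proof.
apply/seteqP; split => [x [xab xab'] i|x xab].
  have := xab i; have := xab' i; rewrite /= !in_itv/= !mxE gt_max lt_min.
  by move=> /andP[-> ->] /andP[-> ->].
by split => i; have := xab i; rewrite /= !in_itv/= !mxE gt_max lt_min => /andP[/andP[? ?] /andP[? ?]]; apply/andP.
Qed.

Lemma cbox_setI a b a' b' : cbox (rV_max a a') (rV_min b b') `<=` cbox a b.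
Proof.
by move=> x xab i; have := xab i; rewrite /= !in_itv/= !mxE ge_max le_min => /andP[/andP[-> _] /andP[-> _]].
Qed.

Lemma oboxes_setI : setI_closed oboxes.
Proof.
by move=> _ _ [a [b ->]] [a' [b' ->]]; rewrite obox_setI; exists (rV_max a a'), (rV_min b b').
Qed.

(** Open boxes are stable under intersection, so with this identity they form a generating
    pi-system, as Dynkin's theorem requires. *)
Lemma measurable_oboxes : @measurable _ 'rV[R]_n = <<s oboxes >>.
Proof.
apply/seteqP; split; last first.
  apply: smallest_sub; first exact: sigma_algebra_measurable.
  by move=> _ [a [b ->]]; exact: measurable_obox.
apply: smallest_sub; first exact: smallest_sigma_algebra.
rewrite -bigcup_seq; apply: bigcup_sub => i _ A [B mB <-].
have : measurable_fun [set: g_sigma_algebraType oboxes] (fun x : 'rV[R]_n => x ord0 i).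
  apply: (measurability _ (RGenOpens.measurableE R)).
  move=> /= _ [_ [a [b ->]] <-]; rewrite setTI.
  (* A slab in direction [i] is exhausted by boxes whose other sides are ]-k, k[. *)
  pose lo k : 'rV[R]_n := \row_j (if j == i then a else - k%:R).
  pose hi k : 'rV[R]_n := \row_j (if j == i then b else k%:R).
  have -> : (fun x : 'rV[R]_n => x ord0 i) @^-1` `]a, b[%classic = \bigcup_k obox (lo k) (hi k).
    apply/seteqP; split => [x xab|x [k _] /(_ i)]; last by rewrite /= !mxE eqxx.
    have [k xk] : exists k : nat, forall j, `|x ord0 j| < k%:R.
      exists (Num.bound `|x|) => j; apply: le_lt_trans (archi_boundP (normr_ge0 x)).
      exact: le_coord_norm.
    exists k => // j; rewrite /= !mxE; case: eqVneq => [->//|_].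
    by rewrite in_itv/= -ltr_norml; exact: xk.
  by apply: bigcupT_measurable => k; apply: sub_sigma_algebra; exists (lo k), (hi k).
by move=> /(_ measurableT B mB).
Qed.

End obox_generate.

Section fundamental.
Context (R : realType) (n : nat).
Local Notation mu := (lebesgue_rV R n).
Implicit Types (Omega K : set 'rV[R]_n) (g : 'rV[R]_n -> R).

Lemma compact_measurable_rV K : compact K -> measurable K.
Proof.
move=> cK; have clK : closed K by apply: compact_closed => //; exact: norm_hausdorff.
by rewrite -[K]setCK; apply: measurableC; apply: open_measurable_rV; exact: closed_openC.
Qed.

Lemma integrable_Rpatch D g : measurable D ->
  mu.-integrable D (EFin \o g) <-> mu.-integrable [set: 'rV[R]_n] (EFin \o g \_ D).
Proof.
move=> mD; rewrite -restrict_EFin; split => [iD|/integrable_restrict].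
  by apply/integrable_restrict; rewrite ?setTI.
by rewrite setTI; apply.
Qed.

Lemma Lp1_integrable D g : measurable D -> Lp D 1 g <-> mu.-integrable D (EFin \o g).
Proof. by move=> mD; rewrite integrable_Rpatch// -Lfun1_integrable. Qed.

Lemma Rintegral_eq_set (D E : set 'rV[R]_n) (f g : 'rV[R]_n -> R) :
  f \_ D = g \_ E -> \int[mu]_(x in D) f x = \int[mu]_(x in E) g x.
Proof. by move=> fg; rewrite Rintegral_mkcond fg -Rintegral_mkcond. Qed.

Lemma cvg_prod_seq (I : Type) (r : seq I) (F : I -> nat -> R) (l : I -> R) :
  (forall i, F i @ \oo --> l i) ->
  (fun k => \prod_(i <- r) F i k) @ \oo --> \prod_(i <- r) l i.
Proof.
move=> Fl; elim: r => [|i r IHr].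
  by rewrite big_nil; under eq_fun do rewrite big_nil; exact: cvg_cst.
rewrite big_cons; under eq_fun do rewrite big_cons; exact: cvgM.
Qed.

(** Test functions bounded by 1 that converge pointwise to the indicator function of the open box:
    each factor is exp(-1/(k+1)s), with s the distance to a face. *)
Definition bump (a b : 'rV[R]_n) (k : nat) (x : 'rV[R]_n) : R :=
  \prod_i (flat 1 (k.+1%:R * (x ord0 i - a ord0 i)) * flat 1 (k.+1%:R * (b ord0 i - x ord0 i))).

Lemma flat1_ge0_le1 (s : R) : 0 <= flat 1 s <= 1.
Proof.
rewrite /flat; case: ifP => [s0|_]; last by rewrite lexx ler01.
by rewrite hornerC mul1r expR_ge0 -expR0 ler_expR oppr_le0 invr_ge0 ltW.
Qed.

Lemma bump_out a b k x : ~ obox a b x -> bump a b k x = 0.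
Proof.
move=> /existsNP[i xi]; rewrite /bump (bigD1 i)//= /flat !pmulr_rgt0 ?ltr0n// !subr_gt0.
case: ifPn => [ax|_]; last by rewrite !mul0r.
case: ifPn => [xb|_]; last by rewrite mulr0 mul0r.
by exfalso; apply: xi; rewrite /= in_itv/= ax.
Qed.

Lemma bump_test a b Omega k : open Omega -> cbox a b `<=` Omega ->
  test_function Omega (bump a b k).
Proof.
move=> oO abO; apply: (smooth_test_function oO (@compact_cbox R n a b) abO).
  apply: smooth_prod => i; apply: smooth_mul.
    apply: (smooth_comp (@openT _) (@smooth1_flat R 1)) => //.
    apply: smooth_mul; first exact: smooth_cst.
    by apply: smooth_add; [exact: smooth_coord|exact: smooth_cst].
  apply: (smooth_comp (@openT _) (@smooth1_flat R 1)) => //.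
  apply: smooth_mul; first exact: smooth_cst.
  apply: smooth_add; first exact: smooth_cst.
  apply: (smooth_eq (smooth_mul (smooth_cst Omega (-1)) (smooth_coord Omega i))) => x _.
  by rewrite mulN1r.
by move=> x xab; apply: bump_out => /obox_sub_cbox.
Qed.

Lemma bump_le1 a b k x : `|bump a b k x| <= 1.
Proof.
suff /andP[b0 b1] : 0 <= bump a b k x <= 1 by rewrite ger0_norm.
rewrite /bump; elim/big_ind : _ => [|y z /andP[y0 y1] /andP[z0 z1]|i _].
- by rewrite ler01 lexx.
- by rewrite mulr_ge0// mulr_ile1.
have /andP[s0 s1] := flat1_ge0_le1 (k.+1%:R * (x ord0 i - a ord0 i)).
have /andP[t0 t1] := flat1_ge0_le1 (k.+1%:R * (b ord0 i - x ord0 i)).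
by rewrite mulr_ge0// mulr_ile1.
Qed.

Lemma cvg_flat1 (s : R) : 0 < s -> (fun k => flat 1 (k.+1%:R * s)) @ \oo --> (1 : R).
Proof.
move=> s0; have -> : (fun k => flat 1 (k.+1%:R * s)) = (fun k => expR (- (harmonic k / s))).
  by apply/funext => k; rewrite /flat pmulr_rgt0 ?ltr0n// s0 hornerC mul1r invfM.
rewrite -expR0; apply: continuous_cvg; first exact: continuous_expR.
rewrite -oppr0; apply: cvgN; rewrite -(mul0r s^-1); apply: cvgM; [exact: cvg_harmonic|exact: cvg_cst].
Qed.

Lemma cvg_bump a b x : (fun k => bump a b k x) @ \oo --> (\1_(obox a b) x : R).
Proof.
rewrite indicE; have [/set_mem xab|xab] := boolP (x \in obox a b).
  rewrite (_ : true%:R = \prod_(i < n) (1 * 1 : R)); last by rewrite mul1r big1.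
  apply: cvg_prod_seq => i; apply: cvgM; apply: cvg_flat1; rewrite subr_gt0.
    by have := xab i; rewrite /= in_itv/= => /andP[].
  by have := xab i; rewrite /= in_itv/= => /andP[].
rewrite (_ : (fun k => bump a b k x) = cst 0); first exact: cvg_cst.
by apply/funext => k; rewrite bump_out// => ?; rewrite mem_set in xab.
Qed.

(** Test against the [bump] functions and pass to the limit by dominated convergence, with majorant
    |g| on the closed box. *)
Lemma fundamental_obox Omega g a b : open Omega -> Lp_loc Omega 1 g ->
  (forall psi, test_function Omega psi -> \int[mu]_(x in Omega) (g x * psi x) = 0) ->
  cbox a b `<=` Omega -> \int[mu]_(x in obox a b) g x = 0.
Proof.
move=> oO gL1 gpsi abO; have cK := @compact_cbox R n a b.
have mK := compact_measurable_rV cK.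
have /Lp1_integrable ig := gL1 _ cK abO; have {}ig := ig mK.
have mg : measurable_fun (cbox a b) g by apply/measurable_EFinP; exact: measurable_int ig.
have tb k := bump_test k oO abO.
have mb k : measurable_fun (cbox a b) (bump a b k).
  apply: measurable_funTS; apply: continuous_measurable_rV; first exact: openT.
  by move=> x _; have [+ _ _] := test_function_smooth (tb k); apply.
have mb1 : measurable_fun (cbox a b) (\1_(obox a b) : 'rV[R]_n -> R).
  by apply: measurable_indic; exact: measurable_obox.
have [| | | | |_ H] := @Rdominated_cvg _ _ _ mu (cbox a b) (fun k x => g x * bump a b k x)
  (fun x => g x * \1_(obox a b) x) (fun x => `|g x|) mK.
- by move=> k; exact: measurable_funM.
- exact: measurable_funM.
- by apply: aeW => x _; apply: cvgM; [exact: cvg_cst|exact: cvg_bump].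
- exact: (integrable_norm ig).
- by move=> k x _; rewrite normrM ler_piMr// bump_le1.
transitivity (\int[mu]_(x in cbox a b) (g x * \1_(obox a b) x)).
  apply: Rintegral_eq_set; apply/funext => x; rewrite !patchE indicE.
  have [/set_mem xab|xab] := boolP (x \in obox a b); last by rewrite mulr0; case: ifP.
  by rewrite mulr1 mem_set//; exact: obox_sub_cbox.
apply/esym/(cvg_unique _ _ H) => //.
rewrite (_ : (fun k => _) = cst 0); first exact: cvg_cst.
apply/funext => k; rewrite -[RHS](gpsi _ (tb k)); apply: Rintegral_eq_set; apply/funext => x.
rewrite !patchE; have [/set_mem xab|xab] := boolP (x \in cbox a b).
  by rewrite mem_set//; exact: abO.
case: ifP => // _; rewrite bump_out ?mulr0// => /obox_sub_cbox.
by move=> ?; rewrite mem_set in xab.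
Qed.

Lemma EFin_Rintegral D (f : 'rV[R]_n -> R) : measurable D -> mu.-integrable D (EFin \o f) ->
  (\int[mu]_(x in D) (f x)%:E)%E = (\int[mu]_(x in D) f x)%:E.
Proof. by move=> mD fi; rewrite /Rintegral fineK//; exact: integrable_fin_num. Qed.

(** The sets [S] for which the integral of [g] over the intersection of the box with [S] vanishes
    form a lambda-system containing the open boxes, hence contain all measurable sets. *)
Lemma ae_eq0_obox a b g : mu.-integrable (obox a b) (EFin \o g) ->
  (forall a' b', \int[mu]_(x in obox a b `&` obox a' b') g x = 0) ->
  ae_eq mu (obox a b) (EFin \o g) (cst 0%E).
Proof.
set D := obox a b => ig g0; have mD : measurable D := measurable_obox a b.
have iS S : measurable S -> mu.-integrable (D `&` S) (EFin \o g).
  by move=> mS; apply: integrableS ig => //; exact: measurableI.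
suff H S : measurable S -> (\int[mu]_(x in D `&` S) (g x)%:E = 0)%E.
  apply: ae_eq_sym; apply: integral_ae_eq => //.
  - exact: integrable0.
  - exact: measurable_int ig.
  - move=> E ED mE; rewrite integral0 -(H _ mE) (_ : D `&` E = E)//.
    by apply/seteqP; split => [x []//|x Ex]; split => //; exact: ED.
rewrite [X in X S -> _]measurable_oboxes.
apply: (@dynkin_induction _ _ (@oboxes R n) (fun S => (\int[mu]_(x in D `&` S) (g x)%:E = 0)%E)).
- exact: measurable_oboxes.
- exact: oboxes_setI.
- rewrite setIT EFin_Rintegral//; congr EFin.
  by rewrite -(g0 a b) setIid.
- move=> _ [a' [b' ->]]; rewrite EFin_Rintegral ?g0//.
    by apply: measurableI => //; exact: measurable_obox.
  by apply: iS; exact: measurable_obox.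
- move=> T mT T0; have mTC := measurableC mT.
  have : \int[mu]_(x in (D `&` T) `|` (D `&` ~` T)) g x = 0.
    by rewrite -setIUr setUCr setIT -(g0 a b) setIid.
  rewrite Rintegral_setU; [|exact: measurableI|exact: measurableI| |].
  + rewrite EFin_Rintegral; [|exact: measurableI|exact: iS].
    by rewrite [X in X + _ = _](_ : _ = 0) ?add0r => [->//|]; rewrite /Rintegral T0.
  + by rewrite -setIUr setUCr setIT.
  + by apply/disj_setPS => x [[_ ?] [_]].
- move=> F mF tF F0; rewrite setI_bigcupr integral_bigcup.
  + by apply: eseries0 => k _ _; exact: F0.
  + by apply: trivIset_setIl.
  + by move=> k; exact: measurableI.
  + by rewrite -setI_bigcupr; apply: iS; exact: bigcupT_measurable.
Qed.

(** Countably many rational boxes with closure in [Omega] cover it, and [g] vanishes almost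
    everywhere on each of them. *)
Lemma fundamental_lemma Omega g : open Omega -> Lp_loc Omega 1 g ->
  (forall psi, test_function Omega psi -> \int[mu]_(x in Omega) (g x * psi x) = 0) ->
  {ae mu, forall x, Omega x -> g x = 0}.
Proof.
move=> oO gL1 gpsi.
pose B q := if `[< cbox (rat_lo R q) (rat_hi R q) `<=` Omega >]
  then obox (rat_lo R q) (rat_hi R q) else set0 : set 'rV[R]_n.
suff H (q : 'rV[rat]_n * nat) : {ae mu, forall x, B q x -> g x = 0}.
  have : mu.-negligible (\bigcup_k (if unpickle k is Some q then ~` [set x | B q x -> g x = 0] else set0)).
    apply: negligible_bigcup => k; case: unpickle => [q|]; last exact: negligible_set0.
    exact: H.
  apply: negligibleS => x /= /not_implyP[Ox gx].
  have [q [qx qO]] := open_rat_box oO Ox.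
  exists (pickle q) => //; rewrite pickleK /= => /(_ _)/gx; apply.
  by rewrite /B ifT//; exact/asboolP.
rewrite /B; case: ifPn => [/asboolP qO|_]; last exact: aeW.
set a := rat_lo R q in qO *; set b := rat_hi R q in qO *.
have mK := compact_measurable_rV (@compact_cbox R n a b).
have mD := measurable_obox a b.
have ig : mu.-integrable (obox a b) (EFin \o g).
  apply: (integrableS mK mD (@obox_sub_cbox _ _ a b)).
  exact: (Lp1_integrable _ mK).1 (gL1 _ (@compact_cbox R n a b) qO).
have : ae_eq mu (obox a b) (EFin \o g) (cst 0%E).
  apply: ae_eq0_obox => // a' b'.
  rewrite obox_setI; apply: (fundamental_obox oO gL1 gpsi).
  exact: subset_trans (@cbox_setI _ _ _ _ _ _) qO.
by apply: filterS => x gx /gx [].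
Qed.

(** * Weak gradients and the chain rule in W^{1,p}_0 *)

Lemma integrable_ge0 D (f : 'rV[R]_n -> R) : measurable D -> measurable_fun D f ->
  (forall x, D x -> 0 <= f x) -> (\int[mu]_(x in D) (f x)%:E < +oo)%E ->
  mu.-integrable D (EFin \o f).
Proof.
move=> mD mf f0 fy; apply/integrableP; split; first exact/measurable_EFinP.
rewrite (eq_integral (fun x => (f x)%:E))// => x /set_mem Dx.
by rewrite /= ger0_norm// f0.
Qed.

Lemma LpP D (k : nat) u : (0 < k)%N -> measurable D ->
  Lp D k%:R u <-> measurable_fun D u /\ mu.-integrable D (fun x => (`|u x| ^+ k)%:E).
Proof.
move=> k0 mD; have k1 : 1 <= k%:R :> R by rewrite ler1n.
have kN0 : k%:R != 0 :> R by rewrite pnatr_eq0 -lt0n.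
have patchk : (fun x => (`|(u \_ D) x| `^ k%:R)%:E) = (EFin \o (fun x => `|u x| ^+ k) \_ D).
  apply/funext => x /=; rewrite powR_mulrn// !patchE; case: ifP => // _.
  by rewrite normr0 expr0n; case: (k) k0.
rewrite /Lp; split => [Lu|[mu_ iu]].
  split.
    apply/(measurable_restrictT _ mD).
    by have := sub_Lfun_mfun Lu; rewrite inE.
  apply/(integrable_Rpatch _ mD); rewrite -patchk; exact: Lfun_integrable Lu.
have mU : measurable_fun [set: 'rV[R]_n] (u \_ D) by apply/(measurable_restrictT _ mD).
rewrite inE; apply/andP; split; first by rewrite inE.
rewrite inE /= /finite_norm unlock /=.
apply: poweR_lty.
have /(integrable_Rpatch _ mD)/integrableP[_] := iu.
rewrite -patchk => H; rewrite (eq_integral (fun x => `|(`|(u \_ D) x| `^ k%:R)%:E|%E))// => x _.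
by rewrite /= (ger0_norm (powR_ge0 _ _)).
Qed.

Lemma compact_lty K : compact K -> (mu K < +oo)%E.
Proof.
move=> cK; have [M KM] := compact_sub_box cK.
apply: le_lt_trans (lebesgue_rV_box n M); apply: le_measure => //; rewrite inE.
  exact: compact_measurable_rV.
exact: measurable_box.
Qed.

Lemma bounded_integrable D (f : 'rV[R]_n -> R) (M : R) : measurable D -> (mu D < +oo)%E ->
  measurable_fun D f -> (forall x, D x -> `|f x| <= M) -> mu.-integrable D (EFin \o f).
Proof.
move=> mD Dy mf fM; apply: measurable_bounded_integrable => //.
by exists M; split; rewrite ?num_real// => N MN x Dx /=; exact: le_trans (fM x Dx) (ltW MN).
Qed.

Lemma bounded_Lp D (u : 'rV[R]_n -> R) (k : nat) (M : R) : (0 < k)%N -> measurable D -> (mu D < +oo)%E ->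
  measurable_fun D u -> (forall x, D x -> `|u x| <= M) -> Lp D k%:R u.
Proof.
move=> k0 mD Dy mU uM; apply/LpP => //; split => //.
apply: (@bounded_integrable _ (fun x => `|u x| ^+ k) (M ^+ k)) => //.
  by apply: measurable_funX; exact: measurableT_comp.
by move=> x Dx; rewrite normrX normr_id lerXn2r ?nnegrE ?(le_trans _ (uM x Dx)) ?uM.
Qed.

Lemma continuous_bounded C (f : 'rV[R]_n -> R) : compact C -> (forall x, C x -> {for x, continuous f}) ->
  exists M : R, forall x : 'rV[R]_n, C x -> `|f x| <= M.
Proof.
move=> cC cf; have : compact (f @` C).
  apply: continuous_compact => //; apply: continuous_in_subspaceT => x /set_mem; exact: cf.
move=> /compact_bounded[K [_ /(_ (`|K| + 1))]].
rewrite (le_lt_trans (ler_norm K)) ?ltrDl// => /(_ isT) KP.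
by exists (`|K| + 1) => x Cx; apply: KP; exists x.
Qed.

Lemma continuous_Lp_loc Omega (u : 'rV[R]_n -> R) (k : nat) : (0 < k)%N -> open Omega ->
  (forall x, Omega x -> {for x, continuous u}) -> Lp_loc Omega k%:R u.
Proof.
move=> k0 oO cu K cK KO.
have [M uM] := continuous_bounded cK (fun x Kx => cu x (KO x Kx)).
apply: (@bounded_Lp _ _ _ M) => //; [exact: compact_measurable_rV|exact: compact_lty|].
apply: measurable_funS KO _; first exact: open_measurable_rV.
exact: continuous_measurable_rV.
Qed.

Lemma integrable_mul_bounded D (g h : 'rV[R]_n -> R) (M : R) : measurable D ->
  mu.-integrable D (EFin \o g) -> measurable_fun D h -> (forall x, D x -> `|h x| <= M) ->
  mu.-integrable D (EFin \o (fun x => g x * h x)).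
Proof.
move=> mD ig mh hM; apply: (integrableMl mD ig mh).
by exists M; split; rewrite ?num_real// => N MN x Dx /=; exact: le_trans (hM x Dx) (ltW MN).
Qed.

Lemma Lp_loc_mul_integrable Omega C g (h : 'rV[R]_n -> R) : open Omega -> Lp_loc Omega 1 g -> compact C ->
  C `<=` Omega -> (forall x, Omega x -> {for x, continuous h}) -> (forall x, ~ C x -> h x = 0) ->
  mu.-integrable Omega (EFin \o (fun x => g x * h x)).
Proof.
move=> oO gL cC CO ch h0; have mC := compact_measurable_rV cC.
have mO := open_measurable_rV oO.
have [M hM] := continuous_bounded cC (fun x Cx => ch x (CO x Cx)).
apply/(integrable_Rpatch _ mO); rewrite (_ : _ \_ _ = (fun x => g x * h x) \_ C).
  apply/(integrable_Rpatch _ mC); apply: (@integrable_mul_bounded _ _ _ M) => //.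
    exact/(Lp1_integrable _ mC)/gL.
  apply: (measurable_funS mO CO); exact: continuous_measurable_rV.
apply/funext => x; rewrite !patchE; have [/set_mem Cx|xC] := boolP (x \in C).
  by rewrite mem_set//; exact: CO.
by case: ifP => // _; rewrite h0 ?mulr0// => Cx; rewrite mem_set in xC.
Qed.

Local Notation e_ i := (delta_mx ord0 i : 'rV[R]_n).

Lemma test_function_support Omega psi : open Omega -> test_function Omega psi ->
  exists C, [/\ compact C, C `<=` Omega, (forall x, ~ C x -> psi x = 0) &
    forall i x, ~ C x -> partial i psi x = 0].
Proof.
move=> oO tpsi; have [_ cC CO] := tpsi; set C := closure _ in cC CO.
have [_ _ dpsi] := test_function_smooth tpsi.
have psi0 x : ~ C x -> psi x = 0.
  move=> Cx; apply: contrapT => px; apply: Cx; apply: subset_closure; exact/eqP.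
exists C; split => // i x Cx.
have oC : open (~` C) by apply: closed_openC; exact: closed_closure.
have : is_derive x (e_ i) psi 0.
  apply: (@near_eq_is_derive R _ R (cst 0) psi x (e_ i) 0).
  by apply: filterS (open_nbhs_nbhs (conj oC Cx)) => y Cy; rewrite (psi0 y).
by move=> [_ <-]; have [_ <-] := dpsi i x.
Qed.

Lemma Lp_loc_test_integrable Omega g psi : open Omega -> Lp_loc Omega 1 g ->
  test_function Omega psi ->
  mu.-integrable Omega (EFin \o (fun x => g x * psi x)) /\
  forall i, mu.-integrable Omega (EFin \o (fun x => g x * partial i psi x)).
Proof.
move=> oO gL tpsi; have [cpsi cdpsi _] := test_function_smooth tpsi.
have [C [cC CO psi0 dpsi0]] := test_function_support oO tpsi.
split => [|i].
  by apply: (Lp_loc_mul_integrable oO gL cC CO) => // x _; exact: cpsi.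
by apply: (Lp_loc_mul_integrable oO gL cC CO) => // [x _|x]; [exact: cdpsi|exact: dpsi0].
Qed.

Lemma Lp_locD Omega f g : open Omega -> Lp_loc Omega 1 f -> Lp_loc Omega 1 g ->
  Lp_loc Omega 1 (fun x => f x + g x).
Proof.
move=> oO fL gL K cK KO; have mK := compact_measurable_rV cK.
apply/(Lp1_integrable _ mK).
have iF := (Lp1_integrable _ mK).1 (fL K cK KO).
have iG := (Lp1_integrable _ mK).1 (gL K cK KO).
exact: (integrableD mK iF iG).
Qed.

Lemma Lp_locN Omega f : open Omega -> Lp_loc Omega 1 f -> Lp_loc Omega 1 (fun x => - f x).
Proof.
move=> oO fL K cK KO; have mK := compact_measurable_rV cK.
apply/(Lp1_integrable _ mK).
have -> : EFin \o (fun x => - f x) = (\- (EFin \o f))%E by [].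
by apply: integrableN; apply/(Lp1_integrable _ mK); exact: fL.
Qed.

Lemma Lp_loc_subset Omega Omega' p f : Omega' `<=` Omega -> Lp_loc Omega p f -> Lp_loc Omega' p f.
Proof. by move=> OO fL K cK KO; apply: fL => //; exact: subset_trans OO. Qed.

Implicit Types (u v : 'rV[R]_n -> R).

Lemma is_weak_gradientD Omega u v (g h : 'rV[R]_n -> 'rV[R]_n) : open Omega ->
  is_weak_gradient Omega u g -> is_weak_gradient Omega v h ->
  is_weak_gradient Omega (u \+ v) (fun x => g x + h x).
Proof.
move=> oO [uL gL ug] [vL hL vh]; have mO := open_measurable_rV oO; split.
- exact: Lp_locD.
- move=> i; rewrite (_ : (fun x => _) = (fun x => g x ord0 i + h x ord0 i)).
    exact: Lp_locD.
  by apply/funext => x; rewrite mxE.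
- move=> psi tpsi i.
  have [_ /(_ i) iu] := Lp_loc_test_integrable oO uL tpsi.
  have [_ /(_ i) iv] := Lp_loc_test_integrable oO vL tpsi.
  have [ig _] := Lp_loc_test_integrable oO (gL i) tpsi.
  have [ih _] := Lp_loc_test_integrable oO (hL i) tpsi.
  rewrite (@eq_Rintegral _ _ _ _ _ (fun x => u x * partial i psi x + v x * partial i psi x)).
    rewrite RintegralD// ug// vh// -opprD -RintegralD//; congr (- _).
    by apply: eq_Rintegral => x _; rewrite mxE mulrDl.
  by move=> x _; rewrite mulrDl.
Qed.

Lemma is_weak_gradientN Omega u (g : 'rV[R]_n -> 'rV[R]_n) : open Omega -> is_weak_gradient Omega u g ->
  is_weak_gradient Omega (fun x => - u x) (fun x => - g x).
Proof.
move=> oO [uL gL ug]; have mO := open_measurable_rV oO; split.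
- exact: Lp_locN.
- move=> i; rewrite (_ : (fun x => _) = (fun x => - g x ord0 i)); first exact: Lp_locN.
  by apply/funext => x; rewrite mxE.
- move=> psi tpsi i.
  have [_ /(_ i) iu] := Lp_loc_test_integrable oO uL tpsi.
  have [ig _] := Lp_loc_test_integrable oO (gL i) tpsi.
  have E (f : 'rV[R]_n -> R) : mu.-integrable Omega (EFin \o f) ->
      \int[mu]_(x in Omega) (- f x) = - \int[mu]_(x in Omega) f x.
    move=> fi; rewrite -mulN1r -RintegralZl//.
    by apply: eq_Rintegral => x _; rewrite mulN1r.
  rewrite (@eq_Rintegral _ _ _ _ _ (fun x => - (u x * partial i psi x))).
    rewrite E// ug//; congr (- _); rewrite -E//.
    by apply: eq_Rintegral => x _; rewrite mxE mulNr.
  by move=> x _; rewrite mulNr.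
Qed.

Lemma weak_gradient_unique Omega u (g h : 'rV[R]_n -> 'rV[R]_n) : open Omega ->
  is_weak_gradient Omega u g -> is_weak_gradient Omega u h ->
  {ae mu, forall x, Omega x -> g x = h x}.
Proof.
move=> oO [uL gL ug] [_ hL uh]; have mO := open_measurable_rV oO.
have H i : {ae mu, forall x, Omega x -> g x ord0 i - h x ord0 i = 0}.
  apply: fundamental_lemma => //; first by apply: Lp_locD => //; exact: Lp_locN.
  move=> psi tpsi.
  have [ig _] := Lp_loc_test_integrable oO (gL i) tpsi.
  have [ih _] := Lp_loc_test_integrable oO (hL i) tpsi.
  rewrite (@eq_Rintegral _ _ _ _ _ (fun x => g x ord0 i * psi x - h x ord0 i * psi x)).
    rewrite RintegralB//; apply/eqP; rewrite subr_eq0; apply/eqP/oppr_inj.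
    by rewrite -ug// -uh.
  by move=> x _; rewrite mulrBl.
have : {ae mu, forall x, forall i, Omega x -> g x ord0 i - h x ord0 i = 0}.
  by apply: filter_forall => i; exact: H.
apply: filterS => x gh Ox; apply/rowP => i.
by apply/eqP; rewrite -subr_eq0 gh.
Qed.

Lemma gradientP Omega u : weakly_differentiable Omega u ->
  is_weak_gradient Omega u (gradient Omega u).
Proof. by move=> [g ug]; rewrite /gradient; exact: (xgetPex (cst 0) (ex_intro _ g ug)). Qed.

Lemma gradient_ae Omega u (g : 'rV[R]_n -> 'rV[R]_n) : open Omega -> is_weak_gradient Omega u g ->
  {ae mu, forall x, Omega x -> gradient Omega u x = g x}.
Proof.
by move=> oO ug; apply: (@weak_gradient_unique _ u) => //; apply: gradientP; exists g.
Qed.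

(** A test function on [Omega'] is also one on [Omega], and both integrands vanish outside
    [Omega']. *)
Lemma is_weak_gradient_restrict Omega Omega' u v (g : 'rV[R]_n -> 'rV[R]_n) : open Omega -> open Omega' ->
  Omega' `<=` Omega -> (forall x, Omega' x -> u x = v x) ->
  is_weak_gradient Omega u g -> is_weak_gradient Omega' v g.
Proof.
move=> oO oO' OO uv [uL gL ug]; split.
- move=> K cK KO; rewrite /Lp (_ : v \_ K = u \_ K); first exact: (Lp_loc_subset OO uL).
  by apply/funext => x; rewrite !patchE; case: ifP => // /set_mem /KO /uv.
- by move=> i; exact: Lp_loc_subset (gL i).
move=> psi tpsi i; have [C [cC CO psi0 dpsi0]] := test_function_support oO' tpsi.
have tpsi' : test_function Omega psi.
  by have [sp cp po] := tpsi; split => //; exact: subset_trans OO.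
rewrite -[LHS](_ : \int[mu]_(x in Omega) (u x * partial i psi x) = _).
  rewrite ug//; congr (- _); apply: Rintegral_eq_set; apply/funext => x.
  rewrite !patchE; have [Ox|Ox] := boolP (x \in Omega').
    by rewrite mem_set//; apply: OO; exact: set_mem.
  case: ifP => // _; rewrite psi0 ?mulr0// => /CO ?; by rewrite mem_set in Ox.
apply: Rintegral_eq_set; apply/funext => x.
rewrite !patchE; have [Ox|Ox] := boolP (x \in Omega').
  by rewrite mem_set ?uv//; [exact: set_mem|apply: OO; exact: set_mem].
case: ifP => // _; rewrite dpsi0 ?mulr0// => /CO ?; by rewrite mem_set in Ox.
Qed.

(** The product of [u] and a test function has compact support, so the integral of its classical
    partial derivative is 0. *)
Lemma C1_is_weak_gradient Omega u (d : 'I_n -> 'rV[R]_n -> R) : open Omega ->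
  (forall x, Omega x -> {for x, continuous u}) ->
  (forall i x, Omega x -> is_derive x (e_ i) u (d i x)) ->
  (forall i x, Omega x -> {for x, continuous (d i)}) ->
  is_weak_gradient Omega u (fun x => \row_i d i x).
Proof.
move=> oO cu du cd; have mO := open_measurable_rV oO.
have uL := @continuous_Lp_loc Omega u 1 isT oO cu.
have dL i := @continuous_Lp_loc Omega (d i) 1 isT oO (cd i).
split => // [i|psi tpsi i].
  by under eq_fun do rewrite mxE; exact: dL.
have [cpsi cdpsi dpsi] := test_function_smooth tpsi.
have [C [cC CO psi0 dpsi0]] := test_function_support oO tpsi.
have [_ /(_ i) iu] := Lp_loc_test_integrable oO uL tpsi.
have [id _] := Lp_loc_test_integrable oO (dL i) tpsi.
have [] := @ibp_open R n Omega C (fun x => u x * psi x)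
  (fun x => d i x * psi x + u x * partial i psi x) i oO cC CO.
- by move=> x /psi0 ->; rewrite mulr0.
- by move=> x Ox; exact: (isD_mul (du i x Ox) (dpsi i x)).
- move=> x Ox; apply: cont_add; apply: cont_mul.
  + exact: cd.
  + exact: cpsi.
  + exact: cu.
  + exact: cdpsi.
move=> _ _ I0; apply/eqP; rewrite -addr_eq0 addrC; apply/eqP.
rewrite (@eq_Rintegral _ _ _ _ _ (fun x => d i x * psi x)); last first.
  by move=> x _; rewrite mxE.
by rewrite -RintegralD// /Rintegral I0.
Qed.

(** [gradient] is an arbitrary representative, so its measurability has to come from local
    integrability, glued over countably many compact boxes. *)
Lemma Lp_loc_measurable Omega g : open Omega -> Lp_loc Omega 1 g -> measurable_fun Omega g.
Proof.
move=> oO gL.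
pose B (q : 'rV[rat]_n * nat) := if `[< cbox (rat_lo R q) (rat_hi R q) `<=` Omega >]
  then cbox (rat_lo R q) (rat_hi R q) else set0 : set 'rV[R]_n.
pose F k := if unpickle k is Some q then B q else set0.
have BK q : [/\ compact (B q), B q `<=` Omega & measurable (B q)].
  rewrite /B; case: ifPn => [/asboolP qO|_].
    by split => //; [exact: compact_cbox|apply: compact_measurable_rV; exact: compact_cbox].
  by split => //; exact: compact0.
have -> : Omega = \bigcup_k F k.
  apply/seteqP; split => [x Ox|x [k _]]; last first.
    by rewrite /F; case: unpickle => // q Bx; have [_ + _] := BK q; apply.
  have [q [qx qO]] := open_rat_box oO Ox.
  exists (pickle q) => //; rewrite /F pickleK /B ifT; last exact/asboolP.
  exact: obox_sub_cbox.
apply/measurable_fun_bigcup => k; rewrite /F; case: unpickle => [q|].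
- by have [_ _] := BK q.
- exact: measurable0.
- have [cB BO mB] := BK q; apply/measurable_EFinP.
  exact: measurable_int ((Lp1_integrable _ mB).1 (gL _ cB BO)).
- exact: measurable_fun_set0.
Qed.

Lemma enorm_ge0 (x : 'rV[R]_n) : 0 <= enorm x.
Proof. exact: sqrtr_ge0. Qed.

Lemma enorm_sqr (x : 'rV[R]_n) : enorm x ^+ 2 = \sum_i x ord0 i ^+ 2.
Proof. by rewrite sqr_sqrtr// sumr_ge0// => i _; rewrite sqr_ge0. Qed.

Lemma le_coord_enorm (x : 'rV[R]_n) i : `|x ord0 i| <= enorm x.
Proof.
rewrite -sqrtr_sqr ler_wsqrtr// (bigD1 i)//= lerDl sumr_ge0// => j _.
exact: sqr_ge0.
Qed.

Lemma measurable_enorm D (G : 'rV[R]_n -> 'rV[R]_n) :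
  (forall i, measurable_fun D (fun x => G x ord0 i)) -> measurable_fun D (@enorm R n \o G).
Proof.
move=> mG; have ms := continuous_measurable_fun (@sqrt_continuous R).
have mS : measurable_fun D (fun x => \sum_i G x ord0 i ^+ 2).
  by apply: measurable_sum => i; apply: measurable_funX.
exact: (measurableT_comp ms mS).
Qed.

Lemma Lnorm_patch_le D (f : 'rV[R]_n -> R) (k : nat) (e : R) : (0 < k)%N -> measurable D ->
  measurable_fun D f -> ('N[mu]_(k%:R)%:E[EFin \o (f \_ D)] < e%:E)%E ->
  mu.-integrable D (EFin \o (fun x => `|f x| ^+ k)) /\
  \int[mu]_(x in D) (`|f x| ^+ k) <= e ^+ k.
Proof.
move=> k0 mD mf Ne; have kN0 : k%:R != 0 :> R by rewrite pnatr_eq0 -lt0n.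
have mfk : measurable_fun D (fun x => `|f x| ^+ k).
  by apply: measurable_funX; exact: measurableT_comp.
have IE : (\int[mu]_(x in D) (`|f x| ^+ k)%:E)%E = ('N[mu]_(k%:R)%:E[EFin \o (f \_ D)] `^ k%:R)%E.
  rewrite powR_Lnorm// [LHS]integral_mkcond; apply: eq_integral => x _.
  rewrite /= powR_mulrn// !patchE; case: ifP => // _.
  by rewrite normr0 expr0n; case: (k) k0.
have N0 := Lnorm_ge0 mu (k%:R)%:E (EFin \o (f \_ D)).
move: Ne N0 IE; case: (Lnorm _ _ _) => [r| |]//; rewrite lte_fin lee_fin => re r0 IE.
have IE' : (\int[mu]_(x in D) (`|f x| ^+ k)%:E)%E = (r ^+ k)%:E.
  by rewrite IE poweR_EFin powR_mulrn.
split; first by apply: integrable_ge0 => //; rewrite IE' ltry.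
by rewrite /Rintegral IE' lerXn2r ?nnegrE ?(le_trans r0)// ltW.
Qed.

Lemma ae_integrable D (f g : 'rV[R]_n -> R) : measurable D -> mu.-integrable D (EFin \o g) ->
  measurable_fun D f -> {ae mu, forall x, D x -> `|f x| <= g x} ->
  mu.-integrable D (EFin \o f).
Proof.
move=> mD ig mf fg; apply/integrableP; split; first exact/measurable_EFinP.
have /integrableP[mg] := ig; apply: le_lt_trans; apply: ae_ge0_le_integral => //.
- by apply: measurableT_comp => //; exact/measurable_EFinP.
- exact: measurableT_comp.
- by apply: filterS fg => x fg Dx; rewrite /= lee_fin (le_trans (fg Dx))// ler_norm.
Qed.

Lemma ae_eq_Rintegral D (f g : 'rV[R]_n -> R) : measurable D -> measurable_fun D f ->
  measurable_fun D g -> {ae mu, forall x, D x -> f x = g x} ->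
  \int[mu]_(x in D) f x = \int[mu]_(x in D) g x.
Proof.
move=> mD mf mg fg; rewrite /Rintegral; congr fine; apply: ae_eq_integral => //.
- exact/measurable_EFinP.
- exact/measurable_EFinP.
- by apply: filterS fg => x fg Dx; rewrite fg.
Qed.

Lemma ae_le_Rintegral D (f g : 'rV[R]_n -> R) : measurable D -> mu.-integrable D (EFin \o f) ->
  mu.-integrable D (EFin \o g) -> {ae mu, forall x, D x -> f x <= g x} ->
  \int[mu]_(x in D) f x <= \int[mu]_(x in D) g x.
Proof.
move=> mD if' ig fg; rewrite -subr_ge0 -RintegralB//.
have mfg : measurable_fun D (fun x => g x - f x).
  by apply: measurable_funB; apply/measurable_EFinP; [exact: measurable_int ig|exact: measurable_int if'].
rewrite (@ae_eq_Rintegral _ _ (fun x => `|g x - f x|))//.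
- by apply: Rintegral_ge0.
- exact: measurableT_comp.
- by apply: filterS fg => x fg Dx; rewrite ger0_norm// subr_ge0 fg.
Qed.

(** * Passing from test functions to W^{1,p}_0 *)

Lemma W1p0_approx Omega (k : nat) phi (e : R) : (0 < k)%N -> open Omega -> 0 < e ->
  W1p0 Omega k%:R phi -> exists2 psi, test_function Omega psi &
  (mu.-integrable Omega (EFin \o (fun x => `|phi x - psi x| ^+ k)) /\
   \int[mu]_(x in Omega) (`|phi x - psi x| ^+ k) <= e) /\
  forall i, mu.-integrable Omega (EFin \o
      (fun x => `|gradient Omega phi x ord0 i - partial i psi x| ^+ k)) /\
   \int[mu]_(x in Omega) (`|gradient Omega phi x ord0 i - partial i psi x| ^+ k) <= e.
Proof.
move=> k0 oO e0 [[Lphi wphi Lgphi] /(_ (Num.min e 1))]; have mO := open_measurable_rV oO.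
(* With [d <= 1], a norm below [d] gives integrals of k-th powers at most [d ^+ k <= d <= e]. *)
set d := Num.min e 1; have d0 : 0 < d by rewrite lt_min e0 ltr01.
have de : d ^+ k <= e.
  apply: (@le_trans _ _ d); last by rewrite ge_min lexx.
  by rewrite ler_iXnr ?(ltW d0)// ge_min lexx orbT.
move=> /(_ d0)[psi tpsi]; rewrite /W1p_norm => N12; exists psi => //; move: N12.
set N1 := Lnorm _ _ _; set N2 := Lnorm _ _ _ => N12.
have [cpsi cdpsi dpsi] := test_function_smooth tpsi.
have gphi := gradientP wphi.
have gpsi : is_weak_gradient Omega psi (fun x => \row_i partial i psi x).
  by apply: C1_is_weak_gradient => // [x _|i x _]; [exact: cpsi|exact: cdpsi].
have gd : is_weak_gradient Omega (phi \- psi) (fun x => gradient Omega phi x - \row_i partial i psi x).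
  by apply: (is_weak_gradientD oO gphi); exact: is_weak_gradientN.
have gd' := gradientP (ex_intro _ _ gd).
have ae_g := gradient_ae oO gd.
have N1d : (N1 < d%:E)%E by apply: le_lt_trans N12; rewrite leeDl// Lnorm_ge0.
have N2d : (N2 < d%:E)%E by apply: le_lt_trans N12; rewrite leeDr// Lnorm_ge0.
have mphi : measurable_fun Omega (fun x => phi x - psi x).
  apply: measurable_funB; first by have [] := (LpP _ k0 mO).1 Lphi.
  by apply: continuous_measurable_rV => // x _; exact: cpsi.
have mgd i : measurable_fun Omega (fun x => gradient Omega (phi \- psi) x ord0 i).
  by have [_ + _] := gd' => /(_ i); exact: Lp_loc_measurable.
have mgd2 i : measurable_fun Omega (fun x => gradient Omega phi x ord0 i - partial i psi x).
  apply: measurable_funB; first by have [] := (LpP _ k0 mO).1 (Lgphi i).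
  by apply: continuous_measurable_rV => // x _; exact: cdpsi.
have [i1 I1] := Lnorm_patch_le k0 mO mphi N1d.
have [i2 I2] := Lnorm_patch_le k0 mO (measurable_enorm mgd) N2d.
split => [|i]; first by split => //; exact: le_trans de.
have le12 : {ae mu, forall x, Omega x ->
    `|gradient Omega phi x ord0 i - partial i psi x| ^+ k <=
    `|enorm (gradient Omega (phi \- psi)%R x)| ^+ k}.
  apply: filterS ae_g => x /[apply] ->; rewrite lerXn2r ?nnegrE//.
  by rewrite (ger0_norm (enorm_ge0 _)) (le_trans _ (le_coord_enorm _ i))// !mxE.
have i3 : mu.-integrable Omega (EFin \o
      (fun x => `|gradient Omega phi x ord0 i - partial i psi x| ^+ k)).
  apply: (ae_integrable mO i2); first by apply: measurable_funX; exact: measurableT_comp.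
  by apply: filterS le12 => x /[apply] ?; rewrite (ger0_norm (exprn_ge0 _ (normr_ge0 _))).
by split => //; apply: le_trans (le_trans I2 de); exact: ae_le_Rintegral.
Qed.

(** A substitute for Hölder's inequality: if the integral of [a ^+ k] is at most [l ^+ k], the
    right-hand side has an integral of order [l]. *)
Lemma mul_le_powD (k : nat) (a b l : R) : (2 <= k)%N -> 0 <= a -> 0 <= b -> 0 < l ->
  a * b <= l * (1 + b ^+ k + a ^+ k / l ^+ k).
Proof.
move=> k2 a0 b0 l0; pose s := a / l; have s0 : 0 <= s by rewrite divr_ge0// ltW.
have -> : a = l * s by rewrite /s mulrC divfK// gt_eqF.
have -> : (l * s) ^+ k / l ^+ k = s ^+ k.
  by rewrite exprMn mulrC mulrA mulVf ?mul1r// expf_neq0// gt_eqF.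
rewrite -mulrA ler_pM2l//.
have H (x y : R) : 0 <= x -> x <= y -> x * y <= 1 + y ^+ k.
  move=> x0 xy; have y0 := le_trans x0 xy.
  apply: (@le_trans _ _ (y ^+ 2)); first by rewrite expr2 ler_wpM2r.
  have [y1|y1] := leP y 1; first by rewrite (le_trans (exprn_ile1 _ y0 y1))// lerDl exprn_ge0.
  by rewrite (@le_trans _ _ (y ^+ k))// ?lerDr// ler_eXn2l// ltW.
have [sb|bs] := leP s b.
  by apply: le_trans (H s b s0 sb) _; rewrite lerDl exprn_ge0.
rewrite mulrC; apply: le_trans (H b s b0 (ltW bs)) _.
by rewrite addrAC lerDl exprn_ge0.
Qed.

Lemma le_add1_pow (k : nat) (y : R) : (0 < k)%N -> 0 <= y -> y <= 1 + y ^+ k.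
Proof.
move=> k0 y0; have [y1|y1] := leP y 1; first by rewrite (le_trans y1)// lerDl exprn_ge0.
by rewrite (@le_trans _ _ (y ^+ k))// ?lerDr// ler_eXnr// ltW.
Qed.

Lemma integrable_cst_fin D (c : R) : measurable D -> (mu D < +oo)%E ->
  mu.-integrable D (EFin \o (fun=> c)).
Proof. by move=> mD Dy; apply: (@bounded_integrable _ (cst c) `|c|). Qed.

Lemma integrable_addR D (f g : 'rV[R]_n -> R) : measurable D -> mu.-integrable D (EFin \o f) ->
  mu.-integrable D (EFin \o g) -> mu.-integrable D (EFin \o (fun x => f x + g x)).
Proof. by move=> mD if1 if2; exact: (integrableD mD if1 if2). Qed.

Lemma integrable_scaleR D (c : R) (f : 'rV[R]_n -> R) : measurable D ->
  mu.-integrable D (EFin \o f) -> mu.-integrable D (EFin \o (fun x => c * f x)).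
Proof. by move=> mD if1; exact: (integrableZl mD c if1). Qed.

(** The integrand is what the chain rule gives for the i-th partial derivative of a function of [x]
    and [phi x]. It is affine in the gradient with bounded Lipschitz coefficients, hence its
    integral is continuous along approximation in W^{1,k}, and its vanishing on test functions
    passes to [phi]. *)
Lemma W1p0_chain_rule Omega (k : nat) phi i (P Pz : 'rV[R]_n -> R -> R) (K : R) :
  (2 <= k)%N -> open Omega -> (mu Omega < +oo)%E -> W1p0 Omega k%:R phi ->
  (forall f, measurable_fun Omega f -> measurable_fun Omega (fun x => P x (f x))) ->
  (forall f, measurable_fun Omega f -> measurable_fun Omega (fun x => Pz x (f x))) ->
  (forall x, Omega x -> `|P x 0| <= K) -> (forall x z, Omega x -> `|Pz x z| <= K) ->
  (forall x y z, Omega x -> `|P x y - P x z| <= K * `|y - z|) ->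
  (forall x y z, Omega x -> `|Pz x y - Pz x z| <= K * `|y - z|) ->
  (forall psi, test_function Omega psi ->
    \int[mu]_(x in Omega) (P x (psi x) + Pz x (psi x) * partial i psi x) = 0) ->
  mu.-integrable Omega (EFin \o
    (fun x => P x (phi x) + Pz x (phi x) * gradient Omega phi x ord0 i)) /\
  \int[mu]_(x in Omega) (P x (phi x) + Pz x (phi x) * gradient Omega phi x ord0 i) = 0.
Proof.
move=> k2 oO Oy W mP mPz P0 PzK Plip Pzlip Ptest; have k0 : (0 < k)%N by exact: ltn_trans k2.
have mO := open_measurable_rV oO.
have [[Lphi wphi /(_ i) Lg] _] := W.
set g := fun x => gradient Omega phi x ord0 i in Lg *.
have [mphi iphi] := (LpP _ k0 mO).1 Lphi.
have [mg ig] := (LpP _ k0 mO).1 Lg.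
pose D f df (x : 'rV[R]_n) : R := P x (f x) + Pz x (f x) * df x.
have mD f df : measurable_fun Omega f -> measurable_fun Omega df -> measurable_fun Omega (D f df).
  by move=> mf mdf; apply: measurable_funD; [exact: mP|apply: measurable_funM => //; exact: mPz].
have iD : mu.-integrable Omega (EFin \o D phi g).
  (* The 3 collects the bound on [P x 0] and one unit from each of |y| <= 1 + |y|^k for y = phi x
     and y = g x. *)
  apply: (@ae_integrable _ _ (fun x => `|K| * (3 + (`|phi x| ^+ k + `|g x| ^+ k)))).
  - exact: mO.
  - apply: integrable_scaleR => //; apply: integrable_addR => //.
      exact: integrable_cst_fin.
    exact: integrable_addR.
  - exact: mD.
  - apply: aeW => x Ox; rewrite /D.
    have K1 : K <= `|K| by exact: ler_norm.
    have p1 := le_add1_pow k0 (normr_ge0 (phi x)).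
    have g1 := le_add1_pow k0 (normr_ge0 (g x)).
    have h1 := Plip x (phi x) 0 Ox; rewrite subr0 in h1.
    have h2 := P0 x Ox; have h3 := PzK x (phi x) Ox.
    have -> : P x (phi x) + Pz x (phi x) * g x =
      (P x (phi x) - P x 0) + P x 0 + Pz x (phi x) * g x by rewrite subrK.
    apply: le_trans (ler_normD _ _) _; rewrite normrM.
    apply: (@le_trans _ _ (`|K| * `|phi x| + `|K| + `|K| * `|g x|)).
      apply: lerD; last by rewrite ler_wpM2r// (le_trans h3).
      apply: le_trans (ler_normD _ _) _; apply: lerD; last exact: le_trans h2 _.
      by apply: le_trans h1 _; rewrite ler_wpM2r.
    rewrite -[X in _ + X + _]mulr1 -!mulrDr ler_wpM2l//; lra.
split; first exact: iD.
set I := \int[mu]_(x in Omega) _.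
pose G := \int[mu]_(x in Omega) (5 + `|g x| ^+ k).
(* The integral is a fixed number bounded by every positive multiple of a fixed constant. *)
suff H (l : R) : 0 < l -> `|I| <= l * (`|K| * (G + 3)).
  apply/eqP; rewrite -normr_le0; apply/ler_addgt0Pr => e e0; rewrite add0r.
  set c := `|K| * _ in H; have c1 : 0 < `|c| + 1 by rewrite ltr_wpDl.
  apply: le_trans (H _ (divr_gt0 e0 c1)) _; rewrite mulrAC ler_pdivrMr// ler_pM2l//.
  by rewrite (le_trans (ler_norm c))// lerDl.
move=> l0; have lk0 : 0 < l ^+ k by exact: exprn_gt0.
have [psi tpsi [[ia Ia] /(_ i)[ib Ib]]] := W1p0_approx k0 oO lk0 W.
have [cpsi cdpsi dpsi] := test_function_smooth tpsi.
have mpsi : measurable_fun Omega psi by apply: continuous_measurable_rV => // x _; exact: cpsi.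
have mdpsi : measurable_fun Omega (partial i psi).
  by apply: continuous_measurable_rV => // x _; exact: cdpsi.
set a := fun x => `|phi x - psi x| ^+ k in ia Ia.
set b := fun x => `|gradient Omega phi x ord0 i - partial i psi x| ^+ k in ib Ib.
(* Sum of three instances of [mul_le_powD], for the pairs (|phi - psi|, 1), (|phi - psi|, |g|) and
   (|g - partial i psi|, 1); the constants add up to 2 + 1 + 2 = 5. The last two terms integrate to
   at most 2 + 1, whence [G + 3]. *)
pose M x := (l * `|K|) * ((5 + `|g x| ^+ k) + (2 / l ^+ k * a x + (l ^+ k)^-1 * b x)).
have i5 : mu.-integrable Omega (EFin \o (fun x => 5 + `|g x| ^+ k)).
  by apply: integrable_addR => //; exact: integrable_cst_fin.
have i2a : mu.-integrable Omega (EFin \o (fun x => 2 / l ^+ k * a x)) by exact: integrable_scaleR.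
have i2b : mu.-integrable Omega (EFin \o (fun x => (l ^+ k)^-1 * b x)) by exact: integrable_scaleR.
have iab := integrable_addR mO i2a i2b.
have iM : mu.-integrable Omega (EFin \o M).
  by apply: integrable_scaleR => //; exact: integrable_addR.
have DM x : Omega x -> `|D phi g x - D psi (partial i psi) x| <= M x.
  move=> Ox; pose A : R := `|phi x - psi x|; pose B : R := `|g x - partial i psi x|.
  have h1 := mul_le_powD k2 (normr_ge0 (phi x - psi x)) (@ler01 R) l0.
  have h2 := mul_le_powD k2 (normr_ge0 (phi x - psi x)) (normr_ge0 (g x)) l0.
  have h3 := mul_le_powD k2 (normr_ge0 (g x - partial i psi x)) (@ler01 R) l0.
  have -> : D phi g x - D psi (partial i psi) x = (P x (phi x) - P x (psi x)) +
      (Pz x (phi x) - Pz x (psi x)) * g x + Pz x (psi x) * (g x - partial i psi x).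
    by rewrite /D; ring.
  have K1 : K <= `|K| by exact: ler_norm.
  apply: (@le_trans _ _ (`|K| * (A * 1) + `|K| * (A * `|g x|) + `|K| * (B * 1))).
    apply: le_trans (ler_normD _ _) _; apply: lerD.
      apply: le_trans (ler_normD _ _) _; apply: lerD.
        by rewrite mulr1; apply: le_trans (Plip _ _ _ Ox) _; rewrite ler_wpM2r.
      rewrite normrM mulrA ler_wpM2r//; apply: le_trans (Pzlip _ _ _ Ox) _.
      by rewrite ler_wpM2r.
    by rewrite normrM mulr1 ler_wpM2r// (le_trans (PzK _ _ Ox)).
  have -> : `|K| * (A * 1) + `|K| * (A * `|g x|) + `|K| * (B * 1) =
    `|K| * (A * 1 + A * `|g x| + B * 1) by ring.
  rewrite (_ : M x = `|K| * (l * ((5 + `|g x| ^+ k) +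
    (2 / l ^+ k * a x + (l ^+ k)^-1 * b x)))); last by rewrite /M; ring.
  rewrite ler_wpM2l//.
  rewrite expr1n in h1 h3; rewrite -/(a x) in h1 h2; rewrite -/(b x) in h3.
  rewrite -/A in h1 h2; rewrite -/B in h3.
  apply: le_trans (lerD (lerD h1 h2) h3) _.
  by rewrite le_eqVlt; apply/orP; left; apply/eqP; ring.
have iDpsi : mu.-integrable Omega (EFin \o D psi (partial i psi)).
  have -> : D psi (partial i psi) =
      (fun x => D phi g x + (-1) * (D phi g x - D psi (partial i psi) x)).
    by apply/funext => x; ring.
  apply: integrable_addR => //; apply: integrable_scaleR => //.
  apply: (ae_integrable mO iM); first by apply: measurable_funB; exact: mD.
  by apply: aeW => x; exact: DM.
have -> : I = \int[mu]_(x in Omega) (D phi g x - D psi (partial i psi) x).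
  by rewrite RintegralB// [X in _ - X](_ : _ = 0) ?subr0//; exact: Ptest.
have idd : mu.-integrable Omega (EFin \o (fun x => D phi g x - D psi (partial i psi) x)).
  have -> : (fun x => D phi g x - D psi (partial i psi) x) =
     (fun x => D phi g x + (-1) * D psi (partial i psi) x).
    by apply/funext => x; ring.
  by apply: integrable_addR => //; exact: integrable_scaleR.
apply: le_trans (le_normr_Rintegral mO idd) _.
apply: (@le_trans _ _ (\int[mu]_(x in Omega) M x)).
  by apply: le_Rintegral => //; exact: (integrable_norm idd).
have -> : \int[mu]_(x in Omega) M x = (l * `|K|) * (G +
    (2 / l ^+ k * \int[mu]_(x in Omega) a x + (l ^+ k)^-1 * \int[mu]_(x in Omega) b x)).
  rewrite /M RintegralZl//; last exact: integrable_addR.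
  by rewrite (RintegralD mO i5 iab) (RintegralD mO i2a i2b) (RintegralZl _ mO ia) (RintegralZl _ mO ib).
rewrite -mulrA ler_wpM2l ?(ltW l0)// ler_wpM2l// -/G lerD2l.
have -> : 3 = 2 + 1 :> R by lra.
apply: lerD.
  by rewrite -mulrA ler_piMr// mulrC ler_pdivrMr// mul1r.
by rewrite mulrC ler_pdivrMr// mul1r.
Qed.

(* A smooth truncation at height [e]: as [e] tends to [0], [sat e] tends to [0]
   uniformly, while its derivative tends to the indicator function of [0]. *)
Definition rsq (e z : R) : R := (1 + (z / e) ^+ 2)^-1.

Definition sat (e z : R) : R := z * rsq e z.

Definition dsat (e z : R) : R := 2 * rsq e z ^+ 2 - rsq e z.

Lemma rsq_bound e z : 0 < rsq e z <= 1.
Proof.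
rewrite /rsq invr_gt0 invf_le1 ?lerDl ?sqr_ge0 ?andbT//;
by rewrite ltr_pwDl// sqr_ge0.
Qed.

Lemma is_derive_sat e (z : R) : 0 < e -> is_derive z 1 (sat e) (dsat e z).
Proof.
move=> e0; have d0 : 1 + (z / e) ^+ 2 != 0 by rewrite gt_eqF// ltr_pwDl// sqr_ge0.
have d1 : is_derive z 1 (fun z : R => 1 + (z / e) ^+ 2) (2 * z / e ^+ 2).
  have H := isD_add (isD_cst 1 z 1) (isD_exp 2 (isD_mul (is_derive_id z 1) (isD_cst e^-1 z 1))).
  apply: (is_derive_eq H).
  by rewrite /= expr1 mulr0 addr0 mul1r add0r; field; rewrite gt_eqF.
have H := isD_mul (is_derive_id z 1) (@is_derive_comp R _ (@GRing.inv R) (fun z : R => 1 + (z / e) ^+ 2) z 1 _ _ (isD_inv d0) d1).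
apply: (is_derive_eq H); rewrite /dsat /rsq /=; move: d0 => /=.
set u := 1 + _ => u0;
have zu : z * (2 * z / e ^+ 2) = 2 * (u - 1) by rewrite /u; field; rewrite gt_eqF.
by rewrite mulrCA zu; field.
Qed.

Lemma sum_squares_bound (s t : R) :
  [/\ `|s| <= 1 + s ^+ 2, `|t + s| <= (1 + s ^+ 2) * (1 + t ^+ 2) &
      `|1 - s * t| <= (1 + s ^+ 2) * (1 + t ^+ 2)].
Proof.
have := sqr_ge0 (s * t); have := sqr_ge0 (2 * s - 1); have := sqr_ge0 (2 * s + 1).
have := sqr_ge0 (2 * t - 1); have := sqr_ge0 (2 * t + 1).
have := sqr_ge0 (s + t); have := sqr_ge0 (s - t); rewrite !expr2 => *.
by split; rewrite ler_norml; apply/andP; split; lra.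
Qed.

Lemma rsq_lip e y z : 0 < e -> `|rsq e y - rsq e z| <= e^-1 * `|y - z|.
Proof.
move=> e0; pose s := y / e; pose t := z / e.
have -> : e^-1 * `|y - z| = `|s - t|.
  by rewrite /s /t -mulrBl normrM [`|e^-1|]gtr0_norm ?invr_gt0// mulrC.
rewrite /rsq -/s -/t.
have s1 : 0 < 1 + s ^+ 2 by rewrite ltr_pwDl// sqr_ge0.
have t1 : 0 < 1 + t ^+ 2 by rewrite ltr_pwDl// sqr_ge0.
have -> : (1 + s ^+ 2)^-1 - (1 + t ^+ 2)^-1 = (t - s) * ((t + s) / ((1 + s ^+ 2) * (1 + t ^+ 2))).
  by field; rewrite ?gt_eqF.
rewrite normrM distrC ler_piMr// normrM normfV [`|_ * _|]gtr0_norm ?mulr_gt0//.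
by rewrite ler_pdivrMr ?mulr_gt0// mul1r; have [] := sum_squares_bound s t.
Qed.

Lemma dsat_lip e y z : 0 < e -> `|dsat e y - dsat e z| <= 5 / e * `|y - z|.
Proof.
move=> e0; have := rsq_lip y z e0; rewrite /dsat.
have := rsq_bound e y; have := rsq_bound e z.
set r := rsq e y; set r' := rsq e z => /andP[r0 r1] /andP[s0 s1] H.
have -> : 2 * r ^+ 2 - r - (2 * r' ^+ 2 - r') = (2 * (r + r') - 1) * (r - r') by ring.
rewrite normrM -mulrA; apply: ler_pM => //; rewrite ler_norml; apply/andP; split; lra.
Qed.

Lemma dsat_le e z : `|dsat e z| <= 1.
Proof.
rewrite /dsat; have := rsq_bound e z; set r := rsq e z => /andP[r0 r1].
by rewrite ler_norml; apply/andP; split; nra.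
Qed.

Lemma sat_le e z : 0 < e -> `|sat e z| <= e.
Proof.
move=> e0; rewrite /sat /rsq; set s := z / e.
have -> : z = e * s by rewrite /s mulrC divfK// gt_eqF.
have s1 : 0 < 1 + s ^+ 2 by rewrite ltr_pwDl// sqr_ge0.
rewrite -mulrA normrM gtr0_norm// ler_piMr ?(ltW e0)// normrM normfV [`|1 + _|]gtr0_norm//.
by rewrite ler_pdivrMr// mul1r; have [] := sum_squares_bound s 0.
Qed.

Lemma sat_lip e y z : 0 < e -> `|sat e y - sat e z| <= `|y - z|.
Proof.
move=> e0; rewrite /sat /rsq; pose s := y / e; pose t := z / e.
have ey : y = e * s by rewrite /s mulrC divfK// gt_eqF.
have ez : z = e * t by rewrite /t mulrC divfK// gt_eqF.
rewrite -/s -/t; clearbody s t; rewrite ey ez -!mulrA -!mulrBr !normrM ler_wpM2l//.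
have s1 : 0 < 1 + s ^+ 2 by rewrite ltr_pwDl// sqr_ge0.
have t1 : 0 < 1 + t ^+ 2 by rewrite ltr_pwDl// sqr_ge0.
have -> : s / (1 + s ^+ 2) - t / (1 + t ^+ 2) =
    (s - t) * ((1 - s * t) / ((1 + s ^+ 2) * (1 + t ^+ 2))).
  by field; rewrite ?gt_eqF.
rewrite normrM ler_piMr// normrM normfV [`|_ * (_ + _)|]gtr0_norm ?mulr_gt0//.
by rewrite ler_pdivrMr ?mulr_gt0// mul1r; have [] := sum_squares_bound s t.
Qed.

Lemma cvg_dsat z : (fun m => dsat m.+1%:R^-1 z) @ \oo --> (if z == 0 then 1 else 0 : R).
Proof.
case: eqVneq => [->|z0].
  rewrite (_ : (fun _ => _) = cst 1); first exact: cvg_cst.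
  by apply/funext => m; rewrite /dsat /rsq mul0r expr0n /= addr0 invr1 expr1n mulr1 /=; ring.
have H : (fun m => rsq m.+1%:R^-1 z) @ \oo --> (0 : R).
  apply: (@squeeze_cvgr _ _ _ _ (cst 0) (fun m => harmonic m * (z ^+ 2)^-1)).
  - apply: nearW => m; have /andP[r0 _] := rsq_bound m.+1%:R^-1 z; rewrite (ltW r0)/=.
    rewrite /rsq /harmonic invrK -invfM lef_pV2 ?posrE; last 2 first.
    + by rewrite ltr_pwDl// sqr_ge0.
    + by rewrite mulr_gt0// exprn_even_gt0.
    rewrite exprMn mulrC; apply: ler_wpDl => //.
    by rewrite ler_wpM2l ?sqr_ge0// -natrX ler_nat expnS expn1 leq_pmulr.
  - exact: cvg_cst.
  - rewrite -(mul0r (z ^+ 2)^-1); apply: cvgM; [exact: cvg_harmonic|exact: cvg_cst].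
have -> : (fun m => dsat m.+1%:R^-1 z) =
    (fun m => 2 * (rsq m.+1%:R^-1 z * rsq m.+1%:R^-1 z) - rsq m.+1%:R^-1 z).
  by apply/funext => m; rewrite /dsat expr2.
rewrite (_ : 0 = 2 * (0 * 0) - 0 :> R); last by rewrite mulr0 subr0 mulr0.
by apply: cvgB => //; apply: cvgM; [exact: cvg_cst|exact: cvgM].
Qed.

Lemma test_function_bounded Omega psi : open Omega -> test_function Omega psi ->
  exists M : R, forall x, `|psi x| <= M /\ forall i, `|partial i psi x| <= M.
Proof.
move=> oO tpsi; have [cpsi cdpsi _] := test_function_smooth tpsi.
have [C [cC CO psi0 dpsi0]] := test_function_support oO tpsi.
have [M0 M0P] := continuous_bounded cC (fun x _ => cpsi x).
have /choice[M1 M1P] i := continuous_bounded cC (fun x _ => cdpsi i x).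
exists (`|M0| + \sum_i `|M1 i|) => x.
have S0 : 0 <= \sum_i `|M1 i| by exact: sumr_ge0.
split => [|i].
  have [Cx|Cx] := pselect (C x); last by rewrite psi0// normr0 addr_ge0.
  by apply: le_trans (M0P _ Cx) _; rewrite ler_wpDr// ler_norm.
have [Cx|Cx] := pselect (C x); last by rewrite dpsi0// normr0 addr_ge0.
apply: le_trans (M1P i _ Cx) _; rewrite ler_wpDl//; apply: le_trans (ler_norm _) _.
by rewrite (bigD1 i)//= lerDl sumr_ge0.
Qed.

(** For a test function [zeta], the integral of the i-th derivative of [zeta * sat e phi] is 0. As
    [e] tends to 0, the term with [sat] disappears and [dsat e phi] becomes the indicator of the
    zero set of [phi]; the fundamental lemma then applies to the gradient restricted to that set. *)
Lemma gradient_zero_set Omega (k : nat) phi : (2 <= k)%N -> open Omega -> (mu Omega < +oo)%E ->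
  W1p0 Omega k%:R phi ->
  {ae mu, forall x, Omega x -> phi x = 0 -> gradient Omega phi x = 0}.
Proof.
move=> k2 oO Oy W; have k0 : (0 < k)%N by exact: ltn_trans k2.
have mO := open_measurable_rV oO.
have [[Lphi wphi Lg] _] := W.
have [mphi iphi] := (LpP _ k0 mO).1 Lphi.
pose h i x := gradient Omega phi x ord0 i * (if phi x == 0 then 1 else 0 : R).
have mi : measurable_fun Omega (fun x => if phi x == 0 then 1 else 0 : R).
  have m0 : measurable_fun [set: R] (\1_[set (0 : R)] : R -> R).
    by apply: measurable_indic; exact: measurable_set1.
  apply: eq_measurable_fun (measurableT_comp m0 mphi) => x _ /=.
  rewrite indicE; case: eqP => [->|h0]; first by rewrite mem_set.
  by rewrite memNset.
have mh i : measurable_fun Omega (h i).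
  by apply: measurable_funM => //; have [] := (LpP _ k0 mO).1 (Lg i).
suff H i : {ae mu, forall x, Omega x -> h i x = 0}.
  have : {ae mu, forall x, forall i, Omega x -> h i x = 0}.
    by apply: filter_forall => i; exact: H.
  apply: filterS => x hx Ox phi0; apply/rowP => i; rewrite mxE.
  by have := hx i Ox; rewrite /h phi0 eqxx mulr1.
have [_ gL _] := gradientP wphi.
apply: fundamental_lemma => //.
  move=> K cK KO; have mK := compact_measurable_rV cK.
  apply/(Lp1_integrable _ mK).
  apply: (@ae_integrable _ _ (fun x => `|gradient Omega phi x ord0 i|)) => //.
  - by apply: integrable_norm; apply/(Lp1_integrable _ mK); exact: gL.
  - exact: measurable_funS mO KO _.
  - apply: aeW => x _; rewrite /h normrM ler_piMr//; case: ifP => _; rewrite ?normr1 ?normr0//.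
move=> zeta tz.
have [cz cdz dz] := test_function_smooth tz.
have [M MP] := test_function_bounded oO tz.
have [C [cC CO z0 dz0]] := test_function_support oO tz.
have M0 : 0 <= M by have [+ _] := MP 0; exact: le_trans.
pose e m : R := m.+1%:R^-1.
have e0 m : 0 < e m by rewrite invr_gt0.
have mzeta : measurable_fun Omega zeta by apply: continuous_measurable_rV => // x _; exact: cz.
have mdzeta : measurable_fun Omega (partial i zeta).
  by apply: continuous_measurable_rV => // x _; exact: cdz.
have csat m : continuous (sat (e m)).
  by move=> y; apply: is_derive_continuous1; exact: is_derive_sat.
have cdsat m : continuous (dsat (e m)).
  move=> y; apply/cvgrPdist_le => /= d d0; near=> z.
  apply: le_trans (dsat_lip _ _ (e0 m)) _; rewrite mulrC -ler_pdivlMr ?divr_gt0//.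
  near: z; apply: cvgr_dist_le; first exact: cvg_id.
  by rewrite divr_gt0// divr_gt0.
have M1 m : M <= M * (1 + 5 / e m).
  by rewrite ler_peMr// lerDl divr_ge0// ltW.
(* The Lipschitz constant may depend on [m]: the chain rule is used for each fixed [m], before the
   limit. *)
have chain m : \int[mu]_(x in Omega) (partial i zeta x * sat (e m) (phi x) +
    zeta x * dsat (e m) (phi x) * gradient Omega phi x ord0 i) = 0.
  apply: (proj2 (@W1p0_chain_rule Omega k phi i (fun x z => partial i zeta x * sat (e m) z)
    (fun x z => zeta x * dsat (e m) z) (M * (1 + 5 / e m)) k2 oO Oy W _ _ _ _ _ _ _)).
  - move=> f mf; apply: measurable_funM => //.
    exact: measurableT_comp (continuous_measurable_fun (csat m)) mf.
  - move=> f mf; apply: measurable_funM => //.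
    exact: measurableT_comp (continuous_measurable_fun (cdsat m)) mf.
  - by move=> x Ox; rewrite /sat mul0r mulr0 normr0; exact: le_trans (M1 m).
  - move=> x z Ox; apply: le_trans (M1 m); rewrite normrM.
    have [zM _] := MP x; apply: le_trans zM; rewrite ler_piMr//; exact: dsat_le.
  - move=> x y z Ox; rewrite -mulrBr normrM; have [_ /(_ i) zM] := MP x.
    apply: ler_pM => //; first exact: le_trans (M1 m).
    exact: sat_lip.
  - move=> x y z Ox; rewrite -mulrBr normrM -mulrA; have [zM _] := MP x.
    apply: ler_pM => //; apply: le_trans (dsat_lip _ _ (e0 m)) _.
    by rewrite ler_wpM2r// lerDr.
  - move=> psi tpsi; have [cpsi cdpsi dpsi] := test_function_smooth tpsi.
    have [] := @ibp_open R n Omega C (fun x => zeta x * sat (e m) (psi x))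
      (fun x => partial i zeta x * sat (e m) (psi x) +
                zeta x * dsat (e m) (psi x) * partial i psi x) i oO cC CO.
    + by move=> x /z0 ->; rewrite mul0r.
    + move=> x _.
      have Hd := isD_mul (dz i x) (is_derive_comp (is_derive_sat (psi x) (e0 m)) (dpsi i x)).
      by apply: (is_derive_eq Hd); rewrite mulrA.
    + move=> x _; apply: cont_add; apply: cont_mul.
      * exact: cdz.
      * by apply: cont_comp; [exact: cpsi|exact: csat].
      * by apply: cont_mul; [exact: cz|apply: cont_comp; [exact: cpsi|exact: cdsat]].
      * exact: cdpsi.
    by move=> _ _; rewrite /Rintegral => ->.
have ig : mu.-integrable Omega (EFin \o (fun x => M * (2 + `|gradient Omega phi x ord0 i| ^+ k))).
  apply: integrable_scaleR => //; apply: integrable_addR => //; first exact: integrable_cst_fin.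
  by have [] := (LpP _ k0 mO).1 (Lg i).
have [| | | |_ Hl] := @Rdominated_cvg _ _ _ mu Omega
  (fun m x => partial i zeta x * sat (e m) (phi x) +
    zeta x * dsat (e m) (phi x) * gradient Omega phi x ord0 i)
  (fun x => h i x * zeta x) _ mO _ _ _ ig.
- move=> m; apply: measurable_funD; apply: measurable_funM => //.
  + exact: measurableT_comp (continuous_measurable_fun (csat m)) mphi.
  + by apply: measurable_funM => //; exact: measurableT_comp (continuous_measurable_fun (cdsat m)) mphi.
  + by have [] := (LpP _ k0 mO).1 (Lg i).
- exact: measurable_funM.
- apply: aeW => x Ox; rewrite -[h i x * zeta x]add0r; apply: cvgD.
    rewrite -(mulr0 (partial i zeta x)); apply: cvgM; first exact: cvg_cst.
    apply: (@squeeze_cvgr _ _ _ _ (fun m => - e m) e).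
    + by apply: nearW => m; rewrite -ler_norml sat_le.
    + rewrite -oppr0; apply: cvgN; exact: cvg_harmonic.
    + exact: cvg_harmonic.
  rewrite (_ : h i x * zeta x = zeta x * (if phi x == 0 then 1 else 0) * gradient Omega phi x ord0 i).
    by apply: cvgM; [apply: cvgM; [exact: cvg_cst|exact: cvg_dsat]|exact: cvg_cst].
  rewrite /h; set c := if _ then _ else _; ring.
- move=> m x Ox; have [zM /(_ i) dzM] := MP x.
  apply: le_trans (ler_normD _ _) _.
  rewrite (_ : M * (2 + `|gradient Omega phi x ord0 i| ^+ k) =
    M * 1 + M * 1 * (1 + `|gradient Omega phi x ord0 i| ^+ k)); last by ring.
  have e1 : e m <= 1 by rewrite /e invf_le1 ?ltr0n// ler1n.
  apply: lerD; rewrite normrM; apply: ler_pM => //.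
  + exact: le_trans (sat_le _ (e0 m)) e1.
  + by rewrite normrM; apply: ler_pM => //; exact: dsat_le.
  + exact: le_add1_pow.
apply/esym/(cvg_unique _ _ Hl) => //.
by rewrite (_ : (fun m => _) = cst 0); [exact: cvg_cst|apply/funext => m; exact: chain].
Unshelve. all: by end_near. Qed.

End fundamental.

(** * Radial functions and calibrations on the annulus *)

Section radial.
Context (R : realType) (n : nat).
Local Notation mu := (lebesgue_rV R n).
Local Notation e_ i := (delta_mx ord0 i : 'rV[R]_n).
Local Notation A := (annulus R n).
Implicit Types (x : 'rV[R]_n).

Definition sqn x : R := \sum_i x ord0 i ^+ 2.

Definition lgr x : R := - ln (enorm x).

Lemma sqnE x : sqn x = enorm x ^+ 2.
Proof. by rewrite enorm_sqr. Qed.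

Lemma continuous_enorm : continuous (@enorm R n).
Proof.
move=> x; apply: (@cont_comp _ _ _ (@Num.sqrt R) sqn); last exact: sqrt_continuous.
apply: (smooth_continuous (@openT _) _ I); apply: smooth_sum => i.
by apply: (smooth_eq (smooth_mul (smooth_coord _ i) (smooth_coord _ i))) => y _; rewrite expr2.
Qed.

Lemma open_annulus : open A.
Proof.
have -> : A = (@enorm R n) @^-1` `](expR 1)^-1, 1[%classic.
  by apply/seteqP; split => x; rewrite /annulus /= in_itv/=.
by apply: open_comp; [move=> x _; exact: continuous_enorm|exact: interval_open].
Qed.

Lemma annulus_lty : (mu A < +oo)%E.
Proof.
apply: le_lt_trans (lebesgue_rV_box n (1 : R)); apply: le_measure; rewrite ?inE.
- exact: open_measurable_rV open_annulus.
- exact: measurable_box.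
- move=> x /andP[_ x1] i; rewrite /= in_itv/= -ler_norml.
  by rewrite (le_trans (le_coord_enorm x i))// ltW.
Qed.

Lemma annulus_enorm_gt0 x : A x -> 0 < enorm x.
Proof. by move=> /andP[x1 _]; apply: lt_trans x1; rewrite invr_gt0 expR_gt0. Qed.

Lemma annulus_sqn_gt0 x : A x -> 0 < sqn x.
Proof. by move=> /annulus_enorm_gt0 x0; rewrite sqnE exprn_gt0. Qed.

Lemma lgr_annulus x : A x -> 0 < lgr x < 1.
Proof.
move=> Ax; have x0 := annulus_enorm_gt0 Ax; case/andP: Ax => xe x1.
rewrite /lgr oppr_gt0 ltrNl -{1}ln1 ltr_ln ?posrE// x1 /=.
by rewrite -[X in X < _](expRK (-1)) expRN ltr_ln ?posrE// invr_gt0 expR_gt0.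
Qed.

Lemma expR_lgr x : A x -> expR (lgr x) = (enorm x)^-1.
Proof. by move=> Ax; rewrite /lgr expRN lnK// posrE; exact: annulus_enorm_gt0. Qed.

Lemma annulus_expR x : 0 < enorm x -> 0 < lgr x < 1 -> A x.
Proof.
move=> x0; rewrite /lgr oppr_gt0 ltrNl -{1}ln1 ltr_ln ?posrE// => /andP[x1].
rewrite -[X in X < _ -> _](expRK (-1)) expRN ltr_ln ?posrE ?invr_gt0 ?expR_gt0// => xe.
by rewrite /annulus /= xe.
Qed.

Lemma lgrE x : 0 < sqn x -> lgr x = - (2^-1 * ln (sqn x)).
Proof.
rewrite sqnE => x0; have e0 : 0 < enorm x.
  by rewrite lt_neqAle enorm_ge0 andbT eq_sym; apply: contraTneq x0 => ->; rewrite expr0n ltxx.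
rewrite /lgr; have -> : ln (enorm x ^+ 2) = 2 * ln (enorm x) by rewrite lnXn// mulr_natl.
by rewrite mulKf.
Qed.

Lemma smooth_sqn U : smooth_on U sqn.
Proof.
apply: smooth_sum => i.
by apply: (smooth_eq (smooth_mul (smooth_coord _ i) (smooth_coord _ i))) => y _; rewrite expr2.
Qed.

Lemma smooth_lgr : smooth_on A lgr.
Proof.
have H := smooth_comp (@open_gt R 0) (@smooth1_ln R) annulus_sqn_gt0 (smooth_sqn A).
apply: (smooth_eq (smooth_mul (smooth_cst A (- 2^-1)) H)) => x /annulus_sqn_gt0 x0.
by rewrite lgrE// mulNr.
Qed.

Lemma is_derive_sqn x i : is_derive x (e_ i) sqn (2 * x ord0 i).
Proof.
have H : is_derive x (e_ i) (\sum_j (fun y : 'rV[R]_n => y ord0 j ^+ 2))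
    (\sum_j 2 * x ord0 j * (j == i)%:R).
  apply: is_derive_sum => j; have := isD_exp 2 (is_derive_coord x i j).
  by rewrite /= expr1.
have -> : sqn = \sum_j (fun y : 'rV[R]_n => y ord0 j ^+ 2).
  by apply/funext => y; rewrite fct_sumE.
apply: (is_derive_eq H); rewrite (bigD1 i)//= eqxx mulr1 big1 ?addr0// => j /negPf ->.
by rewrite mulr0.
Qed.

Lemma is_derive_lgr x i : A x -> is_derive x (e_ i) lgr (- (x ord0 i / sqn x)).
Proof.
move=> Ax; have x0 := annulus_sqn_gt0 Ax.
have H := isD_opp (isD_scale 2^-1 (is_derive_comp (is_derive1_ln x0) (is_derive_sqn x i))).
have := @near_eq_is_derive R _ R _ lgr x (e_ i) _ _ H.
move=> /(_ _)/is_derive_eq; apply.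
  by apply: filterS (open_nbhs_nbhs (conj open_annulus Ax)) => y /annulus_sqn_gt0 /lgrE ->.
by field; rewrite gt_eqF.
Qed.

Lemma continuous_lgr x : A x -> {for x, continuous lgr}.
Proof. exact: (smooth_continuous open_annulus smooth_lgr). Qed.

Definition dotp (x y : 'rV[R]_n) : R := \sum_i x ord0 i * y ord0 i.

Lemma dotp_le x y : `|dotp x y| <= enorm x * enorm y.
Proof.
have X0 := enorm_ge0 x; have Y0 := enorm_ge0 y.
have [x0|xn0] := eqVneq (enorm x) 0.
  have xi0 i : x ord0 i = 0.
    by apply/eqP; rewrite -normr_le0 -[leRHS]x0 le_coord_enorm.
  rewrite /dotp big1 ?normr0 ?mulr_ge0// => i _; by rewrite xi0 mul0r.
have xp : 0 < enorm x ^+ 2 by rewrite exprn_even_gt0.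
suff : dotp x y ^+ 2 <= (enorm x * enorm y) ^+ 2.
  by move=> H; rewrite -(@ler_pXn2r _ 2) ?nnegrE ?mulr_ge0 ?normr_ge0 ?real_normK ?num_real.
set c := dotp x y; set s := c / enorm x ^+ 2.
have : 0 <= \sum_i (y ord0 i - s * x ord0 i) ^+ 2 by apply: sumr_ge0 => i _; exact: sqr_ge0.
have -> : \sum_i (y ord0 i - s * x ord0 i) ^+ 2 = enorm y ^+ 2 - 2 * s * c + s ^+ 2 * enorm x ^+ 2.
  rewrite !enorm_sqr /c /dotp !mulr_sumr -sumrB -big_split; apply: eq_bigr => i _ /=; ring.
move=> H; have E : (enorm x * enorm y) ^+ 2 - c ^+ 2 =
    enorm x ^+ 2 * (enorm y ^+ 2 - 2 * s * c + s ^+ 2 * enorm x ^+ 2).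
  by rewrite /s; field.
by rewrite -subr_ge0 E; apply: mulr_ge0 => //; exact: ltW.
Qed.

(* The Jacobian of x |-> (lgr x, x / |x|) is |x| ^- n: up to sign, [radw i] is
   the i-th component of the divergence-free field x / |x| ^+ n. *)
Definition radw i x : R := - (x ord0 i * expR (lgr x) ^+ n).

Definition dradw i x : R := expR (lgr x) ^+ n * (n%:R * x ord0 i ^+ 2 / sqn x - 1).

Lemma is_derive_radw i x : A x -> is_derive x (e_ i) (radw i) (dradw i x).
Proof.
move=> Ax; have x0 := annulus_sqn_gt0 Ax.
have H := isD_opp (isD_mul (is_derive_coord x i i)
  (isD_exp n (is_derive_comp (is_derive_expR (lgr x)) (is_derive_lgr i Ax)))).
apply: (is_derive_eq H); rewrite eqxx mul1r /dradw /=.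
have -> : n%:R * expR (lgr x) ^+ n.-1 * (expR (lgr x) * - (x ord0 i / sqn x)) =
    n%:R * expR (lgr x) ^+ n * - (x ord0 i / sqn x).
  rewrite [LHS]mulrA; congr (_ * _); rewrite -mulrA; congr (_ * _) => //.
  move: i Ax {H} => i Ax; have : (0 < n)%N by exact: leq_ltn_trans (ltn_ord i).
  by move=> n0; rewrite -exprSr prednK.
by rewrite expr2; field; rewrite gt_eqF.
Qed.

Lemma continuous_expR_lgr x : A x -> {for x, continuous (fun y => expR (lgr y) ^+ n)}.
Proof.
move=> Ax; apply: (@cont_comp _ _ _ (fun s : R => s ^+ n)); last exact: exprn_continuous.
by apply: cont_comp; [exact: continuous_lgr|exact: continuous_expR].
Qed.

Lemma continuous_radw i x : A x -> {for x, continuous (radw i)}.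
Proof.
move=> Ax; apply: cont_opp; apply: cont_mul; first exact: coord_continuous.
exact: continuous_expR_lgr.
Qed.

Lemma continuous_sqn x : {for x, continuous sqn}.
Proof. exact: (smooth_continuous (@openT _) (smooth_sqn setT) I). Qed.

Lemma continuous_coord_sqn i x : A x -> {for x, continuous (fun y : 'rV[R]_n => y ord0 i / sqn y)}.
Proof.
move=> Ax; apply: cont_mul; first exact: coord_continuous.
apply: (@cont_comp _ _ _ (@GRing.inv R)); first exact: continuous_sqn.
by apply: inv_continuous; rewrite gt_eqF// annulus_sqn_gt0.
Qed.

Lemma continuous_dradw i x : A x -> {for x, continuous (dradw i)}.
Proof.
move=> Ax; apply: cont_mul; first exact: continuous_expR_lgr.
apply: cont_add; last exact: cst_continuous.
have -> : (fun y : 'rV[R]_n => n%:R * y ord0 i ^+ 2 / sqn y) =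
    (fun y => n%:R * (y ord0 i * (y ord0 i / sqn y))).
  by apply/funext => y; rewrite expr2 !mulrA.
apply: cont_mul; first exact: cst_continuous.
by apply: cont_mul; [exact: coord_continuous|exact: continuous_coord_sqn].
Qed.

Lemma expR_lgr_le x : A x -> 0 < expR (lgr x) <= expR 1.
Proof. by move=> /lgr_annulus /andP[_ t1]; rewrite expR_gt0 ler_expR ltW. Qed.

Lemma coord_sqn_le i x : A x -> `|x ord0 i / sqn x| <= expR 1.
Proof.
move=> Ax; have x0 := annulus_enorm_gt0 Ax; have /andP[_] := expR_lgr_le Ax.
apply: le_trans; rewrite expR_lgr// normrM sqnE normfV (gtr0_norm (exprn_gt0 2 x0)).
by rewrite ler_pdivrMr ?exprn_gt0// expr2 mulKf ?gt_eqF// le_coord_enorm.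
Qed.

Lemma radw_le i x : A x -> `|radw i x| <= expR 1 ^+ n.
Proof.
move=> Ax; have /andP[e0 e1] := expR_lgr_le Ax; rewrite /radw normrN normrM.
rewrite -[leRHS]mul1r; apply: ler_pM => //.
  by apply: le_trans (le_coord_enorm x i) _; have /andP[_ /ltW] := Ax.
by rewrite ger0_norm ?exprn_ge0 ?(ltW e0)// lerXn2r ?nnegrE ?expR_ge0.
Qed.

Lemma dradw_le i x : A x -> `|dradw i x| <= expR 1 ^+ n * (n%:R + 1).
Proof.
move=> Ax; have /andP[e0 e1] := expR_lgr_le Ax; have x0 := annulus_sqn_gt0 Ax.
rewrite /dradw normrM; apply: ler_pM => //.
  by rewrite ger0_norm ?exprn_ge0 ?(ltW e0)// lerXn2r ?nnegrE ?expR_ge0.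
apply: le_trans (ler_normB _ _) _; rewrite normr1 lerD2r.
rewrite -mulrA normrM ger0_norm// ler_piMr// ger0_norm; last by rewrite divr_ge0 ?sqr_ge0// ltW.
rewrite ler_pdivrMr// mul1r /sqn (bigD1 i)//= lerDl sumr_ge0// => j _; exact: sqr_ge0.
Qed.

(** The divergence of the field: the factor [n] from the exponent of |x| cancels the [n] diagonal
    derivatives of x. *)
Lemma sum_dradw x : A x -> \sum_i dradw i x = 0.
Proof.
move=> Ax; have x0 := annulus_sqn_gt0 Ax; rewrite -mulr_sumr sumrB sumr_const card_ord.
suff -> : \sum_i n%:R * x ord0 i ^+ 2 / sqn x = n%:R by rewrite subrr mulr0.
by rewrite -mulr_suml -mulr_sumr -/(sqn x) mulfK// gt_eqF.
Qed.

(* [H t z] vanishes at [z = 0] and has partial derivatives [Ht] and [Hz]; the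
   integral over the annulus of the radial derivative of [H (lgr x) (phi x)]
   then vanishes for [phi] in W^{1,p}_0. *)
Record calibration (H Ht Hz : R -> R -> R) (K : R) : Prop := Calibration {
  cal0 : forall t, 0 < t < 1 -> H t 0 = 0;
  calt0 : forall t, 0 < t < 1 -> Ht t 0 = 0;
  cal_derive : forall (V : normedModType R) (a b : V -> R) (x v : V) (a' b' : R), 0 < a x < 1 ->
    is_derive x v a a' -> is_derive x v b b' ->
    is_derive x v (fun y => H (a y) (b y)) (Ht (a x) (b x) * a' + Hz (a x) (b x) * b');
  cal_continuous : forall (a b : 'rV[R]_n -> R) x, 0 < a x < 1 ->
    {for x, continuous a} -> {for x, continuous b} ->
    [/\ {for x, continuous (fun y => H (a y) (b y))}, {for x, continuous (fun y => Ht (a y) (b y))} &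
        {for x, continuous (fun y => Hz (a y) (b y))}];
  cal_measurable : forall f : 'rV[R]_n -> R, measurable_fun A f ->
    [/\ measurable_fun A (fun x => H (lgr x) (f x)), measurable_fun A (fun x => Ht (lgr x) (f x)) &
        measurable_fun A (fun x => Hz (lgr x) (f x))];
  cal_lip : forall t y z, 0 < t < 1 ->
    [/\ `|H t y - H t z| <= K * `|y - z|, `|Ht t y - Ht t z| <= K * `|y - z| &
        `|Hz t y - Hz t z| <= K * `|y - z|];
  cal_bound : forall t z, 0 < t < 1 -> `|Hz t z| <= K }.

(** Apply the chain rule to [radw i x * H (lgr x) (phi x)] for each [i] and add up: the terms with
    [H] itself cancel since the field is divergence free, and the rest is the weighted derivative of
    [H (lgr x) (phi x)] in the variable t. *)
Lemma calibration_integral0 H Ht Hz K phi : (2 <= n)%N -> calibration H Ht Hz K ->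
  W1p0 A n%:R phi ->
  let D x := expR (lgr x) ^+ n *
    (Ht (lgr x) (phi x) + Hz (lgr x) (phi x) * - dotp x (gradient A phi x)) in
  mu.-integrable A (EFin \o D) /\ \int[mu]_(x in A) D x = 0.
Proof.
move=> n2 cal W D; have mA := open_measurable_rV open_annulus.
(* [P i] and [Pz i] are the two parts of the product rule for [radw i] times [H]: explicit
   dependence on [x], and dependence through [z]. *)
pose P i x z := dradw i x * H (lgr x) z + radw i x * - (x ord0 i / sqn x) * Ht (lgr x) z.
pose Pz i x z := radw i x * Hz (lgr x) z.
pose K' := expR 1 ^+ n * (n%:R + 1 + expR 1) * K.
have K0 : 0 <= K.
  by apply: le_trans (cal_bound cal (t := 2^-1) 0 _) => //; rewrite invr_gt0 invf_lt1 ?ltr1n// ltr0n.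
have KK' : expR 1 ^+ n * K <= K'.
  by rewrite /K' ler_wpM2r// ler_peMr ?exprn_ge0 ?expR_ge0// -addrA addrCA lerDl addr_ge0// expR_ge0.
have mcont (f : 'rV[R]_n -> R) : (forall x, A x -> {for x, continuous f}) -> measurable_fun A f.
  exact: (continuous_measurable_rV open_annulus).
have mdw i : measurable_fun A (dradw i) by apply: mcont; exact: continuous_dradw.
have mw i : measurable_fun A (radw i) by apply: mcont; exact: continuous_radw.
have mc i : measurable_fun A (fun x => - (x ord0 i / sqn x)).
  by apply: mcont => x Ax; apply: cont_opp; exact: continuous_coord_sqn.
have main i : mu.-integrable A (EFin \o
    (fun x => P i x (phi x) + Pz i x (phi x) * gradient A phi x ord0 i)) /\
  \int[mu]_(x in A) (P i x (phi x) + Pz i x (phi x) * gradient A phi x ord0 i) = 0.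
  apply: (@W1p0_chain_rule R n A n phi i (P i) (Pz i) K') => //.
  - exact: open_annulus.
  - exact: annulus_lty.
  - move=> f mf; have [m1 m2 m3] := cal_measurable cal mf.
    exact: (measurable_funD (measurable_funM (mdw i) m1) (measurable_funM (measurable_funM (mw i) (mc i)) m2)).
  - move=> f mf; have [m1 m2 m3] := cal_measurable cal mf.
    exact: measurable_funM (mw i) m3.
  - move=> x Ax; have t01 := lgr_annulus Ax.
    rewrite /P (cal0 cal)// (calt0 cal)// !mulr0 addr0 normr0.
    by rewrite /K' !mulr_ge0 ?exprn_ge0 ?addr_ge0 ?expR_ge0.
  - move=> x z Ax; have t01 := lgr_annulus Ax; apply: le_trans KK'.
    by rewrite /Pz normrM; apply: ler_pM => //; [exact: radw_le|exact: (cal_bound cal)].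
  - move=> x y z Ax; have [l1 l2 l3] := cal_lip cal y z (lgr_annulus Ax).
    have -> : P i x y - P i x z = dradw i x * (H (lgr x) y - H (lgr x) z) +
      radw i x * - (x ord0 i / sqn x) * (Ht (lgr x) y - Ht (lgr x) z) by rewrite /P; ring.
    apply: le_trans (ler_normD _ _) _.
    rewrite (normrM (dradw i x)) (normrM (radw i x * _)) (normrM (radw i x)).
    rewrite (_ : K' * _ = expR 1 ^+ n * (n%:R + 1) * (K * `|y - z|) +
      expR 1 ^+ n * expR 1 * (K * `|y - z|)); last by rewrite /K'; ring.
    apply: lerD; (apply: ler_pM; rewrite ?mulr_ge0//); first exact: dradw_le.
    apply: ler_pM => //; first exact: radw_le.
    by rewrite normrN; exact: coord_sqn_le.
  - move=> x y z Ax; have [l1 l2 l3] := cal_lip cal y z (lgr_annulus Ax).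
    rewrite /Pz -mulrBr normrM; apply: (@le_trans _ _ (expR 1 ^+ n * (K * `|y - z|))).
      by apply: ler_pM => //; exact: radw_le.
    by rewrite mulrA ler_wpM2r.
  - move=> psi tpsi; have [cpsi cdpsi dpsi] := test_function_smooth tpsi.
    have [C [cC CO psi0 dpsi0]] := test_function_support open_annulus tpsi.
    (* [H t 0 = 0] is known for t in (0, 1) only, so the product is cut off outside the annulus. *)
    have [] := @ibp_open R n A C ((fun x => radw i x * H (lgr x) (psi x)) \_ A)
      (fun x => P i x (psi x) + Pz i x (psi x) * partial i psi x) i open_annulus cC CO.
    + move=> x Cx; rewrite patchE; case: ifP => // /set_mem Ax.
      by rewrite psi0// (cal0 cal) ?mulr0//; exact: lgr_annulus.
    + move=> x Ax; have Hd := cal_derive cal (lgr_annulus Ax) (is_derive_lgr i Ax) (dpsi i x).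
      have Hd2 := isD_mul (is_derive_radw i Ax) Hd.
      apply: (@near_eq_is_derive R _ R (fun x => radw i x * H (lgr x) (psi x))).
        by apply: filterS (open_nbhs_nbhs (conj open_annulus Ax)) => y Ay; rewrite patchE mem_set.
      by apply: (is_derive_eq Hd2); rewrite /P /Pz; ring.
    + move=> x Ax; have [c1 c2 c3] := cal_continuous cal (lgr_annulus Ax) (continuous_lgr Ax) (cpsi x).
      apply: cont_add.
        apply: cont_add; apply: cont_mul => //; first exact: continuous_dradw.
        apply: cont_mul; first exact: continuous_radw.
        by apply: cont_opp; exact: continuous_coord_sqn.
      apply: cont_mul; last exact: cdpsi.
      by apply: cont_mul => //; exact: continuous_radw.
    by move=> _ _; rewrite /Rintegral => ->.
have DE x : A x -> D x = \sum_i (P i x (phi x) + Pz i x (phi x) * gradient A phi x ord0 i).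
  move=> Ax; have x0 := annulus_sqn_gt0 Ax.
  rewrite /D /P /Pz big_split big_split /= -mulr_suml sum_dradw// mul0r add0r mulrDr; congr (_ + _).
    rewrite -mulr_suml; congr (_ * _).
    rewrite (eq_bigr (fun i => expR (lgr x) ^+ n * (x ord0 i ^+ 2 / sqn x))); last first.
      by move=> i _; rewrite /radw; ring.
    by rewrite -mulr_sumr -mulr_suml -/(sqn x) mulfV ?mulr1// gt_eqF.
  rewrite /dotp mulrN mulrN mulrA mulr_sumr -sumrN; apply: eq_bigr => i _.
  by rewrite /radw; ring.
have sumI (r : seq 'I_n) : mu.-integrable A (EFin \o (fun x => \sum_(i <- r)
    (P i x (phi x) + Pz i x (phi x) * gradient A phi x ord0 i))) /\
  \int[mu]_(x in A) (\sum_(i <- r) (P i x (phi x) + Pz i x (phi x) * gradient A phi x ord0 i)) = 0.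
  elim: r => [|i r [iI II]].
    under [X in EFin \o X]eq_fun do rewrite big_nil.
    under [X in Rintegral _ _ X]eq_fun do rewrite big_nil.
    by split; [exact: integrable_cst_fin annulus_lty|rewrite /Rintegral integral0].
  under [X in EFin \o X]eq_fun do rewrite big_cons.
  under [X in Rintegral _ _ X]eq_fun do rewrite big_cons.
  have [mi mI] := main i; split; first exact: integrable_addR.
  by rewrite RintegralD// mI II addr0.
have [sI SI] := sumI (index_enum 'I_n); split.
  by apply: eq_integrable sI => // x /set_mem Ax; rewrite /= DE.
by rewrite -[RHS]SI; apply: eq_Rintegral => x /set_mem Ax; exact: DE.
Qed.

(** The factor [- (x ord0 i / sqn x)] is the i-th partial derivative of [lgr]. *)
Definition radial_gradient (f' : R -> R) x : 'rV[R]_n := \row_i (f' (lgr x) * - (x ord0 i / sqn x)).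

Lemma integral_powR_nat (S : set 'rV[R]_n) (G : 'rV[R]_n -> 'rV[R]_n) (k : nat) :
  (\int[mu]_(x in S) (enorm (G x) `^ k%:R)%:E = \int[mu]_(x in S) (enorm (G x) ^+ k)%:E)%E.
Proof. by apply: eq_integral => x _; rewrite powR_mulrn// enorm_ge0. Qed.

Section radial_function.
Context (f f' : R -> R) (M : R).
Context (df : forall t : R, 0 < t < 1 -> is_derive t 1 f (f' t)).
Context (cf' : forall t : R, 0 < t < 1 -> {for t, continuous f'}).
Context (f'M : forall t : R, 0 < t < 1 -> `|f' t| <= M).

Lemma continuous_radial x : A x -> {for x, continuous (f \o lgr)}.
Proof.
move=> Ax; apply: cont_comp; first exact: continuous_lgr.
exact: is_derive_continuous1 (df (lgr_annulus Ax)).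
Qed.

Lemma continuous_radial_gradient i x : A x ->
  {for x, continuous (fun y => f' (lgr y) * - (y ord0 i / sqn y))}.
Proof.
move=> Ax; apply: cont_mul; last by apply: cont_opp; exact: continuous_coord_sqn.
by apply: cont_comp; [exact: continuous_lgr|exact: cf' (lgr_annulus Ax)].
Qed.

Lemma radial_weak_gradient : is_weak_gradient A (f \o lgr) (radial_gradient f').
Proof.
apply: C1_is_weak_gradient => [|x Ax|i x Ax|i x Ax].
- exact: open_annulus.
- exact: continuous_radial.
- exact: (is_derive_comp (df (lgr_annulus Ax)) (is_derive_lgr i Ax)).
- exact: continuous_radial_gradient.
Qed.

Lemma dotp_radial_gradient x : A x -> - dotp x (radial_gradient f' x) = f' (lgr x).
Proof.
move=> Ax; have x0 := annulus_sqn_gt0 Ax; rewrite /dotp -sumrN.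
rewrite (eq_bigr (fun i => f' (lgr x) * (x ord0 i ^+ 2 / sqn x))); last first.
  by move=> i _; rewrite mxE; ring.
by rewrite -mulr_sumr -mulr_suml -/(sqn x) mulfV ?mulr1// gt_eqF.
Qed.

Lemma enorm_radial_gradient x : A x -> enorm (radial_gradient f' x) = `|f' (lgr x)| * expR (lgr x).
Proof.
move=> Ax; have x0 := annulus_sqn_gt0 Ax; rewrite /enorm.
rewrite (eq_bigr (fun i => (f' (lgr x) / sqn x) ^+ 2 * x ord0 i ^+ 2)); last first.
  by move=> i _; rewrite mxE; ring.
rewrite -mulr_sumr -/(sqn x) (_ : _ * sqn x = (f' (lgr x) * expR (lgr x)) ^+ 2).
  by rewrite sqrtr_sqr normrM (gtr0_norm (expR_gt0 _)).
have e0 := annulus_enorm_gt0 Ax.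
by rewrite expR_lgr// sqnE; field; rewrite gt_eqF.
Qed.

Lemma W1p_loc_radial : (2 <= n)%N -> W1p_loc A n%:R (f \o lgr).
Proof.
move=> n2; have n0 : (0 < n)%N by exact: ltn_trans n2.
have wg := radial_weak_gradient; split.
- exact: (continuous_Lp_loc n0 open_annulus continuous_radial).
- by exists (radial_gradient f').
move=> i K cK KA; have mK := compact_measurable_rV cK.
have gg := gradientP (ex_intro _ _ wg).
have mg : measurable_fun K (fun x => gradient A (f \o lgr) x ord0 i).
  apply: measurable_funS KA _; first exact: open_measurable_rV open_annulus.
  by have [_ + _] := gg => /(_ i); exact: (Lp_loc_measurable open_annulus).
have Lc := continuous_Lp_loc n0 open_annulus (fun x Ax => @continuous_radial_gradient i x Ax) cK KA.
apply/(LpP _ n0 mK); split => //.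
have [mc ic] := (LpP _ n0 mK).1 Lc.
apply: (@ae_integrable _ _ _ (fun x => `|gradient A (f \o lgr) x ord0 i| ^+ n) _ mK ic).
  by apply: measurable_funX; exact: measurableT_comp.
apply: filterS (gradient_ae open_annulus wg) => x gx /KA Ax.
by rewrite gx// mxE ger0_norm// exprn_ge0.
Qed.

(** Multiply the pointwise inequality by |x|^-n and integrate: the left side integrates to 0, and by
    Cauchy-Schwarz the full gradient of [u + phi] dominates its radial part, while for [u] the two
    coincide. *)
Lemma radial_quasisuperminimizer H Ht Hz (K Q : R) : (2 <= n)%N -> 0 < Q ->
  calibration H Ht Hz K ->
  (forall t z s, 0 < t < 1 -> 0 <= z ->
    Ht t z + Hz t z * s <= Q * `|f' t + s| ^+ n - `|f' t| ^+ n) ->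
  quasisuperminimizer A n%:R Q (f \o lgr).
Proof.
move=> n2 Q0 cal ineq; have n0 : (0 < n)%N by exact: ltn_trans n2.
split; first exact: W1p_loc_radial.
move=> phi W phi0; have mA := open_measurable_rV open_annulus.
have [[Lphi wphi Lg] _] := W.
have [mphi _] := (LpP _ n0 mA).1 Lphi.
set S := A `&` _.
have mS : measurable S.
  rewrite /S (_ : [set x | phi x != 0] = phi @^-1` (~` [set 0])).
    by apply: mphi => //; apply: measurableC; exact: measurable_set1.
  by apply/seteqP; split => x /= /eqP.
have SA : S `<=` A by exact: subIsetl.
have gu := gradient_ae open_annulus radial_weak_gradient.
have guphi := is_weak_gradientD open_annulus radial_weak_gradient (gradientP wphi).
have gv := gradient_ae open_annulus guphi.
have mgrad v : weakly_differentiable A v -> measurable_fun A (@enorm R n \o gradient A v).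
  move=> /gradientP[_ Lv _]; apply: measurable_enorm => i.
  exact: (Lp_loc_measurable open_annulus).
have := mgrad _ (ex_intro _ _ guphi); have := mgrad _ (ex_intro _ _ radial_weak_gradient).
move: gu gv; generalize (gradient A (f \o lgr)) (gradient A (f \o lgr \+ phi)) => Gu Gv gu gv mu1 mv.
rewrite !integral_powR_nat.
have mvn : measurable_fun S (fun x => enorm (Gv x) ^+ n).
  by apply: measurable_funX; exact: measurable_funS mA SA mv.
have mun : measurable_fun S (fun x => enorm (Gu x) ^+ n).
  by apply: measurable_funX; exact: measurable_funS mA SA mu1.
set V := (\int[mu]_(x in S) (enorm (Gv x) ^+ n)%:E)%E.
(* An infinite right-hand side makes the inequality trivial; otherwise everything is integrable. *)
have [Vy|] := ltP V +oo%E; last first.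
  by rewrite leye_eq => /eqP ->; rewrite gt0_muley ?lte_fin// leey.
have iv : mu.-integrable S (EFin \o (fun x => enorm (Gv x) ^+ n)).
  by apply: integrable_ge0 => // x _; rewrite exprn_ge0// enorm_ge0.
have iu : mu.-integrable S (EFin \o (fun x => enorm (Gu x) ^+ n)).
  apply: (@ae_integrable R n S _ (fun x => (`|M| * expR 1) ^+ n)) => //.
    by apply: integrable_cst_fin => //; apply: le_lt_trans annulus_lty; apply: le_measure; rewrite ?inE.
  apply: filterS gu => x gx /SA Ax; rewrite gx// enorm_radial_gradient//.
  rewrite ger0_norm ?exprn_ge0 ?mulr_ge0 ?expR_ge0//.
  have /andP[_ e1] := expR_lgr_le Ax.
  rewrite lerXn2r ?nnegrE ?mulr_ge0 ?expR_ge0//; apply: ler_pM; rewrite ?expR_ge0//.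
  by apply: le_trans (f'M (lgr_annulus Ax)) (ler_norm _).
have [iD ID] := calibration_integral0 n2 cal W.
set D := fun x => _ in iD ID.
have iDS : mu.-integrable S (EFin \o D) by exact: integrableS mA mS SA iD.
(* On the zero set of [phi] both [Ht] and, almost everywhere, the gradient vanish, so restricting
   the calibration integral to [S] changes nothing. *)
have ID0 : \int[mu]_(x in S) D x = 0.
  rewrite -[RHS]ID (Rintegral_mkcond _ S) (Rintegral_mkcond _ A).
  apply: ae_eq_Rintegral => //.
  - by apply/(measurable_restrictT _ mS)/measurable_EFinP; exact: measurable_int iDS.
  - by apply/(measurable_restrictT _ mA)/measurable_EFinP; exact: measurable_int iD.
  - apply: filterS (gradient_zero_set n2 open_annulus annulus_lty W) => x gx0 _.
    rewrite !patchE; have [xA|xA] := boolP (x \in A); last first.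
      by rewrite memNset// => /SA Ax; rewrite mem_set in xA.
    have Ax := set_mem xA; case: ifPn => // xS.
    have p0 : phi x = 0.
      by apply/eqP; apply: contraNT xS => px; rewrite inE.
    rewrite /D p0 (calt0 cal (lgr_annulus Ax)) gx0//.
    by rewrite /dotp big1 ?oppr0 ?mulr0 ?addr0 ?mulr0// => i _; rewrite mxE mulr0.
rewrite /V (EFin_Rintegral mS iu) (EFin_Rintegral mS iv) -EFinM lee_fin.
rewrite -[leLHS]addr0 -ID0 -RintegralD// -RintegralZl//.
apply: ae_le_Rintegral => //; [exact: integrable_addR|exact: integrable_scaleR|].
apply: filterS3 phi0 gu gv => x p0 gux gvx Sx; have Ax := SA x Sx.
rewrite gux// gvx// enorm_radial_gradient//.
set w := radial_gradient f' x + gradient A phi x.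
pose s := - dotp x (gradient A phi x).
have t01 := lgr_annulus Ax; have e0 := annulus_enorm_gt0 Ax.
(* In the variable t, the derivative of a function is minus the scalar product of x with its
   gradient. *)
have ws : - dotp x w = f' (lgr x) + s.
  rewrite -(dotp_radial_gradient Ax) /s -opprD /dotp -big_split; congr (- _).
  by apply: eq_bigr => i _; rewrite /= !mxE mulrDr.
have le1 : expR (lgr x) * `|f' (lgr x) + s| <= enorm w.
  by rewrite -ws normrN expR_lgr// mulrC ler_pdivrMr// mulrC dotp_le.
have le2 : expR (lgr x) ^+ n * `|f' (lgr x) + s| ^+ n <= enorm w ^+ n.
  by rewrite -exprMn lerXn2r ?nnegrE ?mulr_ge0 ?expR_ge0 ?enorm_ge0.
apply: le_trans (ler_wpM2l (ltW Q0) le2).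
rewrite /D -/s exprMn mulrC -mulrDr [leRHS]mulrCA ler_wpM2l ?exprn_ge0 ?expR_ge0//.
by have := ineq _ (phi x) s t01 (p0 Ax); rewrite lerBrDl.
Qed.

End radial_function.

End radial.

(** * One-dimensional profiles *)

Section one_dim.
Context (R : realType).
Implicit Types (w c : R).

(** Induction on the exponent: multiplying the inequality for [k] by [w] exceeds the one for [k + 1]
    by [k c^(k-1) (w - c)^2]. *)
Lemma tangent_le (k : nat) w c : (0 < k)%N -> 0 <= w -> 0 <= c ->
  k%:R * c ^+ k.-1 * w - k.-1%:R * c ^+ k <= w ^+ k.
Proof.
case: k => // k _ w0 c0 /=; elim: k => [|k IHk].
  by rewrite !expr1 expr0 mulr1 mul1r mul0r subr0.
have := ler_wpM2l w0 IHk; rewrite -exprS; apply: le_trans.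
rewrite -subr_ge0.
have -> : w * (k.+1%:R * c ^+ k * w - k%:R * c ^+ k.+1) -
    (k.+2%:R * c ^+ k.+1 * w - k.+1%:R * c ^+ k.+2) = k.+1%:R * c ^+ k * (w - c) ^+ 2.
  by rewrite !exprS -[k.+2%:R]natr1 -[k.+1%:R]natr1; ring.
by rewrite mulr_ge0 ?sqr_ge0// mulr_ge0// exprn_ge0.
Qed.

Lemma tangent_le_norm (k : nat) w c : (0 < k)%N -> 0 <= c ->
  k%:R * c ^+ k.-1 * w - k.-1%:R * c ^+ k <= `|w| ^+ k.
Proof.
move=> k0 c0; apply: le_trans (tangent_le k0 (normr_ge0 w) c0).
by rewrite lerD2r ler_wpM2l ?ler_norm// mulr_ge0// exprn_ge0.
Qed.

Lemma tangent_lt (k : nat) w c : (2 <= k)%N -> 0 <= w -> 0 < c -> w != c ->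
  k%:R * c ^+ k.-1 * w - k.-1%:R * c ^+ k < w ^+ k.
Proof.
case: k => [|[|k]]// _ w0 c0 wc.
have := ler_wpM2l w0 (@tangent_le k.+1 w c isT w0 (ltW c0)).
rewrite -exprS; apply: lt_le_trans; rewrite -subr_gt0.
have -> : w * (k.+1%:R * c ^+ k.+1.-1 * w - k.+1.-1%:R * c ^+ k.+1) -
    (k.+2%:R * c ^+ k.+2.-1 * w - k.+2.-1%:R * c ^+ k.+2) = k.+1%:R * c ^+ k * (w - c) ^+ 2.
  by rewrite !succnK !exprS -[k.+2%:R]natr1 -[k.+1%:R]natr1; ring.
have s0 : 0 < (w - c) ^+ 2 by rewrite exprn_even_gt0//= subr_eq0.
by rewrite mulr_gt0// mulr_gt0// exprn_gt0.
Qed.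

(* The tangent line of [Q * w ^+ k] at [w = 1]. *)
Definition tline (k : nat) (Q w : R) := Q * (k%:R * w - k.-1%:R).

(** The difference [h] of the power and the line is positive at 0, negative at 1 because [Q > 1],
    and positive again far out; the intermediate value theorem gives one crossing on each side of
    1. *)
Lemma tline_crossings (k : nat) (Q : R) : (2 <= k)%N -> 1 < Q ->
  exists a b : R, [/\ 0 < a < 1, 1 < b, tline k Q a = a ^+ k & tline k Q b = b ^+ k].
Proof.
move=> k2 Q1; have k0 : (0 < k)%N by exact: ltn_trans k2.
have Q0 : 0 < Q by exact: lt_trans Q1.
pose h w : R := w ^+ k - tline k Q w.
have ch : continuous h.
  move=> w; suff : {for w, continuous h} by [].
  rewrite /h /tline; apply: cont_add; first exact: exprn_continuous.
  apply: cont_opp; apply: cont_mul; first exact: cst_continuous.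
  apply: cont_add; last exact: cst_continuous.
  exact: mulrl_continuous.
have kk : k%:R = k.-1%:R + 1 :> R by rewrite natr1 prednK.
have k1 : 1 <= k.-1%:R :> R by rewrite ler1n; case: (k) k2.
have h0 : 0 < h 0.
  by rewrite /h /tline expr0n gtn_eqF// mulr0 !sub0r mulrN opprK mulr_gt0// (lt_le_trans ltr01).
have h1 : h 1 < 0 by rewrite /h /tline expr1n mulr1 kk addrAC subrr add0r mulr1 subr_lt0.
(* At [W] the line stays below [W ^+ 2], which is at most [W ^+ k]. *)
pose W := Q * k%:R; have kQ1 : 1 < W.
  by rewrite /W kk mulrDr mulr1 ltr_wpDl// mulr_ge0// ltW.
have hW : 0 < h W.
  rewrite /h /tline subr_gt0 mulrBr mulrA -/W; apply: (@lt_le_trans _ _ (W ^+ 2)).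
    by rewrite expr2 gtrBl mulr_gt0// (lt_le_trans ltr01).
  by rewrite ler_eXn2l.
have [|a a01 ha] := @IVT _ h 0 1 0 ler01 (continuous_subspaceT ch).
  by rewrite ge_min le_max (ltW h0) (ltW h1) ?orbT.
have [|b b1W hb] := @IVT _ h 1 W 0 (ltW kQ1) (continuous_subspaceT ch).
  by rewrite ge_min le_max (ltW hW) (ltW h1) ?orbT.
have nz w v : h w = 0 -> h v != 0 -> w != v by move=> hw; apply: contraNneq => <-; rewrite hw.
move: a01 b1W; rewrite !in_itv/= => /andP[a0 a1] /andP[b1 bW].
have eqL w : h w = 0 -> tline k Q w = w ^+ k by move=> /eqP; rewrite subr_eq0 => /eqP.
have h0n : h 0 != 0 by rewrite gt_eqF.
have h1n : h 1 != 0 by rewrite lt_eqF.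
exists a, b; split; [| |exact: eqL|exact: eqL].
  by rewrite lt0r (nz a 0 ha h0n) a0 lt_neqAle (nz a 1 ha h1n) a1.
by rewrite lt_neqAle b1 eq_sym (nz b 1 hb h1n).
Qed.

(** The line is the chord of [w ^+ k] between its two crossings, and a convex function lies below
    its chord; convexity is used through the tangent at [w] evaluated at [a] and [b]. *)
Lemma tline_chord (k : nat) (Q a b w : R) : (0 < k)%N -> 0 <= a -> a <= w <= b ->
  tline k Q a = a ^+ k -> tline k Q b = b ^+ k -> w ^+ k <= tline k Q w.
Proof.
move=> k0 a0 /andP[aw wb] La Lb; have w0 := le_trans a0 aw.
have [ab|] := ltP a b; last first.
  move=> ba; have wa : w = a by apply/eqP; rewrite eq_le aw andbT; exact: le_trans wb ba.
  by rewrite wa La.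
have Ta := tangent_le k0 a0 w0; have Tb := tangent_le k0 (le_trans w0 wb) w0.
have kk : k%:R * w ^+ k.-1 * w = k%:R * w ^+ k by rewrite -mulrA -exprSr prednK.
have k1 : k%:R = k.-1%:R + 1 :> R by rewrite natr1 prednK.
rewrite -(ler_pM2l (_ : 0 < b - a)) ?subr_gt0//.
apply: (@le_trans _ _ ((b - w) * a ^+ k + (w - a) * b ^+ k)).
  have H1 := ler_wpM2l (_ : 0 <= b - w) Ta; have H2 := ler_wpM2l (_ : 0 <= w - a) Tb.
  apply: le_trans (lerD (H1 _) (H2 _)); rewrite ?subr_ge0//.
  rewrite le_eqVlt; apply/orP; left; apply/eqP.
  transitivity ((b - a) * (k%:R * w ^+ k.-1 * w - k.-1%:R * w ^+ k)); last by ring.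
  by rewrite kk k1; ring.
by rewrite -La -Lb /tline le_eqVlt; apply/orP; left; apply/eqP; ring.
Qed.

(* [sramp h] is a smooth approximation of the positive part. *)
Definition sramp (h s : R) : R := s * flat 1 (s / h).

Definition dsramp (h s : R) : R := flat 1 (s / h) + s * (flat ('X^2 * (1 - 1^`())) (s / h) / h).

Lemma is_derive_sramp (h s : R) : is_derive s 1 (sramp h) (dsramp h s).
Proof.
have d1 : is_derive s 1 (fun s : R => s / h) h^-1.
  apply: (is_derive_eq (isD_mul (is_derive_id s 1) (isD_cst h^-1 s 1))).
  by rewrite mul1r mulr0 addr0.
have d2 := isD_mul (is_derive_id s 1) (@is_derive_comp R _ (flat 1) (fun s : R => s / h) s 1 _ _ (is_derive_flat 1 (s / h)) d1).
by apply: (is_derive_eq d2); rewrite mul1r.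
Qed.

Lemma continuous_dsramp h : continuous (dsramp h).
Proof.
move=> s; suff : {for s, continuous (dsramp h)} by [].
have cdiv : {for s, continuous (fun s : R => s / h)} by exact: mulrr_continuous.
have cflat (P : {poly R}) : {for s, continuous (fun s : R => flat P (s / h))}.
  by apply: cont_comp => //; exact: is_derive_continuous1 (is_derive_flat _ _).
apply: cont_add; first exact: cflat.
apply: cont_mul; first exact: (fun B => @cvg_id _ _ B).
by apply: cont_mul; [exact: cflat|exact: cst_continuous].
Qed.

Lemma sramp_le0 (h s : R) : 0 < h -> s <= 0 -> sramp h s = 0 /\ dsramp h s = 0.
Proof.
move=> h0 s0; have F P : flat P (s / h) = 0.
  by rewrite /flat ltNge (_ : s / h <= 0) // pmulr_lle0// invr_gt0.
by rewrite /sramp /dsramp !F mul0r !mulr0 addr0.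
Qed.

Lemma sramp_gt0E (h s : R) : 0 < h -> 0 < s -> sramp h s = s * expR (- (h / s)).
Proof.
by move=> h0 s0; rewrite /sramp /flat divr_gt0// hornerC mul1r (_ : (s / h)^-1 = h / s)// invfM invrK mulrC.
Qed.

Lemma dsramp_gt0E (h s : R) : 0 < h -> 0 < s ->
  dsramp h s = (1 + h / s) * expR (- (h / s)).
Proof.
move=> h0 s0; rewrite /dsramp /flat divr_gt0// hornerC mul1r.
have -> : (s / h)^-1 = h / s by rewrite invfM invrK mulrC.
rewrite derivC subr0 mulr1 hornerXn; field.
by rewrite !gt_eqF.
Qed.

(** With y = h / s this is (1 + y) exp(-y) <= 1. The exact bound 1 is what keeps the slopes of the
    smoothed profiles between [al] and [be]. *)
Lemma dsramp_bound (h s : R) : 0 < h -> 0 <= dsramp h s <= 1.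
Proof.
move=> h0; have [s0|s0] := leP s 0.
  by have [_ ->] := sramp_le0 h0 s0; rewrite lexx ler01.
have y0 : 0 < h / s by rewrite divr_gt0.
rewrite dsramp_gt0E// mulr_ge0 ?expR_ge0//=; last by rewrite addr_ge0// ltW.
by rewrite expRN ler_pdivrMr ?expR_gt0// mul1r expR_ge1Dx.
Qed.

Lemma sramp_bound (h s : R) : 0 < h -> 0 <= sramp h s <= Num.max s 0.
Proof.
move=> h0; have [s0|s0] := leP s 0; first by have [-> _] := sramp_le0 h0 s0; rewrite lexx.
rewrite sramp_gt0E// mulr_ge0 ?expR_ge0 ?(ltW s0)//= ler_piMr ?(ltW s0)//.
by rewrite -[leRHS]expR0 ler_expR oppr_le0 divr_ge0// ltW.
Qed.

Lemma sramp_gt0 (h s : R) : 0 < h -> 0 < s -> 0 < sramp h s.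
Proof. by move=> h0 s0; rewrite sramp_gt0E// mulr_gt0// expR_gt0. Qed.

Lemma smooth_sramp n (U : set 'rV[R]_n) u (h : R) : smooth_on U u ->
  smooth_on U (fun x => sramp h (u x)).
Proof.
move=> su; apply: smooth_mul => //.
apply: (smooth_comp (@openT _) (@smooth1_flat R 1)) => //.
by apply: smooth_mul => //; exact: smooth_cst.
Qed.

Lemma cvg_dsramp (h s : nat -> R) (l : R) : (forall k, 0 < h k) -> h @ \oo --> 0 -> 0 < l ->
  s @ \oo --> l -> (fun k => dsramp (h k) (s k)) @ \oo --> (1 : R).
Proof.
move=> h0 hl l0 sl.
have y : (fun k => h k / s k) @ \oo --> (0 : R).
  by rewrite -(mul0r l^-1); apply: cvgM => //; apply: cvgV => //; rewrite gt_eqF.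
have -> : (1 : R) = (1 + 0) * expR (- 0) by rewrite oppr0 expR0 mulr1 addr0.
apply: (@cvg_trans _ ((fun k => (1 + h k / s k) * expR (- (h k / s k))) @ \oo)).
  apply: near_eq_cvg; near=> k; rewrite dsramp_gt0E//.
  by near: k; exact: (cvgr_gt l sl).
apply: cvgM; first by apply: cvgD => //; exact: cvg_cst.
by apply: continuous_cvg; [exact: continuous_expR|exact: cvgN].
Unshelve. all: by end_near. Qed.

Lemma cvg_sramp (h : nat -> R) (s : R) : (forall k, 0 < h k) -> h @ \oo --> 0 ->
  (fun k => sramp (h k) s) @ \oo --> Num.max s 0.
Proof.
move=> h0 hl; have [s0|s0] := leP s 0.
  rewrite (_ : (fun k => _) = cst 0); first exact: cvg_cst.
  by apply/funext => k; have [-> _] := sramp_le0 (h0 k) s0.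
rewrite (_ : (fun k => _) = (fun k => s * expR (- (h k / s)))); last first.
  by apply/funext => k; rewrite sramp_gt0E.
rewrite -[X in _ --> X]mulr1 -expR0 -oppr0 -(mul0r s^-1).
apply: cvgM; first exact: cvg_cst.
apply: continuous_cvg; first exact: continuous_expR.
by apply: cvgN; apply: cvgM => //; exact: cvg_cst.
Qed.

(** * Powers with linear growth *)

Definition tangent (k : nat) (c w : R) := k%:R * c ^+ k.-1 * w - k.-1%:R * c ^+ k.

Definition clamp (M y : R) := Num.max 0 (Num.min y M).

(* Equal to [y ^+ k] on [0, M], to [0] on the left and affine on the right, so that
   the power calibration built from it is globally Lipschitz. *)
Definition tpow (k : nat) (M y : R) := tangent k (clamp M y) y.

Lemma clamp_ge0 M y : 0 <= clamp M y.
Proof. by rewrite /clamp le_max lexx. Qed.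

Lemma clamp_le M y : 0 <= M -> clamp M y <= M.
Proof. by move=> M0; rewrite /clamp ge_max M0 ge_min lexx orbT. Qed.

Lemma clamp_id M y : 0 <= y <= M -> clamp M y = y.
Proof. by move=> /andP[y0 yM]; rewrite /clamp min_l// max_r. Qed.

Lemma clamp_homo M (x y : R) : x <= y -> clamp M x <= clamp M y.
Proof.
move=> xy; rewrite /clamp ge_max le_max lexx /= le_max; apply/orP; right.
by rewrite le_min ge_min xy /= ge_min lexx orbT.
Qed.

Lemma clamp_lip M (x y : R) : 0 <= M -> `|clamp M x - clamp M y| <= `|x - y|.
Proof.
move=> M0; wlog xy : x y / x <= y.
  move=> H; have /orP[|yx] := le_total x y; first exact: H.
  by rewrite distrC (distrC x); exact: H.
have cxy := clamp_homo M xy.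
rewrite [leLHS]distrC [leRHS]distrC !ger0_norm ?subr_ge0// {cxy}.
rewrite /clamp; case: (leP x M) => xM; case: (leP y M) => yM;
  case: (leP 0 x) => x0; case: (leP 0 y) => y0; rewrite ?(ltW x0) ?max_r ?max_l ?M0 //; try lra.
all: case: (leP 0 M) => M1; lra.
Qed.

Lemma continuous_clamp M : continuous (clamp M).
Proof.
move=> y; suff : {for y, continuous (clamp M)} by [].
apply: continuous_max; first exact: cst_continuous.
by apply: continuous_min; [exact: (fun B => @cvg_id _ _ B)|exact: cst_continuous].
Qed.

Lemma expr_lip (k : nat) (M x y : R) : 0 <= x <= M -> 0 <= y <= M ->
  `|x ^+ k - y ^+ k| <= k%:R * M ^+ k.-1 * `|x - y|.
Proof.
move=> /andP[x0 xM] /andP[y0 yM]; have M0 := le_trans x0 xM.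
case: k => [|k]; first by rewrite !expr0 subrr normr0 !mul0r.
rewrite subrXX normrM mulrC ler_wpM2r//=.
apply: le_trans (ler_norm_sum _ _ _) _; rewrite mulr_natl -[X in _ *+ X]card_ord -sumr_const.
apply: ler_sum => i _; rewrite normrM !normrX !ger0_norm//.
have -> : M ^+ k = M ^+ (k.+1.-1 - i) * M ^+ i by rewrite -exprD subnK// -ltnS.
by apply: ler_pM; rewrite ?exprn_ge0// lerXn2r.
Qed.

(** As [tpow k M] is at each point one of the tangents at points of [0, M], this makes it their
    supremum, hence convex. The three cases are the three regimes of the clamp. *)
Lemma tpow_ge_tangent (k : nat) (M c y : R) : (2 <= k)%N -> 0 <= c <= M ->
  tangent k c y <= tpow k M y.
Proof.
move=> k2 /andP[c0 cM]; have M0 := le_trans c0 cM; have k0 : (0 < k)%N by exact: ltn_trans k2.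
have self z : tangent k z z = z ^+ k.
  have k1 : k%:R = k.-1%:R + 1 :> R by rewrite natr1 prednK.
  by rewrite /tangent -mulrA -exprSr prednK// k1; ring.
rewrite /tpow; have [y0|y0] := leP y 0.
  have -> : clamp M y = 0 by rewrite /clamp min_l ?max_l// (le_trans y0).
  have -> : tangent k 0 y = 0.
    by rewrite /tangent; case: (k) k2 => [|[|j]]// _; rewrite !expr0n !mulr0 mul0r subrr.
  rewrite /tangent subr_le0; apply: (@le_trans _ _ 0).
    by rewrite mulr_ge0_le0// mulr_ge0// exprn_ge0.
  by rewrite mulr_ge0// exprn_ge0.
have [yM|yM] := leP y M.
  by rewrite clamp_id ?(ltW y0)// self; exact: tangent_le (ltW y0) c0.
have -> : clamp M y = M by rewrite /clamp min_r ?max_r// ltW.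
have E z : tangent k z y = tangent k z M + k%:R * z ^+ k.-1 * (y - M) by rewrite /tangent; ring.
rewrite (E c) (E M).
apply: lerD; first by rewrite self; exact: tangent_le.
by rewrite ler_wpM2r ?subr_ge0 ?(ltW yM)// ler_wpM2l// lerXn2r.
Qed.

(** By convexity the increment lies between the slopes at [y] and at [z] times [z - y].
    Differentiability follows from continuity of the clamp, with no case analysis at 0 and [M]. *)
Lemma tpow_approx (k : nat) (M y z : R) : (2 <= k)%N -> 0 <= M ->
  `|tpow k M z - tpow k M y - k%:R * clamp M y ^+ k.-1 * (z - y)| <=
   k%:R * `|clamp M z ^+ k.-1 - clamp M y ^+ k.-1| * `|z - y|.
Proof.
move=> k2 M0; set d := k%:R * _ * _.
have cM x : 0 <= clamp M x <= M by rewrite clamp_ge0 clamp_le.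
have H1 : 0 <= tpow k M z - tpow k M y - d.
  rewrite subr_ge0 lerBrDr (le_trans _ (tpow_ge_tangent z k2 (cM y)))//.
  by rewrite /d /tpow /tangent le_eqVlt; apply/orP; left; apply/eqP; ring.
have H2 := tpow_ge_tangent y k2 (cM z).
rewrite ger0_norm// -(ger0_norm (_ : 0 <= k%:R)) // -!normrM.
apply: le_trans (ler_norm _).
have -> : k%:R * (clamp M z ^+ k.-1 - clamp M y ^+ k.-1) * (z - y) =
  (k%:R * clamp M z ^+ k.-1 * (z - y)) - d by rewrite /d; ring.
rewrite lerD2r lerBlDl -lerBlDr (le_trans _ H2)//.
by rewrite /tpow /tangent le_eqVlt; apply/orP; left; apply/eqP; ring.
Qed.

Lemma is_derive_tpow (k : nat) (M y : R) : (2 <= k)%N -> 0 <= M ->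
  is_derive y 1 (tpow k M) (k%:R * clamp M y ^+ k.-1).
Proof.
move=> k2 M0; set d := _ * _.
suff : (fun h : R => h^-1 *: ((tpow k M \o shift y) (h *: 1) - tpow k M y)) @ 0^' --> d.
  by move=> H; split; [apply/cvg_ex; exists d|exact/cvg_lim].
have cc : {for 0, continuous (fun h => k%:R * (clamp M (h + y) ^+ k.-1 - clamp M y ^+ k.-1))}.
  apply: cont_mul; first exact: cst_continuous.
  apply: cont_add; last exact: cst_continuous.
  apply: (@cont_comp _ _ _ (fun s : R => s ^+ k.-1)); last exact: exprn_continuous.
  apply: cont_comp; last exact: continuous_clamp.
  by apply: cont_add; [exact: (fun B => @cvg_id _ _ B)|exact: cst_continuous].
apply/cvgrPdist_le => e e0.
have near_e : \forall h \near 0^', k%:R * `|clamp M (h + y) ^+ k.-1 - clamp M y ^+ k.-1| <= e.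
  apply: nbhs_dnbhs; have := cc; rewrite /prop_for /continuous_at add0r subrr mulr0.
  move=> /cvgrPdist_le/(_ e e0).
  by apply: filterS => z; rewrite sub0r normrN normrM ger0_norm.
near=> h.
have h0 : h != 0 by near: h; exact: nbhs_dnbhs_neq.
have := tpow_approx y (h + y) k2 M0; rewrite addrK -/d => H.
rewrite /= [h *: 1]mulr1 distrC.
have -> : h^-1 *: (tpow k M (h + y) - tpow k M y) - d =
    h^-1 * (tpow k M (h + y) - tpow k M y - d * h) by rewrite /GRing.scale /=; field.
rewrite normrM normfV ler_pdivrMl ?normr_gt0//.
apply: le_trans H _; rewrite mulrC ler_wpM2l//.
by near: h.
Unshelve. all: by end_near. Qed.

Lemma tpow_lip (k : nat) (M y z : R) : (2 <= k)%N -> 0 <= M ->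
  `|tpow k M y - tpow k M z| <= k%:R * M ^+ k.-1 * `|y - z|.
Proof.
move=> k2 M0; wlog zy : y z / tpow k M z <= tpow k M y.
  by move=> H; have /orP[|] := le_total (tpow k M z) (tpow k M y) => /H //; rewrite distrC (distrC z).
have cM x : 0 <= clamp M x <= M by rewrite clamp_ge0 clamp_le.
rewrite ger0_norm ?subr_ge0//.
have /andP[c0 c1] := cM y.
apply: (@le_trans _ _ (k%:R * clamp M y ^+ k.-1 * (y - z))); last first.
  apply: le_trans (ler_norm _) _; rewrite normrM ler_wpM2r//.
  by rewrite ger0_norm ?mulr_ge0 ?exprn_ge0// ler_wpM2l// lerXn2r.
rewrite lerBlDl -lerBlDr (le_trans _ (tpow_ge_tangent z k2 (cM y)))//.
by rewrite /tpow /tangent le_eqVlt; apply/orP; left; apply/eqP; ring.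
Qed.

(** * Calibration of the power profiles *)

Section power_calibration.
Context (n : nat) (Q M d M' : R) (F F' : R -> R).
Context (n2 : (2 <= n)%N) (Q0 : 0 <= Q) (M0 : 0 <= M) (d0 : 0 < d).
Context (dF : forall t : R, 0 < t < 1 -> is_derive t 1 F (F' t)).
Context (cF' : forall t : R, 0 < t < 1 -> {for t, continuous F'}).
Context (F'M : forall t : R, 0 < t < 1 -> `|F' t| <= M').

(** [slope] is the slope from the point (-d, 0) to (t, F t + z), and [P] the perspective of the
    power function. Its derivative in t is exactly the tangent at [slope], evaluated at [F' t]; its
    derivative in z is the slope of that tangent. *)
Local Notation slope t z := ((F t + z) / (t + d)).
Local Notation P t z := ((t + d) * tpow n M (slope t z)).
Local Notation Pt t z := (tangent n (clamp M (slope t z)) (F' t)).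
Local Notation Pz t z := (n%:R * clamp M (slope t z) ^+ n.-1).

Let td0 (t : R) : 0 < t < 1 -> 0 < t + d.
Proof. by move=> /andP[t0 _]; rewrite addr_gt0. Qed.

Let cM (y : R) : 0 <= clamp M y <= M.
Proof. by rewrite clamp_ge0 clamp_le. Qed.

Let is_derive_P (V : normedModType R) (a b : V -> R) (x v : V) (a' b' : R) :
  0 < a x < 1 -> is_derive x v a a' -> is_derive x v b b' ->
  is_derive x v (fun y => P (a y) (b y)) (Pt (a x) (b x) * a' + Pz (a x) (b x) * b').
Proof.
move=> ax da db; have t0 := td0 ax; have tn0 : a x + d != 0 by rewrite gt_eqF.
have dad : is_derive x v (fun y => a y + d) a'.
  by apply: (is_derive_eq (isD_add da (isD_cst d x v))); rewrite addr0.
have dF1 := is_derive_comp (dF ax) da.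
have ds := isD_mul (isD_add dF1 db) (@is_derive_comp _ _ _ (fun y => a y + d) _ _ _ _ (isD_inv tn0) dad).
have dt := @is_derive_comp _ _ _ (fun y => slope (a y) (b y)) _ _ _ _ (is_derive_tpow (slope (a x) (b x)) n2 M0) ds.
apply: (is_derive_eq (isD_mul dad dt)).
rewrite /tpow /tangent /=; move: (clamp _ _ ^+ n.-1) (clamp _ _ ^+ n) (n%:R) (n.-1%:R) => p q k1 k2.
by field.
Qed.

Let continuous_slope (a b : 'rV[R]_n -> R) x : 0 < a x < 1 ->
  {for x, continuous a} -> {for x, continuous b} ->
  {for x, continuous (fun y => slope (a y) (b y))}.
Proof.
move=> ax ca cb; apply: cont_mul.
  apply: cont_add => //; apply: cont_comp => //.
  exact: is_derive_continuous1 (dF ax).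
apply: (@cont_comp _ _ _ (@GRing.inv R)); last by apply: inv_continuous; rewrite gt_eqF// td0.
by apply: cont_add => //; exact: cst_continuous.
Qed.

Let continuous_tpow : continuous (tpow n M).
Proof. by move=> y; exact: is_derive_continuous1 (is_derive_tpow y n2 M0). Qed.

Let continuous_P (a b : 'rV[R]_n -> R) x : 0 < a x < 1 ->
  {for x, continuous a} -> {for x, continuous b} ->
  [/\ {for x, continuous (fun y => P (a y) (b y))}, {for x, continuous (fun y => Pt (a y) (b y))} &
      {for x, continuous (fun y => Pz (a y) (b y))}].
Proof.
move=> ax ca cb; have cs := continuous_slope ax ca cb.
have cc (j : nat) : {for x, continuous (fun y => clamp M (slope (a y) (b y)) ^+ j)}.
  apply: (@cont_comp _ _ _ (fun s : R => s ^+ j)); last exact: exprn_continuous.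
  by apply: cont_comp => //; exact: continuous_clamp.
have ck (j : nat) : {for x, continuous (fun y => n%:R * clamp M (slope (a y) (b y)) ^+ j)}.
  by apply: cont_mul => //; exact: cst_continuous.
split => //.
- apply: cont_mul; first by apply: cont_add => //; exact: cst_continuous.
  by apply: cont_comp => //; exact: continuous_tpow.
- apply: cont_add; first by apply: cont_mul => //; apply: cont_comp => //; exact: cF'.
  by apply: cont_opp; apply: cont_mul => //; exact: cst_continuous.
Qed.

Let measurable_P (f : 'rV[R]_n -> R) : measurable_fun (annulus R n) f ->
  [/\ measurable_fun (annulus R n) (fun x => P (lgr x) (f x)),
      measurable_fun (annulus R n) (fun x => Pt (lgr x) (f x)) &
      measurable_fun (annulus R n) (fun x => Pz (lgr x) (f x))].
Proof.
move=> mf; have mc (g : R -> R) : (forall t : R, 0 < t < 1 -> {for t, continuous g}) ->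
    measurable_fun (annulus R n) (g \o @lgr R n).
  move=> cg; apply: (continuous_measurable_rV (@open_annulus R n)) => x Ax.
  by apply: cont_comp; [exact: continuous_lgr|exact/cg/lgr_annulus].
have mt (g : R -> R) (h : 'rV[R]_n -> R) : continuous g ->
    measurable_fun (annulus R n) h -> measurable_fun (annulus R n) (g \o h).
  by move=> cg; apply: measurableT_comp; exact: continuous_measurable_fun.
have cadd (t : R) : {for t, continuous (fun s => s + d)}.
  by apply: cont_add; [exact: (fun B => @cvg_id _ _ B)|exact: cst_continuous].
have ms : measurable_fun (annulus R n) (fun x => slope (lgr x) (f x)).
  apply: measurable_funM.
    apply: measurable_funD => //; apply: mc => t t01.
    exact: is_derive_continuous1 (dF t01).
  apply: (mc (fun t => (t + d)^-1)) => t t01.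
  by apply: (@cont_comp _ _ _ (@GRing.inv R)) => //; apply: inv_continuous; rewrite gt_eqF// td0.
have mk (j : nat) : measurable_fun (annulus R n) (fun x => clamp M (slope (lgr x) (f x)) ^+ j).
  by apply: measurable_funX; exact: mt (@continuous_clamp M) ms.
have mnk (j : nat) (c : R) : measurable_fun (annulus R n) (fun x => c * clamp M (slope (lgr x) (f x)) ^+ j).
  by apply: measurable_funM => //; exact: measurable_cst.
split.
- apply: measurable_funM; first by apply: (mc (fun t => t + d)) => t _; exact: cadd.
  exact: mt continuous_tpow ms.
- by apply: measurable_funB => //; apply: measurable_funM => //; exact: (mc _ cF').
- exact: mnk.
Qed.

Let slope_lip (t y z : R) : 0 < t < 1 -> `|slope t y - slope t z| <= d^-1 * `|y - z|.
Proof.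
move=> t01; have t0 := td0 t01; rewrite -mulrBl [X in `|X / _|](_ : _ = y - z); last by ring.
rewrite normrM mulrC ler_wpM2r// normfV (gtr0_norm t0) lef_pV2 ?posrE// lerDr.
by case/andP: t01 => /ltW.
Qed.

(** Subtracting the value at [z = 0] makes [H] and [Ht] vanish there, as a calibration must. *)
Definition power_H t z := Q * (P t z - P t 0).
Definition power_Ht t z := Q * (Pt t z - Pt t 0).
Definition power_Hz t z := Q * Pz t z.

Lemma power_calibration : exists K, calibration n power_H power_Ht power_Hz K.
Proof.
have M'0 : 0 <= M'.
  by apply: le_trans (F'M (t := 2^-1) _) => //; rewrite invr_gt0 invf_lt1 ?ltr1n// ltr0n.
(* [K1], [K2] and [K3] are Lipschitz constants in [z] of [P], [Pt] and [Pz]. Division by [d] comes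
   from t + d > d; in [K1] the factor t + d of [P] cancels the denominator. *)
pose L := n.-1%:R * M ^+ n.-1.-1.
pose K1 := n%:R * M ^+ n.-1.
pose K2 := (n%:R * L * M' + n.-1%:R * K1) / d.
pose K3 := n%:R * L / d.
have L0 : 0 <= L by rewrite mulr_ge0// exprn_ge0.
have K10 : 0 <= K1 by rewrite mulr_ge0// exprn_ge0.
have K30 : 0 <= K3 by apply: divr_ge0 (ltW d0); rewrite mulr_ge0.
have K20 : 0 <= K2 by apply: divr_ge0 (ltW d0); apply: addr_ge0; apply: mulr_ge0 => //; exact: mulr_ge0.
exists (Q * (K1 + K2 + K3)).
have cl t y z : 0 < t < 1 ->
    `|clamp M (slope t y) - clamp M (slope t z)| <= d^-1 * `|y - z|.
  by move=> t01; apply: le_trans (clamp_lip _ _ M0) (slope_lip y z t01).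
have pl (j : nat) t y z : 0 < t < 1 ->
    `|clamp M (slope t y) ^+ j - clamp M (slope t z) ^+ j| <= j%:R * M ^+ j.-1 / d * `|y - z|.
  move=> t01; apply: le_trans (expr_lip j (cM _) (cM _)) _.
  by rewrite -[leRHS]mulrA ler_wpM2l ?cl// mulr_ge0// exprn_ge0.
split.
- by move=> t t01; rewrite /power_H subrr mulr0.
- by move=> t t01; rewrite /power_Ht subrr mulr0.
- move=> V a b x v a' b' ax da db.
  have D1 := is_derive_P ax da db; have D2 := is_derive_P ax da (isD_cst 0 x v).
  apply: (is_derive_eq (isD_scale Q (isD_sub D1 D2))).
  by rewrite /power_Ht /power_Hz; ring.
- move=> a b x ax ca cb.
  have [p1 p2 p3] := continuous_P ax ca cb.
  have [q1 q2 q3] := continuous_P ax ca (@cst_continuous 'rV[R]_n R 0 x).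
  have cQ (g : 'rV[R]_n -> R) : {for x, continuous g} -> {for x, continuous (fun y => Q * g y)}.
    by apply: cont_mul; exact: cst_continuous.
  by split; apply: cQ => //; apply: cont_add => //; exact: cont_opp.
- move=> f mf; have [p1 p2 p3] := measurable_P mf.
  have [q1 q2 q3] := measurable_P (measurable_cst (0 : R)).
  by split; apply: measurable_funM; try (exact: measurable_cst); [exact: measurable_funB|exact: measurable_funB|].
- move=> t y z t01; have t0 := td0 t01; split.
  + rewrite /power_H -mulrBr normrM (ger0_norm Q0) -mulrA ler_wpM2l//.
    rewrite (_ : _ - _ - _ = (t + d) * (tpow n M (slope t y) - tpow n M (slope t z))); last by ring.
    rewrite normrM (gtr0_norm t0).
    apply: (@le_trans _ _ (K1 * `|y - z|)).
      apply: le_trans (ler_wpM2l (ltW t0) (tpow_lip _ _ n2 M0)) _.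
      rewrite -mulrBl [X in `|X / _|](_ : _ = y - z); last by ring.
      rewrite normrM normfV (gtr0_norm t0) le_eqVlt; apply/orP; left; apply/eqP.
      by rewrite /K1; field; rewrite gt_eqF.
    by rewrite ler_wpM2r// -addrA lerDl addr_ge0.
  + rewrite /power_Ht -mulrBr normrM (ger0_norm Q0) -mulrA ler_wpM2l//.
    apply: (@le_trans _ _ (K2 * `|y - z|)); last first.
      by rewrite ler_wpM2r// -addrA addrCA lerDl addr_ge0.
    set cy := clamp M (slope t y); set cz := clamp M (slope t z).
    rewrite (_ : _ - _ - _ = n%:R * (cy ^+ n.-1 - cz ^+ n.-1) * F' t - n.-1%:R * (cy ^+ n - cz ^+ n));
      last by rewrite /tangent; ring.
    apply: le_trans (ler_normB _ _) _; rewrite /K2 mulrDl mulrDl; apply: lerD.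
      rewrite normrM normrM (ger0_norm (_ : 0 <= n%:R))//.
      apply: (@le_trans _ _ (n%:R * (L / d * `|y - z|) * M')).
        by apply: ler_pM => //; [rewrite ler_wpM2l// pl|exact: F'M].
      by rewrite le_eqVlt; apply/orP; left; apply/eqP; ring.
    rewrite normrM (ger0_norm (_ : 0 <= n.-1%:R))// -2!mulrA ler_wpM2l//.
    by rewrite mulrA pl.
  + rewrite /power_Hz -mulrBr normrM (ger0_norm Q0) -mulrA ler_wpM2l//.
    apply: (@le_trans _ _ (K3 * `|y - z|)); last by rewrite ler_wpM2r// lerDr addr_ge0.
    rewrite -mulrBr normrM (ger0_norm (_ : 0 <= n%:R))// /K3 -2!mulrA ler_wpM2l//.
    by rewrite mulrA pl.
- move=> t z t01; rewrite /power_Hz normrM (ger0_norm Q0) ler_wpM2l//.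
  have /andP[c0 c1] := cM (slope t z).
  rewrite ger0_norm ?mulr_ge0 ?exprn_ge0//.
  apply: (@le_trans _ _ K1); last by rewrite -addrA lerDl addr_ge0.
  by rewrite /K1 ler_wpM2l// lerXn2r.
Qed.

End power_calibration.

(** The function C (t + d)^g. *)
Definition powf (C g d t : R) := C * expR (g * ln (t + d)).

Lemma is_derive_powf (C g d t : R) : 0 < t + d ->
  is_derive t 1 (powf C g d) (powf (g * C) (g - 1) d t).
Proof.
move=> t0; have d1 : is_derive t 1 (fun s => s + d) 1.
  by apply: (is_derive_eq (isD_add (is_derive_id t 1) (isD_cst d t 1))); rewrite addr0.
have d2 := isD_scale g (@is_derive_comp _ _ _ (fun s => s + d) _ _ _ _ (is_derive1_ln t0) d1).
apply: (is_derive_eq (isD_scale C (@is_derive_comp _ _ _ (fun s => g * ln (s + d)) _ _ _ _ (is_derive_expR _) d2))).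
rewrite /powf mulrBl mul1r expRD expRN (lnK (x := t + d)) ?posrE// mulr1.
by ring.
Qed.

Lemma powf_split (C g d t : R) : 0 < t + d -> powf C g d t = (t + d) * powf C (g - 1) d t.
Proof.
move=> t0; rewrite /powf mulrBl mul1r expRD expRN (lnK (x := t + d)) ?posrE//.
by field; rewrite gt_eqF.
Qed.

Lemma powf_gt0 (C g d t : R) : 0 < C -> 0 < powf C g d t.
Proof. by move=> C0; rewrite mulr_gt0// expR_gt0. Qed.

Lemma powf_lt (C g d s t : R) : 0 < C -> 0 < g -> 0 < s + d -> s < t ->
  powf C g d s < powf C g d t.
Proof.
move=> C0 g0 s0 st; rewrite /powf ltr_pM2l// ltr_expR ltr_pM2l// ltr_ln ?ltrD2r// posrE//.
by rewrite (lt_trans s0)// ltrD2r.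
Qed.

(** For [F = C (t + d)^g] the derivative is [g] times the quotient [s t = F t / (t + d)], so the
    calibration inequality is homogeneous in [s t] and reduces to the numerical condition on [g]. *)
Lemma power_quasisuperminimizer (n : nat) (Q C g d : R) : (2 <= n)%N -> 0 < Q -> 0 < C ->
  1 < g -> 0 < d -> g ^+ n <= tline n Q g ->
  quasisuperminimizer (annulus R n) n%:R Q ((fun t => powf C g d t - powf C g d 0) \o @lgr R n).
Proof.
move=> n2 Q0 C0 g1 d0 gQ; have g0 : 0 < g by exact: lt_trans g1.
have g10 : 0 < g - 1 by rewrite subr_gt0.
have td0 (t : R) : 0 < t < 1 -> 0 < t + d by move=> /andP[t0 _]; rewrite addr_gt0.
pose F := powf C g d; pose F' := powf (g * C) (g - 1) d; pose s := powf C (g - 1) d.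
(* [s] increases up to [M], so the truncation in [tpow] is inactive at [z = 0]. *)
pose M := s 1.
have s_bd (t : R) : 0 < t < 1 -> 0 <= s t <= M.
  move=> t01; rewrite (ltW (powf_gt0 _ _ _ C0))/=.
  by rewrite ltW// powf_lt// ?td0//; case/andP: t01.
have M0 : 0 <= M by exact: ltW (powf_gt0 _ _ _ C0).
have F'E t : F' t = g * s t by rewrite /F' /s /powf mulrA.
have dF (t : R) : 0 < t < 1 -> is_derive t 1 F (F' t) by move=> /td0; exact: is_derive_powf.
have cF' (t : R) : 0 < t < 1 -> {for t, continuous F'}.
  by move=> /td0 t0; exact: is_derive_continuous1 (is_derive_powf _ _ t0).
have F'M (t : R) : 0 < t < 1 -> `|F' t| <= g * M.
  move=> /s_bd/andP[s0 sM]; rewrite F'E ger0_norm; last by apply: mulr_ge0 => //; exact: ltW.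
  by apply: ler_wpM2l => //; exact: ltW.
have [K cal] := power_calibration n2 (ltW Q0) M0 d0 dF cF' F'M.
have df (t : R) : 0 < t < 1 -> is_derive t 1 (fun t => F t - F 0) (F' t).
  by move=> t01; apply: (is_derive_eq (isD_sub (dF t t01) (isD_cst (F 0) t 1))); rewrite subr0.
apply: (radial_quasisuperminimizer df cF' F'M n2 Q0 cal) => t z w t01 z0.
have n0 : (0 < n)%N by exact: ltn_trans n2.
have tp := td0 t t01.
have sE : (F t + 0) / (t + d) = s t.
  by rewrite addr0 /F powf_split// mulrC mulKf// gt_eqF.
rewrite /power_Ht /power_Hz sE (clamp_id (s_bd t t01)).
set c := clamp M _; have c0 : 0 <= c by exact: clamp_ge0.
have st0 : 0 <= s t by have /andP[] := s_bd t t01.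
(* The terms in [w] complete the first tangent to its value at [F' t + w], which lies below the
   power; the second tangent is [tline n Q g * s t ^+ n]. *)
have -> : Q * (tangent n c (F' t) - tangent n (s t) (F' t)) + Q * (n%:R * c ^+ n.-1) * w =
    Q * tangent n c (F' t + w) - Q * tangent n (s t) (F' t) by rewrite /tangent; ring.
apply: lerB; first by rewrite ler_wpM2l ?(ltW Q0)//; exact: tangent_le_norm.
rewrite F'E ger0_norm; last (by apply: mulr_ge0 => //; exact: ltW); rewrite exprMn.
have -> : Q * tangent n (s t) (g * s t) = tline n Q g * s t ^+ n.
  have -> : tangent n (s t) (g * s t) = n%:R * g * (s t ^+ n.-1 * s t) - n.-1%:R * s t ^+ n.
    by rewrite /tangent; ring.
  by rewrite -exprSr prednK// /tline; ring.
by rewrite ler_wpM2r// exprn_ge0.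
Qed.

Lemma linear_calibration (n : nat) (Q : R) : 0 <= Q ->
  calibration n (fun _ z => Q * z) (fun _ _ => 0) (fun _ _ => Q) Q.
Proof.
move=> Q0; split => //.
- by move=> t _; rewrite mulr0.
- move=> V a b x v a' b' _ _ db.
  by apply: (is_derive_eq (isD_scale Q db)); rewrite mul0r add0r.
- move=> a b x _ _ cb; split; try exact: cst_continuous.
  by apply: cont_mul => //; exact: cst_continuous.
- move=> f mf; split; try exact: measurable_cst.
  by apply: measurable_funM => //; exact: measurable_cst.
- by move=> t y z _; rewrite -mulrBr normrM (ger0_norm Q0) !subrr normr0 mulr_ge0.
- by move=> t z _; rewrite ger0_norm.
Qed.

(** The calibration is the slope of the tangent of [Q w^n] at 1: [Q |f' + w|^n] lies above this line
    at [f' + w], and [f'^n] lies below it at [f'], since [f'] stays between the crossings. *)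
Lemma chord_quasisuperminimizer (n : nat) (Q a b : R) (f f' : R -> R) :
  (2 <= n)%N -> 0 < Q -> 0 <= a -> tline n Q a = a ^+ n -> tline n Q b = b ^+ n ->
  (forall t : R, 0 < t < 1 -> is_derive t 1 f (f' t)) ->
  (forall t : R, 0 < t < 1 -> {for t, continuous f'}) ->
  (forall t : R, 0 < t < 1 -> a <= f' t <= b) ->
  quasisuperminimizer (annulus R n) n%:R Q (f \o @lgr R n).
Proof.
move=> n2 Q0 a0 La Lb df cf' f'ab; have n0 : (0 < n)%N by exact: ltn_trans n2.
have f'M (t : R) : 0 < t < 1 -> `|f' t| <= b.
  by move=> /f'ab/andP[af fb]; rewrite ger0_norm// (le_trans a0).
have cal := @linear_calibration n (Q * n%:R) (mulr_ge0 (ltW Q0) (ler0n _ n)).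
apply: (radial_quasisuperminimizer df cf' f'M n2 Q0 cal) => t z w t01 _.
have /andP[af fb] := f'ab t t01; rewrite add0r.
have H := tline_chord n0 a0 (f'ab t t01) La Lb.
rewrite (ger0_norm (le_trans a0 af)); apply: le_trans (lerB _ H); last first.
  by apply: (ler_wpM2l (ltW Q0)); exact: (tangent_le_norm (f' t + w) n0 ler01).
rewrite !expr1n /tline le_eqVlt; apply/orP; left; apply/eqP; ring.
Qed.

End one_dim.

(** * Energy of the minimum of two radial functions *)

Section radial_test.
Context (R : realType) (n : nat).
Local Notation mu := (lebesgue_rV R n).
Local Notation A := (annulus R n).

(** A line in the first coordinate direction meets the sphere in at most two points, so Fubini gives
    measure 0. *)
Lemma null_sphere m (r : R) : lebesgue_rV R m.+1 [set x | sqn x = r] = 0%E.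
Proof.
have mS : measurable [set x : 'rV[R]_m.+1 | sqn x = r].
  have := continuous_measurable_rV (@openT 'rV[R]_m.+1) (fun x _ => @continuous_sqn R m.+1 x).
  by move=> /(_ measurableT _ (measurable_set1 r)); rewrite setTI.
rewrite /= /lebesgue_cons /pushforward.
have mS' : measurable (@rV_cons R m @^-1` [set x | sqn x = r]).
  by rewrite -[X in measurable X]setTI; exact: measurable_rV_cons.
(* Exchange the order of integration, so that the inner sections are those in the first
   coordinate. *)
rewrite (@product_measure_unique _ _ _ _ _ _ _ (lebesgue_measure \x^ lebesgue_rV R m)%E)//; last first.
  by move=> X Y mX mY; rewrite /= product_measure2E.
rewrite /= /product_measure2; apply: integral0_eq => y _ /=.
apply: countable_lebesgue_measure0; apply: finite_set_countable.
set c := r - sqn y.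
apply: (@sub_finite_set _ _ [set Num.sqrt c; - Num.sqrt c]); last exact: finite_set2.
move=> t; rewrite /ysection /= inE /= => H.
have tc : t ^+ 2 = c.
  rewrite /c -H /sqn big_ord_recl rV_cons0 /=.
  by under eq_bigr do rewrite rV_consS; rewrite addrK.
have : `|t| = Num.sqrt c by rewrite -tc sqrtr_sqr.
by case: (ger0P t) => _ <-; [left|right; rewrite opprK].
Qed.

Lemma null_lgr (c : R) : (0 < n)%N -> {ae mu, forall x, A x -> lgr x != c}.
Proof.
case: n => // m _; exists [set x | sqn x = expR (- c) ^+ 2]; split.
- have := continuous_measurable_rV (@openT 'rV[R]_m.+1) (fun x _ => @continuous_sqn R m.+1 x).
  by move=> /(_ measurableT _ (measurable_set1 (expR (- c) ^+ 2))); rewrite setTI.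
- exact: null_sphere.
- move=> x /= /not_implyP[Ax /negP]; rewrite negbK => /eqP xc.
  by rewrite sqnE -xc expRN expR_lgr// invrK.
Qed.

(* The radial functions [g \o lgr] are integrated against [|x| ^- n dx], for which
   the radial derivative of a compactly supported function has integral 0. *)
Definition wint (g : R -> R) : R := \int[mu]_(x in A) (expR (lgr x) ^+ n * g (lgr x)).

Definition measurable01 (g : R -> R) := measurable_fun (A : set 'rV[R]_n) (g \o @lgr R n).

Lemma measurable_expR_lgr : measurable_fun A (fun x => expR (lgr x) ^+ n).
Proof.
apply: (continuous_measurable_rV (@open_annulus R n)) => x Ax.
exact: continuous_expR_lgr.
Qed.

Lemma wint_integrable (g : R -> R) (M : R) : measurable01 g ->
  (forall t : R, 0 < t < 1 -> `|g t| <= M) ->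
  mu.-integrable A (EFin \o (fun x => expR (lgr x) ^+ n * g (lgr x))).
Proof.
move=> mg gM; have mA := open_measurable_rV (@open_annulus R n).
apply: (@bounded_integrable _ _ _ _ (expR 1 ^+ n * M)) => //; first exact: annulus_lty.
  exact: measurable_funM measurable_expR_lgr mg.
move=> x Ax; rewrite normrM; apply: ler_pM => //; last exact: gM (lgr_annulus Ax).
have /andP[e0 e1] := expR_lgr_le Ax.
by rewrite ger0_norm ?exprn_ge0 ?(ltW e0)// lerXn2r ?nnegrE ?expR_ge0.
Qed.

(** Convergence is required off one value [c] only: the sphere where [lgr] equals [c] is null. This
    covers limits whose slope jumps at one point. *)
Lemma wint_cvg (G : nat -> R -> R) (g : R -> R) (M c : R) : (0 < n)%N ->
  (forall k, measurable01 (G k)) -> measurable01 g ->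
  (forall k (t : R), 0 < t < 1 -> `|G k t| <= M) ->
  (forall t : R, 0 < t < 1 -> t != c -> (fun k => G k t) @ \oo --> g t) ->
  (fun k => wint (G k)) @ \oo --> wint g.
Proof.
move=> n0 mG mg GM Gg; have mA := open_measurable_rV (@open_annulus R n).
have mM (h : R -> R) : measurable01 h -> measurable_fun A (fun x => expR (lgr x) ^+ n * h (lgr x)).
  exact: measurable_funM measurable_expR_lgr.
have [| | | | |_ H] := @Rdominated_cvg _ _ _ mu A (fun k x => expR (lgr x) ^+ n * G k (lgr x))
  (fun x => expR (lgr x) ^+ n * g (lgr x)) (fun=> expR 1 ^+ n * M) mA.
- by move=> k; exact: mM.
- exact: mM.
- apply: filterS (null_lgr c n0) => x xc Ax.
  by apply: cvgM; [exact: cvg_cst|apply: Gg; [exact: lgr_annulus|exact: xc]].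
- by apply: integrable_cst_fin => //; exact: annulus_lty.
- move=> k x Ax; rewrite normrM; apply: ler_pM => //; last exact: GM (lgr_annulus Ax).
  have /andP[e0 e1] := expR_lgr_le Ax.
  by rewrite ger0_norm ?exprn_ge0 ?(ltW e0)// lerXn2r ?nnegrE ?expR_ge0.
exact: H.
Qed.

Lemma W1p0_test_function (Omega : set 'rV[R]_n) (psi : 'rV[R]_n -> R) : (0 < n)%N -> open Omega -> test_function Omega psi ->
  W1p0 Omega n%:R psi.
Proof.
move=> n0 oO tpsi; have [cpsi cdpsi dpsi] := test_function_smooth tpsi.
have mO := open_measurable_rV oO.
have [M psiM] := test_function_bounded oO tpsi.
have [C [cC CO psi0 dpsi0]] := test_function_support oO tpsi.
have wg : is_weak_gradient Omega psi (fun x => \row_i partial i psi x).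
  by apply: C1_is_weak_gradient => // [x _|i x _]; [exact: cpsi|exact: cdpsi].
have mC := compact_measurable_rV cC.
have LC (u : 'rV[R]_n -> R) : (forall x, {for x, continuous u}) -> (forall x, ~ C x -> u x = 0) ->
    Lp Omega n%:R u.
  move=> cu u0; have [K uK] := continuous_bounded cC (fun x _ => cu x).
  have LpC : Lp C n%:R u.
    apply: (@bounded_Lp _ _ _ _ _ K) => //; first exact: compact_lty.
    apply: (measurable_funS measurableT) => //.
    by apply: (continuous_measurable_rV (@openT _)) => x _; exact: cu.
  rewrite /Lp (_ : u \_ Omega = u \_ C)//; apply/funext => x; rewrite !patchE.
  have [/set_mem Cx|Cx] := boolP (x \in C); first by rewrite mem_set//; exact: CO.
  by case: ifP => // _; apply: u0 => /mem_set; exact/negP.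
split.
  split; [exact: LC|by exists (fun x => \row_i partial i psi x)|move=> i].
  have Li := LC _ (fun x => cdpsi i x) (fun x => @dpsi0 i x).
  have [mi ii] := (LpP _ n0 mO).1 Li; apply/(LpP _ n0 mO).
  have mg : measurable_fun Omega (fun x => gradient Omega psi x ord0 i).
    have [_ + _] := gradientP (ex_intro _ _ wg) => /(_ i); exact: Lp_loc_measurable.
  split => //; apply: (@ae_integrable _ _ _ (fun x => `|gradient Omega psi x ord0 i| ^+ n) _ mO ii).
    by apply: measurable_funX; exact: measurableT_comp.
  apply: filterS (gradient_ae oO wg) => x gx Ox.
  by rewrite gx// mxE ger0_norm// exprn_ge0.
move=> e e0; exists psi => //.
have -> : (psi \- psi) = cst 0 by apply/funext => x /=; rewrite subrr.
have w0 : is_weak_gradient Omega (cst 0 : 'rV[R]_n -> R) (fun x => \row_i (0 : R)).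
  by apply: C1_is_weak_gradient => // [x _|i x _]; exact: cst_continuous.
rewrite /W1p_norm.
have p0 : (0 < n%:R%:E :> \bar R)%E by rewrite lte_fin ltr0n.
rewrite (_ : EFin \o (cst 0 \_ Omega) = cst 0%E); last first.
  by apply/funext => x /=; rewrite patchE; case: ifP.
rewrite Lnorm0 ?gt_eqF// add0e.
set F := EFin \o _; rewrite (_ : ('N[mu]_(n%:R)%:E[F])%E = 0%E) ?lte_fin//.
have mF : measurable_fun setT F.
  apply/measurable_EFinP/(measurable_restrictT _ mO); apply: measurable_enorm => i.
  have [_ + _] := gradientP (ex_intro _ _ w0) => /(_ i); exact: Lp_loc_measurable.
have F0 : {ae mu, forall x, F x = 0%E}.
  apply: filterS (gradient_ae oO w0) => x gx; rewrite /F /= patchE; case: ifP => // /set_mem Ox.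
  rewrite /= gx// /enorm big1 ?sqrtr0// => i _; by rewrite mxE expr0n.
rewrite unlock /Lnorm (_ : (\int[mu]_x _)%E = 0%E); last first.
  rewrite (@ae_eq_integral _ _ _ mu setT (cst 0%E))//; first exact: integral0.
    apply: (@measurableT_comp _ _ _ _ _ _ (fun y : \bar R => (y `^ n%:R)%E)); first exact: measurable_poweR.
    exact: measurableT_comp.
  by apply: filterS F0 => x Fx _; rewrite Fx /= normr0 powR0// pnatr_eq0 -lt0n.
by rewrite poweR0r// invr_eq0 pnatr_eq0 -lt0n.
Qed.

Definition test_profile (psi psi' : R -> R) (a b : R) :=
  [/\ 0 < a, b < 1, smooth_on A (psi \o @lgr R n),
    (forall t : R, 0 < t < 1 -> is_derive t 1 psi (psi' t)) &
    (forall t : R, 0 < t < 1 -> {for t, continuous psi'}) /\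
    (forall t : R, 0 < t < 1 -> psi t != 0 -> a <= t <= b)].

Lemma measurable01_continuous (g : R -> R) :
  (forall t : R, 0 < t < 1 -> {for t, continuous g}) -> measurable01 g.
Proof.
move=> cg; apply: (continuous_measurable_rV (@open_annulus R n)) => x Ax.
by apply: cont_comp; [exact: continuous_lgr|exact/cg/lgr_annulus].
Qed.

Lemma lgr_gt0_annulus (x : 'rV[R]_n) : 0 < lgr x < 1 -> A x.
Proof.
move=> t01; apply: annulus_expR => //; have := enorm_ge0 x; rewrite le_eqVlt => /orP[/eqP x0|//].
by move: t01; rewrite /lgr -x0 ln0// oppr0 ltxx.
Qed.

Section profile.
Context (psi psi' : R -> R) (a b : R).
Context (tpsi : test_profile psi psi' a b).

(** [psi] is constrained on (0, 1) only, whereas a test function is defined on the whole space;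
    hence the extension by 0. *)
Definition radial_test : 'rV[R]_n -> R := (psi \_ (`]0, 1[%classic : set R)) \o @lgr R n.

Lemma radial_testE x : A x -> radial_test x = psi (lgr x).
Proof.
by move=> Ax; rewrite /radial_test /= patchE mem_set//= in_itv/= lgr_annulus.
Qed.

Lemma test_function_radial : test_function A radial_test.
Proof.
have [a0 b1 spsi dpsi [cpsi' psiab]] := tpsi.
pose C := @enorm R n @^-1` `[expR (- b), expR (- a)]%classic.
have CA x : C x -> A x.
  rewrite /C /= in_itv/= => /andP[x1 x2]; apply/andP; split.
    by apply: lt_le_trans x1; rewrite -expRN ltr_expR ltrN2.
  by apply: (le_lt_trans x2); rewrite -expR0 ltr_expR oppr_lt0.
apply: (@smooth_test_function R n A C) => //.
- exact: open_annulus.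
- apply: (@subclosed_compact _ _ (cbox (\row_i (-1)) (\row_i 1))).
  + by apply: preimage_closed => [x _|]; [exact: continuous_enorm|exact: interval_closed].
  + exact: compact_cbox.
  + move=> x /CA /andP[_ x1] i; rewrite /= in_itv/= !mxE -ler_norml.
    exact: le_trans (le_coord_enorm x i) (ltW x1).
- by apply: (smooth_eq spsi) => x Ax; rewrite radial_testE.
move=> x Cx; rewrite /radial_test /= patchE; case: ifP => // /set_mem /=.
rewrite in_itv/= => t01; have Ax := lgr_gt0_annulus t01.
have [//|px] := eqVneq (psi (lgr x)) 0; exfalso; apply: Cx.
have := psiab _ t01 px; rewrite /C /= in_itv/= => /andP[at1 tb].
have -> : enorm x = expR (- lgr x) by rewrite expRN expR_lgr// invrK.
by rewrite !ler_expR !lerN2 at1 tb.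
Qed.

Lemma radial_test_weak_gradient : is_weak_gradient A radial_test (radial_gradient psi').
Proof.
have [a0 b1 spsi dpsi [cpsi' psiab]] := tpsi.
apply: (@is_weak_gradient_restrict R n A A (psi \o @lgr R n)) => //; try exact: open_annulus.
  by move=> x Ax; rewrite radial_testE.
exact: radial_weak_gradient.
Qed.

(** The calibration [H t z = z] applied to the radial test function. *)
Lemma wint_test_profile : (2 <= n)%N -> wint psi' = 0.
Proof.
move=> n2; have n0 : (0 < n)%N by exact: ltn_trans n2.
have mA := open_measurable_rV (@open_annulus R n).
have [a0 b1 spsi dpsi [cpsi' psiab]] := tpsi.
have W := W1p0_test_function n0 (@open_annulus R n) test_function_radial.
have [iD <-] := calibration_integral0 n2 (linear_calibration n ler01) W.
apply: ae_eq_Rintegral => //.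
- exact: measurable_funM measurable_expR_lgr (measurable01_continuous cpsi').
- by apply/measurable_EFinP; exact: measurable_int iD.
apply: filterS (gradient_ae (@open_annulus R n) radial_test_weak_gradient) => x gx Ax.
by rewrite gx// dotp_radial_gradient// add0r mul1r.
Qed.

End profile.

Lemma measurable01_gt0 (K : R -> R) : measurable01 K -> measurable01 (fun t => (0 < K t)%R%:R).
Proof.
move=> mK; rewrite /measurable01.
rewrite (_ : _ \o _ = \1_(`]0, +oo[%classic : set R) \o (K \o @lgr R n)).
  by apply: measurableT_comp => //; exact: measurable_indic.
by apply/funext => x; rewrite /= indicE /= mem_setE in_itv/= andbT.
Qed.

(** The integrand is the derivative of the positive part of [K], which tends to 0 at both ends by
    the hypothesis on superlevel sets. It is approximated by compactly supported profiles. *)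
Lemma wint_derive_gt0 (K K' : R -> R) (M : R) : (2 <= n)%N -> smooth_on A (K \o @lgr R n) ->
  (forall t : R, 0 < t < 1 -> is_derive t 1 K (K' t)) ->
  (forall t : R, 0 < t < 1 -> {for t, continuous K'}) ->
  (forall t : R, 0 < t < 1 -> `|K' t| <= M) ->
  (forall eta : R, 0 < eta -> exists a b : R, [/\ 0 < a, b < 1 &
    forall t : R, 0 < t < 1 -> eta < K t -> a <= t <= b]) ->
  wint (fun t => (0 < K t)%R%:R * K' t) = 0.
Proof.
move=> n2 sK dK cK' K'M Kab; have n0 : (0 < n)%N by exact: ltn_trans n2.
pose h (k : nat) : R := k.+1%:R^-1; have h0 k : 0 < h k by rewrite invr_gt0.
have hl : h @ \oo --> (0 : R) by exact: cvg_harmonic.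
(* The shift by [h k] confines the approximation to the set where [K > h k], which lies in a compact
   subinterval of (0, 1). *)
pose G k t := dsramp (h k) (K t - h k) * K' t.
have cK (t : R) : 0 < t < 1 -> {for t, continuous K}.
  by move=> t01; exact: is_derive_continuous1 (dK t t01).
have cG k (t : R) : 0 < t < 1 -> {for t, continuous (G k)}.
  move=> t01; apply: cont_mul; last exact: cK'.
  apply: cont_comp; last exact: continuous_dsramp.
  by apply: cont_add; [exact: cK|exact: cst_continuous].
have H : (fun k => wint (G k)) @ \oo --> wint (fun t => (0 < K t)%R%:R * K' t).
  apply: (@wint_cvg _ _ M 0) => //.
  - by move=> k; apply: measurable01_continuous; exact: cG.
  - by apply: measurable_funM; [apply: measurable01_gt0|]; exact: measurable01_continuous.
  - move=> k t t01; rewrite /G normrM; have /andP[d0 d1] := dsramp_bound (K t - h k) (h0 k).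
    by rewrite ger0_norm// -[leRHS]mul1r ler_pM// K'M.
  - move=> t t01 _; have [Kt|Kt] := ltP 0 (K t).
      apply: cvgM; last exact: cvg_cst.
      apply: (cvg_dsramp h0 hl Kt); rewrite -[X in _ --> X]subr0.
      by apply: cvgB => //; exact: cvg_cst.
    rewrite mul0r (_ : (fun k => _) = cst 0); first exact: cvg_cst.
    apply/funext => k; rewrite /G; have [|_ ->] := @sramp_le0 _ (h k) (K t - h k) (h0 k).
      by rewrite subr_le0 (le_trans Kt)// ltW.
    by rewrite mul0r.
apply/esym/(cvg_unique _ _ H) => //.
rewrite (_ : (fun k => _) = cst 0); first exact: cvg_cst.
apply/funext => k; have [a [b [a0 b1 ab]]] := Kab _ (h0 k).
apply: (@wint_test_profile (fun t => sramp (h k) (K t - h k)) _ a b) => //; split => //.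
- apply: smooth_sramp; apply: (smooth_eq (smooth_add sK (smooth_cst A (- h k)))) => //.
- move=> t t01; apply: (@is_derive_comp R _ _ (fun t => K t - h k) t 1 _ _ (is_derive_sramp _ _)).
  by apply: (is_derive_eq (isD_sub (dK t t01) (isD_cst (h k) t 1))); rewrite subr0.
split => [|t t01 Kt]; first exact: cG.
apply: ab => //; rewrite -subr_gt0 ltNge; apply: contraNN Kt => Kt.
by have [->] := sramp_le0 (h0 k) Kt.
Qed.

Lemma measurable01_neq0 (g : R -> R) : measurable01 g -> measurable01 (fun t => (g t != 0)%R%:R).
Proof.
move=> mg; rewrite /measurable01.
rewrite (_ : _ \o _ = \1_(~` [set 0 : R]) \o (g \o @lgr R n)).
  apply: measurableT_comp => //; apply: measurable_indic.
  by apply: measurableC; exact: measurable_set1.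
apply/funext => x /=; rewrite indicE in_setC; congr (~~ _)%:R.
by apply/idP/idP => [/eqP H|/set_mem/eqP//]; exact/mem_set.
Qed.

Lemma measurable01_normX (g : R -> R) : measurable01 g -> measurable01 (fun t => `|g t| ^+ n).
Proof. by move=> mg; apply: measurable_funX; exact: measurableT_comp. Qed.

Lemma integral_energy_radial (psi g' : R -> R) (M : R) (v : 'rV[R]_n -> R) (phi : 'rV[R]_n -> R) :
  (0 < n)%N -> weakly_differentiable A v ->
  {ae mu, forall x, A x -> gradient A v x = radial_gradient g' x} ->
  measurable01 g' -> (forall t : R, 0 < t < 1 -> `|g' t| <= M) ->
  measurable01 psi -> (forall x, A x -> phi x = psi (lgr x)) ->
  (\int[mu]_(x in A `&` [set x | phi x != 0%R]) (enorm (gradient A v x) `^ n%:R)%:E =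
   (wint (fun t => (psi t != 0)%R%:R * `|g' t| ^+ n))%:E)%E.
Proof.
move=> n0 wv; have : measurable_fun A (@enorm R n \o gradient A v).
  apply: measurable_enorm => i; have [_ + _] := gradientP wv => /(_ i).
  exact: (Lp_loc_measurable (@open_annulus R n)).
generalize (gradient A v) => G mG gG mg' g'M mpsi phiE.
have mA := open_measurable_rV (@open_annulus R n).
rewrite integral_powR_nat; set S := A `&` _.
have mS : measurable S.
  rewrite /S (_ : _ `&` _ = A `&` (psi \o @lgr R n) @^-1` (~` [set 0])).
    by apply: mpsi => //; apply: measurableC; exact: measurable_set1.
  apply/seteqP; split => x [Ax] /=; rewrite phiE// => px; split => //=; first exact/eqP.
  exact/eqP.
have SA : S `<=` A by exact: subIsetl.
set w := (w in wint w).
have mw : measurable01 w by apply: measurable_funM; [exact: measurable01_neq0|exact: measurable01_normX].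
have iw : mu.-integrable A (EFin \o (fun x => expR (lgr x) ^+ n * w (lgr x))).
  apply: (@wint_integrable _ (M ^+ n)) => // t t01; rewrite /w normrM normrX normr_id.
  rewrite -[leRHS]mul1r; apply: ler_pM => //.
    by case: (_ != _); rewrite ?normr1 ?normr0.
  by rewrite lerXn2r ?nnegrE ?(le_trans _ (g'M t t01))// g'M.
rewrite /wint -(EFin_Rintegral mA iw) [LHS]integral_mkcond [RHS]integral_mkcond.
apply: ae_eq_integral => //.
- apply/(measurable_restrictT _ mS)/measurable_EFinP; apply: measurable_funX.
  exact: measurable_funS mA SA mG.
- by apply/(measurable_restrictT _ mA); exact: measurable_int iw.
apply: filterS gG => x gx _; rewrite !patchE.
have [/set_mem Ax|Ax] := boolP (x \in A); last first.
  by rewrite memNset// => /SA /mem_set; exact/negP.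
have [/set_mem [_ /= px]|/negP xS] := boolP (x \in S).
  rewrite gx// enorm_radial_gradient// /w -phiE// px mul1r exprMn mulrC//.
rewrite /w -phiE//; have [_|px] := eqVneq (phi x) 0; first by rewrite mul0r mulr0.
by exfalso; apply: xS; apply/mem_set; split.
Qed.

(** * Comparison of the minimum with the identity *)

Section minimum.
Context (f1 f1' f2 f2' : R -> R) (M b : R).
Context (n2 : (2 <= n)%N)
  (df1 : forall t : R, 0 < t < 1 -> is_derive t 1 f1 (f1' t))
  (df2 : forall t : R, 0 < t < 1 -> is_derive t 1 f2 (f2' t))
  (cf1' : forall t : R, 0 < t < 1 -> {for t, continuous f1'})
  (cf2' : forall t : R, 0 < t < 1 -> {for t, continuous f2'})
  (f1'M : forall t : R, 0 < t < 1 -> `|f1' t| <= M)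
  (f2'M : forall t : R, 0 < t < 1 -> `|f2' t| <= M)
  (f1_le : forall t : R, 0 < t < 1 -> t < b -> f1 t <= f2 t)
  (f2_le : forall t : R, 0 < t < 1 -> b < t -> f2 t <= f1 t).

(** The derivative of the minimum off t = b; the value at [b] is immaterial, as the sphere t = b is
    null. *)
Definition min_slope (t : R) := if t < b then f1' t else f2' t.

Local Notation u := ((f1 \o @lgr R n) \min (f2 \o @lgr R n)).

Lemma min_slope_bound (t : R) : 0 < t < 1 -> `|min_slope t| <= M.
Proof. by move=> t01; rewrite /min_slope; case: ifP => _; [exact: f1'M|exact: f2'M]. Qed.

Lemma measurable01_lt (c : R) : measurable01 (fun t => (t < c)%R%:R).
Proof.
have H : measurable01 (fun t => c - t).
  apply: measurable01_continuous => t _.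
  by apply: cont_add; [exact: cst_continuous|apply: cont_opp; exact: (fun B => @cvg_id _ _ B)].
apply: eq_measurable_fun (measurable01_gt0 H) => x _ /=.
by rewrite subr_gt0.
Qed.

Lemma measurable01_min_slope : measurable01 min_slope.
Proof.
have m1 := measurable01_continuous cf1'; have m2 := measurable01_continuous cf2'.
have H : measurable01 (fun t => f2' t + (t < b)%R%:R * (f1' t - f2' t)).
  apply: measurable_funD => //; apply: measurable_funM; first exact: measurable01_lt.
  exact: measurable_funB.
apply: eq_measurable_fun H => x _; rewrite /= /min_slope; case: ifP => _; last by rewrite mul0r addr0.
by rewrite mul1r addrC subrK.
Qed.

(** On each of the open sets t < b and t > b the minimum coincides with one of the two smooth
    functions, whose weak gradient is known and unique; the sphere in between is null. *)
Lemma gradient_min : weakly_differentiable A u ->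
  {ae mu, forall x, A x -> gradient A u x = radial_gradient min_slope x}.
Proof.
move=> wu; have n0 : (0 < n)%N by exact: ltn_trans n2.
have gu := gradientP wu; have oA := @open_annulus R n.
have enormE x : A x -> enorm x = expR (- lgr x) by move=> Ax; rewrite expRN expR_lgr// invrK.
pose A1 := A `&` @enorm R n @^-1` [set y | expR (- b) < y].
pose A2 := A `&` @enorm R n @^-1` [set y | y < expR (- b)].
have oA1 : open A1.
  by apply: openI => //; apply: open_comp; [move=> x _; exact: continuous_enorm|exact: open_gt].
have oA2 : open A2.
  by apply: openI => //; apply: open_comp; [move=> x _; exact: continuous_enorm|exact: open_lt].
have A1E x : A x -> A1 x <-> lgr x < b.
  by move=> Ax; rewrite /A1 /= enormE// ltr_expR ltrN2; split => [[]|].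
have A2E x : A x -> A2 x <-> b < lgr x.
  by move=> Ax; rewrite /A2 /= enormE// ltr_expR ltrN2; split => [[]|].
have g1 : {ae mu, forall x, A1 x -> gradient A u x = radial_gradient f1' x}.
  apply: (@weak_gradient_unique R n A1 (f1 \o @lgr R n)) => //.
    apply: (@is_weak_gradient_restrict R n A A1 u) => //; first exact: subIsetl.
    move=> x A1x; have Ax := A1x.1; rewrite /= min_l// f1_le//; first exact: lgr_annulus.
    exact/(A1E x Ax).
  apply: (@is_weak_gradient_restrict R n A A1 (f1 \o @lgr R n)) => //; first exact: subIsetl.
  exact: radial_weak_gradient.
have g2 : {ae mu, forall x, A2 x -> gradient A u x = radial_gradient f2' x}.
  apply: (@weak_gradient_unique R n A2 (f2 \o @lgr R n)) => //.
    apply: (@is_weak_gradient_restrict R n A A2 u) => //; first exact: subIsetl.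
    move=> x A2x; have Ax := A2x.1; rewrite /= min_r// f2_le//; first exact: lgr_annulus.
    exact/(A2E x Ax).
  apply: (@is_weak_gradient_restrict R n A A2 (f2 \o @lgr R n)) => //; first exact: subIsetl.
  exact: radial_weak_gradient.
apply: filterS3 g1 g2 (null_lgr b n0) => x g1x g2x xb Ax.
have [xb1|xb1|/eqP] := ltgtP (lgr x) b; last by rewrite (negbTE (xb Ax)).
- rewrite g1x; last exact/(A1E x Ax).
  by apply/rowP => i; rewrite !mxE /min_slope xb1.
- rewrite g2x; last exact/(A2E x Ax).
  by apply/rowP => i; rewrite !mxE /min_slope ltNge (ltW xb1).
Qed.

Lemma min_test_le (Q : R) (psi psi' : R -> R) (a c M' : R) : 0 < Q ->
  quasisuperminimizer A n%:R Q u -> test_profile psi psi' a c ->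
  (forall t : R, 0 < t < 1 -> 0 <= psi t) ->
  (forall t : R, 0 < t < 1 -> `|psi' t| <= M') ->
  wint (fun t => (psi t != 0)%R%:R * `|min_slope t| ^+ n) <=
  Q * wint (fun t => (psi t != 0)%R%:R * `|min_slope t + psi' t| ^+ n).
Proof.
move=> Q0 [[_ wu _] qu] tpsi psi0 psi'M; have n0 : (0 < n)%N by exact: ltn_trans n2.
have oA := @open_annulus R n.
have [a0 c1 spsi dpsi [cpsi' psiab]] := tpsi.
have W := W1p0_test_function n0 oA (test_function_radial tpsi).
have H := qu _ W; have gphi := radial_test_weak_gradient tpsi.
have wuphi := is_weak_gradientD oA (gradientP wu) gphi.
have gu := gradient_min wu.
have guphi : {ae mu, forall x, A x ->
    gradient A (u \+ radial_test psi) x = radial_gradient (fun t => min_slope t + psi' t) x}.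
  apply: filterS2 (gradient_ae oA wuphi) gu => x + + Ax => /(_ Ax) -> /(_ Ax) ->.
  by apply/rowP => i; rewrite !mxE mulrDl.
have mpsi : measurable01 psi.
  by apply: measurable01_continuous => t t01; exact: is_derive_continuous1 (dpsi t t01).
have mpsi' := measurable01_continuous cpsi'.
have phiE x : A x -> radial_test psi x = psi (lgr x) by move=> Ax; rewrite radial_testE.
have E1 := integral_energy_radial n0 wu gu measurable01_min_slope min_slope_bound mpsi phiE.
have wd : weakly_differentiable A (u \+ radial_test psi) by eexists; exact: wuphi.
have mms : measurable01 (fun t => min_slope t + psi' t).
  exact: measurable_funD measurable01_min_slope mpsi'.
have msM (t : R) : 0 < t < 1 -> `|min_slope t + psi' t| <= M + M'.
  by move=> t01; apply: le_trans (ler_normD _ _) _; apply: lerD; [exact: min_slope_bound|exact: psi'M].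
have E2 := integral_energy_radial n0 wd guphi mms msM mpsi phiE.
rewrite -lee_fin EFinM -E1 -E2; apply: H.
by apply: aeW => x Ax; rewrite radial_testE//; exact/psi0/lgr_annulus.
Qed.

(* [min (f1, f2)] is compared with the identity profile, i.e. with [lgr] itself. *)
Lemma min_energy_le (Q L : R) : 0 < Q -> 0 < L -> b < 1 ->
  smooth_on A (f1 \o @lgr R n) -> smooth_on A (f2 \o @lgr R n) ->
  (forall t : R, 0 < t < 1 -> t < b -> f1 t < f2 t) ->
  (forall t : R, 0 < t < 1 -> 0 <= f1 t) -> (forall t : R, 0 < t < 1 -> 0 <= f2 t) ->
  (forall t : R, 0 < t < 1 -> f2 t < t) ->
  (forall t : R, 0 < t < 1 -> t - f2 t <= L * (1 - t)) ->
  quasisuperminimizer A n%:R Q u ->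
  wint (fun t => `|min_slope t| ^+ n) <= Q * wint (fun=> 1).
Proof.
move=> Q0 L0 b1 s1 s2 f12 f10 f20 f2t f2L qu; have n0 : (0 < n)%N by exact: ltn_trans n2.
pose h (k : nat) : R := k.+1%:R^-1; have h0 k : 0 < h k by rewrite invr_gt0.
have hl : h @ \oo --> (0 : R) by exact: cvg_harmonic.
(* [Y k] smooths (f2 - f1)^+, so [t - f2 t + Y k t] smooths t - min (f1, f2). Subtracting [h k] and
   smoothing the positive part once more gives an admissible perturbation [psi k]. *)
pose Y k t := sramp (h k) (f2 t - f1 t).
pose X k t := t - f2 t + Y k t - h k.
pose psi k t := sramp (h k) (X k t).
pose Y' k t := dsramp (h k) (f2 t - f1 t) * (f2' t - f1' t).
pose psi' k t := dsramp (h k) (X k t) * (1 - f2' t + Y' k t).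
have dX k (t : R) : 0 < t < 1 -> is_derive t 1 (X k) (1 - f2' t + Y' k t).
  move=> t01; have dY := @is_derive_comp R R _ (fun t => f2 t - f1 t) t 1 _ _
    (is_derive_sramp (h k) _) (isD_sub (df2 t01) (df1 t01)).
  apply: (is_derive_eq (isD_sub (isD_add (isD_sub (is_derive_id t 1) (df2 t01)) dY) (isD_cst (h k) t 1))).
  by rewrite subr0.
have dpsi k (t : R) : 0 < t < 1 -> is_derive t 1 (psi k) (psi' k t).
  by move=> t01; exact: (is_derive_comp (is_derive_sramp (h k) (X k t)) (dX k t t01)).
have cpsi' k (t : R) : 0 < t < 1 -> {for t, continuous (psi' k)}.
  move=> t01; have cX := is_derive_continuous1 (dX k t t01).
  have c1 := is_derive_continuous1 (df1 t01); have c2 := is_derive_continuous1 (df2 t01).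
  apply: cont_mul; first by apply: cont_comp => //; exact: continuous_dsramp.
  apply: cont_add.
    by apply: cont_add; [exact: cst_continuous|exact: cont_opp (cf2' t01)].
  apply: cont_mul; last by apply: cont_add; [exact: cf2'|exact: cont_opp (cf1' t01)].
  apply: (@cont_comp _ _ _ _ (fun t => f2 t - f1 t)); last exact: continuous_dsramp.
  by apply: cont_add => //; exact: cont_opp.
have M0 : 0 <= M.
  by apply: le_trans (f1'M (t := 2^-1) _) => //; rewrite invr_gt0 invf_lt1 ?ltr1n// ltr0n.
have psi'M k (t : R) : 0 < t < 1 -> `|psi' k t| <= 1 + 3 * M.
  move=> t01; have /andP[d0 d1] := dsramp_bound (X k t) (h0 k).
  have /andP[e0 e1] := dsramp_bound (f2 t - f1 t) (h0 k).
  have B1 := f1'M t01; have B2 := f2'M t01.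
  rewrite /psi' normrM ger0_norm// -[leRHS]mul1r; apply: ler_pM => //.
  rewrite (_ : 1 + 3 * M = 1 + M + 1 * (M + M)); last by ring.
  apply: le_trans (ler_normD _ _) _; apply: lerD.
    by apply: le_trans (ler_normB _ _) _; rewrite normr1 lerD2l.
  rewrite /Y' normrM ger0_norm//; apply: ler_pM => //.
  by apply: le_trans (ler_normB _ _) _; exact: lerD.
(* Where [X k] is positive, [h k] is less than t - min (f1, f2), hence less than [t]. Beyond [b] the
   term [Y k] vanishes, and [t - f2 t <= L * (1 - t)] keeps [t] away from 1. *)
have psi_supp k (t : R) : 0 < t < 1 -> psi k t != 0 -> h k <= t <= Num.max b (1 - h k / L).
  move=> t01 pt; have /andP[t0 t1] := t01.
  have X0 : 0 < X k t.
    by rewrite ltNge; apply: contraNN pt => Xt; rewrite /psi; have [->] := sramp_le0 (h0 k) Xt.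
  have /andP[Y0 Ym] := sramp_bound (f2 t - f1 t) (h0 k).
  have ff1 := f10 t t01; have ff2 := f20 t t01.
  move: X0; rewrite /X -/(Y k t) subr_gt0 => X0; apply/andP; split.
    apply/ltW/(lt_le_trans X0); apply: (@le_trans _ _ (t - f2 t + Num.max (f2 t - f1 t) 0)).
      by rewrite lerD2l.
    by have [_|_] := leP (f2 t - f1 t) 0; lra.
  rewrite le_max; have [//|bt] := leP t b.
  have Yt : Y k t = 0.
    by have [] := @sramp_le0 _ (h k) (f2 t - f1 t) (h0 k) => //; rewrite subr_le0 f2_le.
  apply/orP; right; rewrite lerBrDl -lerBrDr ler_pdivrMr// mulrC.
  by apply: le_trans (f2L t t01); move: X0; rewrite Yt addr0 => /ltW.
have tpsi k : test_profile (psi k) (psi' k) (h k) (Num.max b (1 - h k / L)).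
  split => //; [| |exact: dpsi|by split; [exact: cpsi'|exact: psi_supp]].
  - by rewrite gt_max b1 ltrBlDr ltrDl divr_gt0.
  apply: smooth_sramp.
  have sY : smooth_on A (Y k \o @lgr R n).
    apply: smooth_sramp.
    apply: (smooth_eq (smooth_add s2 (smooth_mul (smooth_cst A (-1)) s1))) => x _ /=.
    by rewrite mulN1r.
  have sX := smooth_add (smooth_add (smooth_add (@smooth_lgr R n) (smooth_mul (smooth_cst A (-1)) s2)) sY)
    (smooth_cst A (- h k)).
  by apply: (smooth_eq sX) => x _ /=; rewrite mulN1r.
have psi0 k (t : R) : 0 < t < 1 -> 0 <= psi k t.
  by move=> _; have /andP[] := sramp_bound (X k t) (h0 k).
pose ms k t := (psi k t != 0)%R%:R : R.
have ms1 k t : 0 <= ms k t <= 1 by rewrite /ms; case: (_ != _); rewrite ?lexx ler01.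
have mpsi k : measurable01 (ms k).
  apply: measurable01_neq0; apply: measurable01_continuous => t t01.
  exact: is_derive_continuous1 (dpsi k t t01).
have mmin := measurable01_min_slope.
have Xl (t : R) : 0 < t < 1 -> t != b -> exists2 l : R, 0 < l & (fun k => X k t) @ \oo --> l.
  move=> t01 tb; exists (t - f2 t + Num.max (f2 t - f1 t) 0).
    by rewrite ltr_pwDl ?le_max ?lexx ?orbT// subr_gt0 f2t.
  rewrite -[X in _ --> X]subr0; apply: cvgB => //; apply: cvgD; first exact: cvg_cst.
  exact: cvg_sramp.
have msl (t : R) : 0 < t < 1 -> t != b -> (fun k => ms k t) @ \oo --> (1 : R).
  move=> t01 tb; have [l l0 Xk] := Xl t t01 tb.
  apply: (@cvg_trans _ ((fun=> 1 : R) @ \oo)); last exact: cvg_cst.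
  apply: near_eq_cvg; near=> k; rewrite /ms; have -> // : psi k t != 0.
  by rewrite gt_eqF// sramp_gt0//; near: k; exact: (cvgr_gt l Xk).
have psi'l (t : R) : 0 < t < 1 -> t != b -> (fun k => psi' k t) @ \oo --> 1 - min_slope t.
  move=> t01 tb; have [l l0 Xk] := Xl t t01 tb.
  rewrite -[X in _ --> X]mul1r; apply: cvgM; first exact: (cvg_dsramp h0 hl l0 Xk).
  rewrite /min_slope; have [tb1|bt] := ltP t b.
    have -> : 1 - f1' t = 1 - f2' t + 1 * (f2' t - f1' t) by ring.
    apply: cvgD; first exact: cvg_cst.
    apply: cvgM; last exact: cvg_cst.
    by apply: (@cvg_dsramp _ h (fun=> f2 t - f1 t) (f2 t - f1 t)) => //; [rewrite subr_gt0 f12|exact: cvg_cst].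
  rewrite (_ : (fun k => _) = cst (1 - f2' t)); first exact: cvg_cst.
  apply/funext => k; rewrite /Y'; have [|_ ->] := @sramp_le0 _ (h k) (f2 t - f1 t) (h0 k).
    by rewrite subr_le0 f2_le// lt_neqAle eq_sym tb.
  by rewrite mul0r addr0.
(* In the limit the support fills the whole annulus and [min_slope + psi' k] tends to 1, the slope
   of the identity. *)
have H1 : (fun k => wint (fun t => ms k t * `|min_slope t| ^+ n)) @ \oo -->
    wint (fun t => `|min_slope t| ^+ n).
  apply: (@wint_cvg _ _ (M ^+ n) b) => //.
  - by move=> k; exact: measurable_funM (mpsi k) (measurable01_normX mmin).
  - exact: measurable01_normX.
  - move=> k t t01; have /andP[m0 m1] := ms1 k t.
    rewrite normrM normrX normr_id ger0_norm// -[leRHS]mul1r; apply: ler_pM => //.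
    by rewrite lerXn2r ?nnegrE// min_slope_bound.
  - move=> t t01 tb; rewrite -[X in _ --> X]mul1r.
    by apply: cvgM; [exact: msl|exact: cvg_cst].
have H2 : (fun k => wint (fun t => ms k t * `|min_slope t + psi' k t| ^+ n)) @ \oo --> wint (fun=> 1).
  apply: (@wint_cvg _ _ ((M + (1 + 3 * M)) ^+ n) b) => //.
  - move=> k; have mk : measurable01 (fun t => min_slope t + psi' k t).
      exact: measurable_funD mmin (measurable01_continuous (cpsi' k)).
    exact: measurable_funM (mpsi k) (measurable01_normX mk).
  - exact: measurable_cst.
  - move=> k t t01; have /andP[m0 m1] := ms1 k t.
    rewrite normrM normrX normr_id ger0_norm// -[leRHS]mul1r; apply: ler_pM => //.
    rewrite lerXn2r ?nnegrE//; first by rewrite addr_ge0 ?addr_ge0 ?mulr_ge0.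
    by apply: le_trans (ler_normD _ _) _; apply: lerD; [exact: min_slope_bound|exact: psi'M].
  - move=> t t01 tb; rewrite -[X in _ --> X]mul1r.
    apply: cvgM; first exact: msl.
    have -> : (1 : R) = `|min_slope t + (1 - min_slope t)| ^+ n by rewrite addrC subrK normr1 expr1n.
    have cn (y : R) : {for y, continuous (fun y : R => `|y| ^+ n)}.
      by apply: (@cont_comp _ _ _ (fun y : R => y ^+ n)); [exact: norm_continuous|exact: exprn_continuous].
    apply: (cvg_comp (fun k => min_slope t + psi' k t) (fun y : R => `|y| ^+ n) _ (cn _)).
    by apply: cvgD; [exact: cvg_cst|exact: psi'l].
apply: (ler_cvg_to H1 (cvgM (cvg_cst Q) H2)); apply: nearW => k.
exact: (min_test_le Q0 qu (tpsi k) (psi0 k) (psi'M k)).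
Unshelve. all: by end_near. Qed.

(** A convenient algebra of functions on which [wint] is linear. *)
Definition tame (g : R -> R) :=
  measurable01 g /\ exists K : R, forall t : R, 0 < t < 1 -> `|g t| <= K.

Lemma tame_cst (c : R) : tame (fun=> c).
Proof. by split; [exact: measurable_cst|exists `|c|]. Qed.

Lemma tame_add (g h : R -> R) : tame g -> tame h -> tame (fun t => g t + h t).
Proof.
move=> [mg [K gK]] [mh [K' hK]]; split; first exact: measurable_funD mg mh.
exists (K + K') => t t01; apply: le_trans (ler_normD _ _) _.
by apply: lerD; [exact: gK|exact: hK].
Qed.

Lemma tame_mul (g h : R -> R) : tame g -> tame h -> tame (fun t => g t * h t).
Proof.
move=> [mg [K gK]] [mh [K' hK]]; split; first exact: measurable_funM mg mh.
by exists (K * K') => t t01; rewrite normrM; apply: ler_pM => //; [exact: gK|exact: hK].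
Qed.

Lemma tame_exp (g : R -> R) (k : nat) : tame g -> tame (fun t => g t ^+ k).
Proof.
move=> tg; elim: k => [|k IHk]; first exact: tame_cst.
by under [X in tame X]eq_fun do rewrite exprS; exact: tame_mul.
Qed.

Lemma tame_lt (c : R) : tame (fun t => (t < c)%R%:R).
Proof.
split; first exact: measurable01_lt.
by exists 1 => t _; case: (_ < _); rewrite ?normr1 ?normr0.
Qed.

Lemma tame_continuous (g : R -> R) (K : R) : (forall t : R, 0 < t < 1 -> {for t, continuous g}) ->
  (forall t : R, 0 < t < 1 -> `|g t| <= K) -> tame g.
Proof. by move=> cg gK; split; [exact: measurable01_continuous|exists K]. Qed.

Lemma wintD (g h : R -> R) : tame g -> tame h -> wint (fun t => g t + h t) = wint g + wint h.
Proof.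
move=> [mg [K gK]] [mh [K' hK]]; rewrite /wint.
under eq_Rintegral do rewrite mulrDr.
apply: RintegralD; [exact: open_measurable_rV (@open_annulus R n)|exact: wint_integrable gK|].
exact: wint_integrable hK.
Qed.

Lemma wintZ (c : R) (g : R -> R) : tame g -> wint (fun t => c * g t) = c * wint g.
Proof.
move=> [mg [K gK]]; rewrite /wint.
under eq_Rintegral do rewrite mulrCA.
apply: RintegralZl; first exact: open_measurable_rV (@open_annulus R n).
exact: wint_integrable gK.
Qed.

Lemma eq_wint (g h : R -> R) : (forall t : R, 0 < t < 1 -> g t = h t) -> wint g = wint h.
Proof. by move=> gh; apply: eq_Rintegral => x /set_mem/lgr_annulus/gh ->. Qed.

(** The gain is the convexity defect of [f1'] relative to the tangent at [al], the loss is the gap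
    between the chord line and [f2'^n]. The energy of the minimum equals [Q] times that of the
    identity plus gain minus loss, so the energy inequality is equivalent to the claim. *)
Lemma min_gain_le_loss (Q L al : R) : 0 < Q -> 0 < L -> 0 < b < 1 ->
  smooth_on A (f1 \o @lgr R n) -> smooth_on A (f2 \o @lgr R n) ->
  (forall t : R, 0 < t < 1 -> (f1 t < f2 t) = (t < b)) ->
  (forall t : R, 0 < t < 1 -> 0 <= f1 t) -> (forall t : R, 0 < t < 1 -> 0 <= f2 t) ->
  (forall t : R, 0 < t < 1 -> f2 t < t) ->
  (forall t : R, 0 < t < 1 -> t - f2 t <= L * (1 - t)) ->
  (forall t : R, 0 < t < 1 -> 0 <= f1' t) -> (forall t : R, 0 < t < 1 -> 0 <= f2' t) ->
  (forall t : R, 0 < t < 1 -> t < b -> f2' t = al) -> tline n Q al = al ^+ n ->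
  quasisuperminimizer A n%:R Q u ->
  wint (fun t => (t < b)%R%:R * (f1' t ^+ n - tangent n al (f1' t))) <=
  wint (fun t => tline n Q (f2' t) - f2' t ^+ n).
Proof.
move=> Q0 L0 /andP[b0 b1] s1 s2 f12 f10 f20 f2t f2L f1'0 f2'0 f2'al Lal qu.
have n0 : (0 < n)%N by exact: ltn_trans n2.
have f12' (t : R) : 0 < t < 1 -> t < b -> f1 t < f2 t by move=> t01; rewrite f12.
have E := min_energy_le Q0 L0 b1 s1 s2 f12' f10 f20 f2t f2L qu.
have T1 : tame f1' := tame_continuous cf1' f1'M.
have T2 : tame f2' := tame_continuous cf2' f2'M.
have TN (g : R -> R) : tame g -> tame (fun t => - g t).
  by move=> tg; under [X in tame X]eq_fun do rewrite -mulN1r; apply: tame_mul => //; exact: tame_cst.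
have TB (g h : R -> R) : tame g -> tame h -> tame (fun t => g t - h t).
  by move=> tg th; apply: tame_add => //; exact: TN.
have TZ (c : R) (g : R -> R) : tame g -> tame (fun t => c * g t) by exact/tame_mul/tame_cst.
have TT (c : R) (g : R -> R) : tame g -> tame (fun t => tangent n c (g t)).
  by move=> tg; apply: (TB); [exact: TZ|exact: tame_cst].
set gain := fun t => _ * (_ - tangent n al _).
set loss := fun t => tline _ _ _ - _.
have tgain : tame gain.
  by apply: tame_mul; [exact: tame_lt|apply: (TB); [exact: tame_exp|exact: TT]].
have tloss : tame loss.
  apply: (TB); last exact: tame_exp.
  by apply: (TZ); apply: (TB); [exact: TZ|exact: tame_cst].
(* The function [t - f2 t] is positive inside and tends to 0 at both ends. *)
have B1 : wint (fun t => 1 - f2' t) = 0.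
  rewrite -[RHS](@wint_derive_gt0 (fun t => t - f2 t) (fun t => 1 - f2' t) (1 + M) n2).
  - by apply: eq_wint => t t01; rewrite subr_gt0 f2t// mul1r.
  - apply: (smooth_eq (smooth_add (@smooth_lgr R n) (smooth_mul (smooth_cst A (-1)) s2))) => x _ /=.
    by rewrite mulN1r.
  - by move=> t t01; exact: isD_sub (is_derive_id t 1) (df2 t01).
  - by move=> t t01; apply: cont_add; [exact: cst_continuous|exact: cont_opp (cf2' t01)].
  - by move=> t t01; apply: le_trans (ler_normB _ _) _; rewrite normr1 lerD2l f2'M.
  - move=> eta eta0; exists eta, (1 - eta / L); split => //.
      by rewrite ltrBlDr ltrDl divr_gt0.
    move=> t t01 te; have ff2 := f20 t t01; apply/andP; split; first by lra.
    rewrite lerBrDl -lerBrDr ler_pdivrMr// mulrC.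
    exact: le_trans (ltW te) (f2L t t01).
(* On (0, b), [f2 - f1] is positive; it is below [t] near 0 and is not positive beyond [b], so its
   positive part tends to 0 at both ends. *)
have B2 : wint (fun t => (t < b)%R%:R * (f2' t - f1' t)) = 0.
  rewrite -[RHS](@wint_derive_gt0 (fun t => f2 t - f1 t) (fun t => f2' t - f1' t) (M + M) n2).
  - by apply: eq_wint => t t01; rewrite subr_gt0 f12.
  - apply: (smooth_eq (smooth_add s2 (smooth_mul (smooth_cst A (-1)) s1))) => x _ /=.
    by rewrite mulN1r.
  - by move=> t t01; exact: isD_sub (df2 t01) (df1 t01).
  - by move=> t t01; apply: cont_add; [exact: cf2'|exact: cont_opp (cf1' t01)].
  - by move=> t t01; apply: le_trans (ler_normB _ _) _; apply: lerD; [exact: f2'M|exact: f1'M].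
  - move=> eta eta0; exists eta, b; split => // t t01 te.
    have ff1 := f10 t t01; have ff2 := f2t t t01; apply/andP; split; first by lra.
    by rewrite ltW// -f12// -subr_gt0 (lt_trans eta0).
have tB1 : tame (fun t => 1 - f2' t) by apply: (TB) => //; exact: tame_cst.
have tB2 : tame (fun t => (t < b)%R%:R * (f2' t - f1' t)).
  by apply: tame_mul; [exact: tame_lt|exact: TB].
(* A pointwise identity. For t < b the loss is 0, since [f2' t = al] is a crossing; for t >= b the
   gain and the [B2] term carry the factor 0. *)
have EE : wint (fun t => `|min_slope t| ^+ n) =
    wint (fun t => Q * 1 + (gain t + (- loss t +
      (- (n%:R * al ^+ n.-1) * ((t < b)%R%:R * (f2' t - f1' t)) + - (Q * n%:R) * (1 - f2' t))))).
  have n1 : n%:R = n.-1%:R + 1 :> R by rewrite natr1 prednK.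
  apply: eq_wint => t t01; rewrite /gain /loss /min_slope /tangent.
  have [tb|tb] := ltP t b.
    rewrite ger0_norm ?f1'0// f2'al// Lal subrr.
    have E1 : al ^+ n = al ^+ n.-1 * al by rewrite -exprSr prednK.
    rewrite !mul1r; apply/eqP; rewrite -subr_eq0; apply/eqP.
    transitivity (al ^+ n - tline n Q al); last by rewrite Lal subrr.
    by rewrite E1 /tline; move: (f1' t ^+ n) (al ^+ n.-1) => p q; rewrite n1; ring.
  rewrite ger0_norm ?f2'0// !mul0r mulr0 !add0r /tline.
  by move: (f2' t ^+ n) => p; rewrite n1; ring.
move: E; rewrite {}EE wintD; [|by apply: (TZ); exact: tame_cst|]; last first.
  apply: tame_add => //; apply: tame_add; first exact: TN.
  by apply: tame_add; exact: TZ.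
rewrite wintZ ?gerDl; last exact: tame_cst.
rewrite wintD//; last by apply: tame_add; [exact: TN|apply: tame_add; exact: TZ].
rewrite wintD; [|exact: TN|by apply: tame_add; exact: TZ].
rewrite wintD; [|exact: TZ|exact: TZ].
rewrite !wintZ// B1 B2 !mulr0 !addr0.
rewrite (_ : wint (fun t => - loss t) = - wint loss) ?subr_le0//.
by rewrite -mulN1r -wintZ//; apply: eq_wint => t _; rewrite mulN1r.
Qed.

End minimum.

End radial_test.

(** * Choice of the two profiles *)

Section profiles.
Context (R : realType).

Lemma is_derive_MVT (f f' : R -> R) (x y : R) : x < y ->
  (forall t : R, x <= t <= y -> is_derive t 1 f (f' t)) ->
  exists z : R, x < z < y /\ f y - f x = f' z * (y - x).
Proof.
move=> xy df; have [||z] := @MVT R f f' x y xy.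
- by move=> t; rewrite in_itv/= => /andP[xt ty]; apply: df; rewrite !ltW.
- apply: continuous_in_subspaceT => t; rewrite inE/= in_itv/= => xty.
  exact: is_derive_continuous1 (df t xty).
- by rewrite in_itv/= => zxy E; exists z.
Qed.

(* [k] is strictly convex with [k 0 = 0], hence changes sign once. *)
Lemma convex_sign_change (k k' : R -> R) (d a : R) : 0 < d < a ->
  (forall t : R, 0 <= t <= a -> is_derive t 1 k (k' t)) ->
  (forall s t : R, 0 <= s -> s < t -> k' s < k' t) ->
  k 0 = 0 -> k' d <= 0 -> 0 < k a ->
  exists b : R, d < b < a /\ forall t : R, 0 < t <= a -> (k t < 0) = (t < b).
Proof.
move=> /andP[d0 da] dk k'lt k0 k'd ka.
have mvt (x y : R) : 0 <= x -> x < y -> y <= a -> exists z : R, x < z < y /\ k y - k x = k' z * (y - x).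
  move=> x0 xy ya; apply: is_derive_MVT => // t /andP[xt ty]; apply: dk.
  by rewrite (le_trans x0)//= (le_trans ty).
have kd : k d < 0.
  have [z [/andP[z0 zd]]] := mvt 0 d (lexx _) d0 (ltW da); rewrite k0 !subr0 => ->.
  by rewrite pmulr_llt0// (lt_le_trans (k'lt _ _ (ltW z0) zd)).
have ck : {within `[d, a], continuous k}.
  apply: continuous_in_subspaceT => t; rewrite inE/= in_itv/= => /andP[dt ta].
  by apply: is_derive_continuous1 (dk t _); rewrite ta (le_trans (ltW d0)).
have [|b] := @IVT _ k d a 0 (ltW da) ck.
  by rewrite ge_min le_max (ltW kd) (ltW ka) orbT.
rewrite in_itv/= => /andP[db ba] kb.
have db' : d < b by rewrite lt_neqAle db andbT; apply: contraTneq kd => ->; rewrite kb ltxx.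
have ba' : b < a by rewrite lt_neqAle ba andbT; apply: contraTneq ka => <-; rewrite kb ltxx.
have b0 : 0 < b by exact: lt_trans db'.
exists b; split; first by rewrite db'.
move=> t /andP[t0 ta]; have [tb|bt|->] := ltgtP t b; last by rewrite kb ltxx.
- rewrite ltNge; apply/negP => kt.
  have [z [/andP[z0 zt]]] := mvt 0 t (lexx _) t0 ta; rewrite k0 !subr0 => E1.
  have [y [/andP[ty yb]]] := mvt t b (ltW t0) tb ba; rewrite kb sub0r => E2.
  have k'z : 0 <= k' z by move: kt; rewrite E1 pmulr_lge0.
  have k'y : 0 < k' y by apply: (le_lt_trans k'z); apply: k'lt; [exact: ltW|exact: lt_trans ty].
  have bt : 0 < b - t by rewrite subr_gt0.
  by have := mulr_gt0 k'y bt; rewrite -E2 oppr_gt0 ltNge kt.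
- apply/negbTE; rewrite -leNgt ltW//.
  have [z [/andP[z0 zb]]] := mvt 0 b (lexx _) b0 ba; rewrite kb k0 !subr0 => /esym/eqP.
  rewrite mulf_eq0 (gt_eqF b0) orbF => /eqP k'z.
  have [y [/andP[yb yt]]] := mvt b t (ltW b0) bt ta; rewrite kb subr0 => ->.
  by rewrite mulr_gt0 ?subr_gt0// -k'z; apply: k'lt; [exact: ltW|exact: lt_trans yb].
Qed.

(** The constant [C] is fixed first, large enough for the profile to exceed [be * t] from [a] on;
    then [d] small enough for its slope to be below [al] on (0, d). Convexity yields the single
    crossing [b] with the line of slope [al]. *)
Lemma power_profile (g al be a : R) : 1 < g -> 0 < al < be -> 0 < a -> exists C d b : R,
  [/\ 0 < C, 0 < d, d < b < a,
    (forall t : R, 0 < t <= a -> (powf C g d t - powf C g d 0 < al * t) = (t < b)) &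
    (forall t : R, a <= t -> be * t < powf C g d t - powf C g d 0) /\
    (forall t : R, 0 < t < d -> powf (g * C) (g - 1) d t < al)].
Proof.
move=> g1 /andP[al0 albe] a0; have g0 : 0 < g by exact: lt_trans g1.
have be0 : 0 < be by exact: lt_trans albe.
have g10 : 0 < g - 1 by rewrite subr_gt0.
(* Chosen so that C a^(g-1) = be. *)
pose C := be / expR ((g - 1) * ln a); have C0 : 0 < C by rewrite divr_gt0// expR_gt0.
have gC0 : 0 < g * C by rewrite mulr_gt0.
(* The first term makes g C (2 d)^(g-1) <= al, with 2 d = exp(m); the second makes 2 d <= a. *)
pose m := Num.min (ln (al / (g * C)) / (g - 1)) (ln a).
pose d := expR m / 2; have d0 : 0 < d by rewrite divr_gt0// expR_gt0.
have dd : d + d = expR m by rewrite /d -splitr.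
have da : d < a.
  apply: (@lt_le_trans _ _ (d + d)); first by rewrite ltrDl.
  by rewrite dd -[leRHS](lnK (x := a)) ?posrE// ler_expR ge_min lexx orbT.
pose F := powf C g d; pose F' := powf (g * C) (g - 1) d.
have F'd : F' d <= al.
  rewrite /F' /powf dd expRK -ler_pdivlMl// -[leRHS](lnK (x := _ * al)) ?posrE ?mulr_gt0 ?invr_gt0//.
  by rewrite ler_expR mulrC -ler_pdivlMr// [(g * C)^-1 * al]mulrC ge_min lexx.
have F'lt (s t : R) : 0 <= s -> s < t -> F' s < F' t.
  by move=> s0 st; apply: powf_lt => //; rewrite ltr_wpDl.
(* With s(t) = C (t + d)^(g-1), F t - F 0 = t s(t) + d (s(t) - s(0)), and s(t) > be for t >= a. *)
have big (t : R) : a <= t -> be * t < F t - F 0.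
  move=> at1; have t0 : 0 < t by exact: lt_le_trans at1.
  rewrite /F (@powf_split R C g d t) ?addr_gt0// (@powf_split R C g d 0) ?add0r//.
  have S0 : powf C (g - 1) d 0 < powf C (g - 1) d t by apply: powf_lt; rewrite ?add0r.
  have S1 : be < powf C (g - 1) d t.
    have {1}-> : be = powf C (g - 1) 0 a by rewrite /powf addr0 /C mulfVK// gt_eqF// expR_gt0.
    rewrite /powf ltr_pM2l// ltr_expR ltr_pM2l// addr0 ltr_ln ?posrE ?addr_gt0//.
    by rewrite (le_lt_trans at1)// ltrDl.
  rewrite mulrDl -addrA -mulrBr ltr_wpDr//; last by rewrite mulrC ltr_pM2l.
  by rewrite mulr_ge0 ?(ltW d0)// subr_ge0 ltW.
have [||||||b [bda bt]] := @convex_sign_change (fun t => F t - F 0 - al * t) (fun t => F' t - al) d a.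
- by rewrite d0.
- move=> t /andP[t0 _]; have td : 0 < t + d by rewrite ltr_wpDl.
  apply: (is_derive_eq (isD_sub (isD_sub (is_derive_powf C g td) (isD_cst (F 0) t 1))
    (isD_scale al (is_derive_id t 1)))).
  by rewrite subr0 mulr1.
- by move=> s t s0 st; rewrite ltrD2r F'lt.
- by rewrite subrr mulr0 subr0.
- by rewrite subr_le0.
- rewrite subr_gt0; apply: le_lt_trans (big a (lexx _)).
  by rewrite ler_wpM2r ?(ltW a0)// ltW.
exists C, d, b; split => //.
  by move=> t ta; rewrite -bt// subr_lt0.
split => // t /andP[t0 td]; apply: lt_le_trans F'd; exact: F'lt (ltW t0) td.
Qed.

(** A smooth version of the broken line through the origin with slope [al] before [c] and [be] after
    it. *)
Definition ramp (al be h c t : R) := al * t + (be - al) * sramp h (t - c).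
Definition dramp (al be h c t : R) := al + (be - al) * dsramp h (t - c).

Lemma is_derive_ramp (al be h c t : R) : is_derive t 1 (ramp al be h c) (dramp al be h c t).
Proof.
have d1 : is_derive t 1 (fun t : R => t - c) 1.
  by apply: (is_derive_eq (isD_sub (is_derive_id t 1) (isD_cst c t 1))); rewrite subr0.
have d2 := @is_derive_comp R R _ (fun t : R => t - c) t 1 _ _ (is_derive_sramp h (t - c)) d1.
apply: (is_derive_eq (isD_add (isD_scale al (is_derive_id t 1)) (isD_scale (be - al) d2))).
by rewrite !mulr1.
Qed.

Lemma continuous_dramp (al be h c : R) : continuous (dramp al be h c).
Proof.
move=> t; suff : {for t, continuous (dramp al be h c)} by [].
apply: cont_add; first exact: cst_continuous.
apply: cont_mul; first exact: cst_continuous.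
apply: (@cont_comp _ _ _ (dsramp h) (fun t => t - c)); last exact: continuous_dsramp.
by apply: cont_add; [exact: (fun B => @cvg_id _ _ B)|exact: cst_continuous].
Qed.

Lemma dramp_bound (al be h c t : R) : 0 < h -> al <= be -> al <= dramp al be h c t <= be.
Proof.
move=> h0 ab; have /andP[d0 d1] := dsramp_bound (t - c) h0.
have ab0 : 0 <= be - al by rewrite subr_ge0.
rewrite /dramp lerDl mulr_ge0//= -lerBrDl -[leRHS]mulr1.
by rewrite ler_wpM2l.
Qed.

Lemma ramp_le (al be h c t : R) : 0 < h -> t <= c -> ramp al be h c t = al * t /\ dramp al be h c t = al.
Proof.
move=> h0 tc; have [||s0 d0] := @sramp_le0 _ h (t - c) => //; first by rewrite subr_le0.
by rewrite /ramp /dramp s0 d0 mulr0 !addr0.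
Qed.

Section ramp_profile.
Context (al be s : R).
Context (al01 : 0 < al < 1) (be1 : 1 < be).
(** For a sharp corner the broken line reaches 1 at t = 1 exactly when the piece of slope [be] has
    length [lam]. With smoothing, that piece is lengthened to [s], and [h] solves
    [s * expR (- (h / s)) = lam], which restores the value 1 at t = 1. *)
Let lam := (1 - al) / (be - al).
Context (s01 : lam < s < 1).
Let h := s * ln (s / lam).
Let f t := ramp al be h (1 - s) t.

Let ab0 : 0 < be - al.
Proof. by rewrite subr_gt0; case/andP: al01 => _ /lt_trans; apply. Qed.

Let lam0 : 0 < lam.
Proof. by rewrite divr_gt0// subr_gt0; case/andP: al01. Qed.

Let s0 : 0 < s.
Proof. by case/andP: s01 => /(lt_trans lam0). Qed.

Lemma ramp_h_gt0 : 0 < h.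
Proof. by rewrite mulr_gt0// ln_gt0// ltr_pdivlMr// mul1r; case/andP: s01. Qed.

Let hsE : expR (- (h / s)) = lam / s.
Proof.
have sl : 0 < s / lam by exact: divr_gt0.
rewrite /h mulrC mulKf ?gt_eqF// expRN lnK ?posrE//.
by rewrite invfM invrK mulrC.
Qed.

Let ablam : (be - al) * lam = 1 - al.
Proof. by rewrite /lam mulrC divfK// gt_eqF. Qed.

Lemma ramp_at1 : f 1 = 1.
Proof.
rewrite /f /ramp subKr sramp_gt0E ?ramp_h_gt0// hsE mulr1.
have -> : (be - al) * (s * (lam / s)) = (be - al) * lam by field; rewrite gt_eqF.
by rewrite ablam addrC subrK.
Qed.

(** For the bound by [t]: past the break point, replacing the exponential factor by its value at t =
    1 gives the chord ending at (1, 1), which lies below the diagonal. The last bound is the mean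
    value theorem on [t, 1], with slope at most [be] and value 1 at 1. *)
Lemma ramp_bounds (t : R) : 0 < t < 1 ->
  [/\ al * t <= f t, f t < be * t, f t < t & t - f t <= (be - 1) * (1 - t)].
Proof.
move=> /andP[t0 t1]; have h0 := ramp_h_gt0; have /andP[al0 al1] := al01.
have /andP[sr0 sr1] := sramp_bound (t - (1 - s)) h0.
have s1 : s < 1 by case/andP: s01.
have mt : Num.max (t - (1 - s)) 0 < t by rewrite gt_max t0 andbT ltrBlDr ltrDl subr_gt0.
split.
- by rewrite /f /ramp lerDl mulr_ge0// ltW.
- rewrite /f /ramp -ltrBrDl -mulrBl ltr_pM2l//; exact: le_lt_trans mt.
- have [tc|ct] := leP t (1 - s).
    rewrite /f; have [-> _] := ramp_le al be h0 tc.
    by rewrite gtr_pMl.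
  have tcs : 0 < t - (1 - s) by rewrite subr_gt0.
  have ts : t - (1 - s) < s by lra.
  have E : expR (- (h / (t - (1 - s)))) < lam / s.
    rewrite -hsE ltr_expR ltrN2 ltr_pM2l//; rewrite ltf_pV2 ?posrE//.
  rewrite /f /ramp sramp_gt0E//.
  apply: (@lt_le_trans _ _ (al * t + (be - al) * ((t - (1 - s)) * (lam / s)))).
    by rewrite ltrD2l ltr_pM2l// ltr_pM2l.
  have -> : (be - al) * ((t - (1 - s)) * (lam / s)) = (1 - al) * ((t - (1 - s)) / s).
    by rewrite -ablam; ring.
  have : (t - (1 - s)) / s <= t.
    rewrite ler_pdivrMr// -subr_ge0 (_ : _ - _ = (1 - s) * (1 - t)); last by ring.
    by rewrite mulr_ge0// subr_ge0 ltW.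
  have al10 : 0 <= 1 - al by rewrite subr_ge0 ltW.
  by move=> /(ler_wpM2l al10); lra.
have [z [zt]] := is_derive_MVT t1 (fun x _ => is_derive_ramp al be h (1 - s) x).
rewrite -/(f 1) -/(f t) ramp_at1 => E.
have abe : al <= be by rewrite -subr_ge0 ltW.
have /andP[_ db] := dramp_bound (1 - s) z h0 abe.
have t10 : 0 <= 1 - t by rewrite subr_ge0 ltW.
have := ler_wpM2r t10 db; rewrite -E; lra.
Qed.

End ramp_profile.

End profiles.

(** * Positive gain, vanishing loss, and the conclusion *)

Lemma open_measure_gt0 (R : realType) (n : nat) (U : set 'rV[R]_n) : open U -> U !=set0 ->
  (0 < lebesgue_rV R n U)%E.
Proof.
move=> oU [x Ux]; have [q [Bx qU]] := open_rat_box oU Ux.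
have mB := @measurable_obox R n (rat_lo R q) (rat_hi R q).
apply: (@lt_le_trans _ _ (lebesgue_rV R n (obox (rat_lo R q) (rat_hi R q)))); last first.
  apply: le_measure; rewrite ?inE//; first exact: open_measurable_rV.
  by move=> y /obox_sub_cbox/qU.
have mI i : measurable (`]rat_lo R q ord0 i, rat_hi R q ord0 i[%classic : set R) by exact: measurable_itv.
have := lebesgue_rV_prod mI; rewrite -/(obox _ _) => ->.
rewrite (_ : (\prod_(i < n) _)%E = (\prod_(i < n) (rat_hi R q ord0 i - rat_lo R q ord0 i : R))%:E); last first.
  rewrite -prodEFin; apply: eq_bigr => i _; rewrite lebesgue_measure_itv /=.
  have := Bx i; rewrite /= in_itv/= => /andP[lo hi].
  by rewrite lte_fin (lt_trans lo hi).
rewrite lte_fin; apply: prodr_gt0 => i _; rewrite subr_gt0.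
by have := Bx i; rewrite /= in_itv/= => /andP[lo hi]; exact: lt_trans hi.
Qed.

Lemma lgr_surj (R : realType) (n : nat) (t : R) : (0 < n)%N -> 0 < t < 1 ->
  exists2 x : 'rV[R]_n, annulus R n x & lgr x = t.
Proof.
case: n => // n _ t01; pose x : 'rV[R]_n.+1 := \row_i (if i == ord0 then expR (- t) else 0).
have ex : enorm x = expR (- t).
  rewrite /enorm big_ord_recl big1 => [|i _]; first by rewrite mxE eqxx addr0 sqrtr_sqr ger0_norm ?expR_ge0.
  by rewrite mxE expr0n.
have tx : lgr x = t by rewrite /lgr ex expRK opprK.
by exists x => //; apply: lgr_gt0_annulus; rewrite tx.
Qed.

(** A zero integral would make [g] vanish almost everywhere, but the shell t < d is a nonempty open
    set and so has positive measure. *)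
Lemma wint_gt0 (R : realType) (n : nat) (g : R -> R) (d : R) : (0 < n)%N -> 0 < d -> tame n g ->
  (forall t : R, 0 < t < 1 -> 0 <= g t) -> (forall t : R, 0 < t < 1 -> t < d -> 0 < g t) ->
  0 < wint n g.
Proof.
move=> n0 d0 [mg [K gK]] g0 gd; have oA := @open_annulus R n.
have mA := open_measurable_rV oA.
have w0 x : annulus R n x -> 0 <= expR (lgr x) ^+ n * g (lgr x).
  by move=> Ax; rewrite mulr_ge0 ?exprn_ge0 ?expR_ge0//; exact/g0/lgr_annulus.
have ig := wint_integrable mg gK.
rewrite lt_neqAle Rintegral_ge0// andbT eq_sym; apply/negP => /eqP wg.
have I0 : (\int[lebesgue_rV R n]_(x in annulus R n) `|(expR (lgr x) ^+ n * g (lgr x))%:E| = 0)%E.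
  rewrite -[RHS]/(0 : R)%:E -wg /wint -(EFin_Rintegral mA ig); apply: eq_integral => x /set_mem Ax.
  by rewrite /= ger0_norm// w0.
have [+ _] := ae_eq_integral_abs (lebesgue_rV R n) mA (measurable_int _ ig).
move=> /(_ I0) [N [mN N0 subN]].
pose U := annulus R n `&` @enorm R n @^-1` [set y | expR (- d) < y].
have oU : open U.
  by apply: openI => //; apply: open_comp; [move=> x _; exact: continuous_enorm|exact: open_gt].
have UE x : annulus R n x -> U x <-> lgr x < d.
  move=> Ax; have ex : enorm x = expR (- lgr x) by rewrite expRN expR_lgr// invrK.
  by rewrite /U /= ex ltr_expR ltrN2; split => [[]|].
have U0 : U !=set0.
  pose t := Num.min d 1 / 2; have m0 : 0 < Num.min d 1 by rewrite lt_min d0 ltr01.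
  have tm : t < Num.min d 1 by rewrite /t ltr_pdivrMr// mulr2n mulrDr mulr1 ltrDl.
  have t0 : 0 < t by rewrite divr_gt0.
  move: tm; rewrite lt_min => /andP[td t1].
  have [x Ax xt] := @lgr_surj R n t n0 (introT andP (conj t0 t1)).
  by exists x; apply/(UE x Ax); rewrite xt.
have : (lebesgue_rV R n U <= 0)%E.
  rewrite -N0; apply: le_measure; rewrite ?inE//; first exact: open_measurable_rV.
  move=> x Ux; apply: subN => /= /(_ Ux.1) /= [] /eqP.
  have Ax := Ux.1; apply/negP; rewrite gt_eqF// mulr_gt0 ?exprn_gt0 ?expR_gt0// gd//.
    exact: lgr_annulus.
  exact/(UE x Ax).
by rewrite leNgt open_measure_gt0.
Qed.

(** Off the limiting break point, here called [lam], the slope of the ramp tends to [al] or to [be],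
    the two crossings, where the loss vanishes; dominated convergence concludes. *)
Lemma ramp_loss_cvg (R : realType) (n : nat) (Q al be lam : R) (h c : nat -> R) : (2 <= n)%N ->
  0 < Q -> 0 <= al <= be -> tline n Q al = al ^+ n -> tline n Q be = be ^+ n ->
  (forall k, 0 < h k) -> h @ \oo --> 0 -> c @ \oo --> lam ->
  (fun k => wint n (fun t => tline n Q (dramp al be (h k) (c k) t) - dramp al be (h k) (c k) t ^+ n))
    @ \oo --> (0 : R).
Proof.
move=> n2 Q0 /andP[al0 albe] La Lb h0 hl cl; have n0 : (0 < n)%N by exact: ltn_trans n2.
pose loss w := tline n Q w - w ^+ n.
have closs (w : R) : {for w, continuous loss}.
  apply: cont_add; last by apply: cont_opp; exact: exprn_continuous.
  apply: cont_mul; first exact: cst_continuous.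
  by apply: cont_add; [exact: mulrl_continuous|exact: cst_continuous].
have dr k t : al <= dramp al be (h k) (c k) t <= be by exact: dramp_bound.
have -> : (0 : R) = wint n (fun=> 0 : R).
  by rewrite -[RHS]mul1r -(@wintZ R n 1 (fun=> 0) (tame_cst n 0)) /wint; under eq_Rintegral do rewrite mulr0 mulr0; rewrite /Rintegral integral0.
apply: (@wint_cvg R n _ _ (Q * (n%:R * be + n.-1%:R) + be ^+ n) lam) => //.
- move=> k; apply: measurable01_continuous => t _.
  by apply: (@cont_comp _ _ _ loss); [exact: continuous_dramp|exact: closs].
- exact: measurable_cst.
- move=> k t t01; have /andP[d0 d1] := dr k t; have d0' := le_trans al0 d0.
  apply: le_trans (ler_normB _ _) _; apply: lerD.
    rewrite /tline normrM gtr0_norm// ler_pM2l//; apply: le_trans (ler_normB _ _) _.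
    by rewrite !ger0_norm ?mulr_ge0// lerD2r ler_wpM2l.
  by rewrite ger0_norm ?exprn_ge0// lerXn2r ?nnegrE// (le_trans d0').
move=> t t01 tl.
suff [w lw dw] : exists2 w : R, loss w = 0 & (fun k => dramp al be (h k) (c k) t) @ \oo --> w.
  by rewrite -lw; exact: (cvg_comp (fun k => dramp al be (h k) (c k) t) loss dw (closs w)).
have [tlam|lamt|/eqP] := ltgtP t lam; last by rewrite (negbTE tl).
  exists al; first by rewrite /loss La subrr.
  apply: (@cvg_trans _ ((fun=> al) @ \oo)); last exact: cvg_cst.
  apply: near_eq_cvg; near=> k; have [|_ ->//] := @ramp_le R al be (h k) (c k) t (h0 k).
  by rewrite ltW//; near: k; exact: (cvgr_gt lam cl).
exists be; first by rewrite /loss Lb subrr.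
have {2}-> : be = al + (be - al) * 1 by rewrite mulr1 addrC subrK.
apply: cvgD; first exact: cvg_cst.
apply: cvgM; first exact: cvg_cst.
apply: (@cvg_dsramp R h (fun k => t - c k) (t - lam)) => //; first by rewrite subr_gt0.
by apply: cvgB => //; exact: cvg_cst.
Unshelve. all: by end_near. Qed.

Lemma smooth_powf (R : realType) (n : nat) (C g d : R) : 0 < d ->
  smooth_on (annulus R n) (powf C g d \o @lgr R n).
Proof.
move=> d0; have pos x : annulus R n x -> 0 < lgr x + d.
  by move=> /lgr_annulus/andP[t0 _]; rewrite addr_gt0.
apply: smooth_mul; first exact: smooth_cst.
apply: (smooth_comp (@openT R) (@smooth1_expR R)) => //.
apply: smooth_mul; first exact: smooth_cst.
apply: (smooth_comp (@open_gt R 0) (@smooth1_ln R) pos).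
by apply: smooth_add; [exact: smooth_lgr|exact: smooth_cst].
Qed.

Lemma smooth_ramp (R : realType) (n : nat) (al be h c : R) :
  smooth_on (annulus R n) (ramp al be h c \o @lgr R n).
Proof.
apply: smooth_add; first by apply: smooth_mul; [exact: smooth_cst|exact: smooth_lgr].
apply: smooth_mul; first exact: smooth_cst.
by apply: smooth_sramp; apply: smooth_add; [exact: smooth_lgr|exact: smooth_cst].
Qed.

Theorem theorem1p2 (R : realType) (n : nat) (Q1 Q2 : R) :
  (2 <= n)%N -> 1 < Q1 -> Q1 <= Q2 ->
  exists u1 u2 : 'rV[R]_n -> R,
    [/\ quasisuperminimizer (annulus R n) n%:R Q1 u1,
        quasisuperminimizer (annulus R n) n%:R Q2 u2
      & ~ quasisuperminimizer (annulus R n) n%:R Q2 (u1 \min u2)].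
Proof.
move=> n2 Q1gt1 Q12; have Q2gt1 : 1 < Q2 by exact: lt_le_trans Q12.
have n0 : (0 < n)%N by exact: ltn_trans n2.
have Q10 : 0 < Q1 by exact: lt_trans Q1gt1.
have Q20 : 0 < Q2 by exact: lt_trans Q2gt1.
(* [g] is the larger crossing for [Q1]: it exceeds 1 and satisfies the condition on the exponent
   with equality. *)
have [_ [g [_ g1 _ Lg]]] := tline_crossings n2 Q1gt1.
have [al [be [al01 be1 Lal Lbe]]] := tline_crossings n2 Q2gt1.
have /andP[al0 al1] := al01; have albe : al < be by exact: lt_trans be1.
pose lam := (1 - al) / (be - al).
have lam0 : 0 < lam by rewrite divr_gt0// subr_gt0.
have lam1 : lam < 1 by rewrite ltr_pdivrMr ?subr_gt0// mul1r ltrD2r.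
(* Half of the limiting break point [1 - lam]. Since [s k <= lam + a] below, every [f2 k] has slope
   [al] up to [a], so [f1], [b] and the gain can be fixed before [k]. *)
pose a := (1 - lam) / 2; have a0 : 0 < a by rewrite divr_gt0// subr_gt0.
have aa : a + a = 1 - lam by rewrite -splitr.
have [C [d [b [C0 d0 /andP[db ba] bE [f1be f1'al]]]]] :=
  power_profile g1 (introT andP (conj al0 albe)) a0.
have b0 : 0 < b by exact: lt_trans db.
have a1 : a < 1 by lra.
have b01 : 0 < b < 1 by rewrite b0 (lt_trans ba).
have g0 : 0 < g by exact: lt_trans g1.
pose f1 t := powf C g d t - powf C g d 0; pose f1' := powf (g * C) (g - 1) d.
have td0 (t : R) : 0 < t < 1 -> 0 < t + d by move=> /andP[t0 _]; rewrite addr_gt0.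
have gC0 : 0 < g * C by rewrite mulr_gt0.
have df1 (t : R) : 0 < t < 1 -> is_derive t 1 f1 (f1' t).
  move=> /td0 td; apply: (is_derive_eq (isD_sub (is_derive_powf C g td) (isD_cst (powf C g d 0) t 1))).
  by rewrite subr0.
have cf1' (t : R) : 0 < t < 1 -> {for t, continuous f1'}.
  by move=> /td0 td; exact: is_derive_continuous1 (is_derive_powf _ _ td).
have f1'0 (t : R) : 0 < t < 1 -> 0 <= f1' t by move=> _; exact: ltW (powf_gt0 _ _ _ gC0).
have f10 (t : R) : 0 < t < 1 -> 0 <= f1 t.
  move=> /andP[t0 _]; rewrite subr_ge0 ltW//; apply: powf_lt => //.
  by rewrite add0r.
have s1 : smooth_on (annulus R n) (f1 \o @lgr R n).
  exact: smooth_add (smooth_powf n C g d0) (smooth_cst _ (- powf C g d 0)).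
pose s k := lam + a / k.+1%:R.
have s01 k : lam < s k < 1.
  have k0 : 0 < a / k.+1%:R by rewrite divr_gt0.
  have ka : a / k.+1%:R <= a by rewrite ler_pdivrMr// ler_peMr ?(ltW a0)// ler1n.
  by rewrite /s ltrDl k0 /= -ltrBrDl -aa (le_lt_trans ka)// ltrDl.
pose h k := s k * ln (s k / lam).
have h0 k : 0 < h k by exact: ramp_h_gt0.
have sl : s @ \oo --> lam.
  rewrite -[X in _ --> X]addr0; apply: cvgD; first exact: cvg_cst.
  rewrite -(mulr0 a); apply: cvgM; first exact: cvg_cst.
  exact: cvg_harmonic.
have hl : h @ \oo --> (0 : R).
  have sl1 : (fun k => s k / lam) @ \oo --> (1 : R).
    by rewrite -(@divff _ lam) ?gt_eqF//; apply: cvgM => //; exact: cvg_cst.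
  rewrite -(mulr0 lam); apply: cvgM => //; rewrite -[X in _ --> X]ln1.
  exact: (cvg_comp (fun k => s k / lam) (@ln R) sl1 (continuous_ln ltr01)).
pose f2 k := ramp al be (h k) (1 - s k); pose f2' k := dramp al be (h k) (1 - s k).
have ab (k : nat) (t : R) : al <= f2' k t <= be by apply: dramp_bound => //; exact: ltW.
have df2 k (t : R) : 0 < t < 1 -> is_derive t 1 (f2 k) (f2' k t).
  by move=> _; exact: is_derive_ramp.
have cf2' k (t : R) : 0 < t < 1 -> {for t, continuous (f2' k)}.
  by move=> _; exact: continuous_dramp.
have f2B k (t : R) : 0 < t < 1 ->
    [/\ al * t <= f2 k t, f2 k t < be * t, f2 k t < t & t - f2 k t <= (be - 1) * (1 - t)].
  by move=> t01; exact: (ramp_bounds al01 be1 (s01 k) t01).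
have f2a k (t : R) : t <= a -> f2 k t = al * t /\ f2' k t = al.
  move=> ta; apply: ramp_le => //; apply: le_trans ta _.
  have ka : a / k.+1%:R <= a by rewrite ler_pdivrMr// ler_peMr ?(ltW a0)// ler1n.
  by rewrite /s opprD addrA -aa -addrA lerDl subr_ge0.
(* Up to [a] the profile [f2 k] is the line of slope [al], which [f1] crosses once, at [b]; beyond
   [a] it stays below [be * t], which [f1] exceeds. *)
have f12 k (t : R) : 0 < t < 1 -> (f1 t < f2 k t) = (t < b).
  move=> t01; have /andP[t0 t1] := t01; have [ta|at1] := leP t a.
    by have [-> _] := f2a k t ta; rewrite bE ?t0.
  have [_ f2be _ _] := f2B k t t01.
  rewrite ltNge (ltW (lt_trans f2be (f1be t (ltW at1)))).
  by rewrite ltNge (ltW (lt_trans ba at1)).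
pose M := Num.max (f1' 1) be.
have f1'M (t : R) : 0 < t < 1 -> `|f1' t| <= M.
  move=> t01; rewrite ger0_norm ?f1'0// le_max ltW//; apply: powf_lt => //.
  - by rewrite subr_gt0.
  - exact: td0.
  - by case/andP: t01.
have f2'0 k t : 0 <= f2' k t by have /andP[al2 _] := ab k t; exact: le_trans (ltW al0) al2.
have f2'M k (t : R) : 0 < t < 1 -> `|f2' k t| <= M.
  by move=> _; rewrite ger0_norm// le_max; have /andP[_ ->] := ab k t; rewrite orbT.
pose gain (t : R) := (t < b)%R%:R * (f1' t ^+ n - tangent n al (f1' t)).
have tf1' : tame n f1' := tame_continuous n cf1' f1'M.
have tgain : tame n gain.
  apply: tame_mul; first exact: tame_lt.
  apply: tame_add; first exact: tame_exp.
  under [X in tame n X]eq_fun do rewrite -mulN1r.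
  apply: tame_mul; first exact: tame_cst.
  by apply: tame_add; [apply: tame_mul => //|]; exact: tame_cst.
have gain0 : 0 < wint n gain.
  apply: (@wint_gt0 R n gain d) => //.
    (* Nonnegativity is convexity of the power; below [d] the slope of [f1] is strictly less than
       [al], so strict convexity makes the gain positive there. *)
    move=> t t01; apply: mulr_ge0; first by [].
    by rewrite subr_ge0; apply: tangent_le => //; [exact: f1'0|exact: ltW].
  move=> t t01 td; rewrite /gain (lt_trans td db) mul1r subr_gt0.
  apply: tangent_lt => //; first exact: f1'0.
  by rewrite lt_eqF// f1'al// td andbT; case/andP: t01.
have cl : (fun k => 1 - s k) @ \oo --> 1 - lam by apply: cvgB => //; exact: cvg_cst.
have ale : 0 <= al <= be by rewrite !ltW.
have lossl := ramp_loss_cvg n2 Q20 ale Lal Lbe h0 hl cl.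
(* The gain is independent of [k] and positive, while the loss tends to 0. *)
have [k lossk] : exists k, wint n (fun t => tline n Q2 (f2' k t) - f2' k t ^+ n) < wint n gain.
  have [k _ H] := cvgr_lt _ lossl _ gain0.
  by exists k; exact: H (leqnn k).
exists (f1 \o @lgr R n), (f2 k \o @lgr R n); split.
- by apply: power_quasisuperminimizer => //; rewrite Lg.
- exact: (chord_quasisuperminimizer n2 Q20 (ltW al0) Lal Lbe (df2 k) (cf2' k) (fun t _ => ab k t)).
move=> qu; move: lossk; rewrite ltNge => /negP; apply.
have f2_lt (t : R) : 0 < t < 1 -> t < b -> f1 t <= f2 k t by move=> t01 tb; rewrite ltW// f12.
have f1_ge (t : R) : 0 < t < 1 -> b < t -> f2 k t <= f1 t.
  by move=> t01 bt; rewrite leNgt f12// -leNgt ltW.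
apply: (min_gain_le_loss n2 df1 (df2 k) cf1' (cf2' k) f1'M (f2'M k) f2_lt f1_ge Q20 (L := be - 1) _ b01 s1) => //.
- by rewrite subr_gt0.
- exact: smooth_ramp.
- exact: f12.
- move=> t t01; have [+ _ _ _] := f2B k t t01; apply: le_trans.
  by rewrite mulr_ge0 ?(ltW al0)//; case/andP: t01 => /ltW.
- by move=> t t01; have [_ _ ? _] := f2B k t t01.
- by move=> t t01; have [_ _ _ ?] := f2B k t t01.
- by move=> t t01 tb; have [_ ->] := f2a k t (ltW (lt_trans tb ba)).
Qed.
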